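(* Given pieces $G_1^*,\dots,G_h^*$ and a vertex pairing as in the context, the number $\mathcal G_h=R(G_1^*,\dots,G_h^*,\mathbf b')$ of (dual) ribbon graphs whose degenerating edges as $\mathbf b'(\epsilon)\to\mathbf b$ form a static graph with these pieces and which has precisely one cycle is equal to $$\mathcal G_h=\mathrm{vol}(\widetilde\mu)\cdot\prod_{i=1}^h\frac{\kappa_i}2,$$ where $\kappa_i=4g_i-2$ (the enhancements of the edges of the special star graph $\Gamma$ associated with the pieces) and $$\mathrm{vol}(\widetilde\mu)=\sum_{\substack{I\subset\{1,\dots,h\}\\ c_{1,I}>0}}c_{1,I}\,f_2(m_1,|I|+1)\,f_2(m_2,|I^c|+1),\qquad c_{1,I}=m_1+2-\sum_{i\in I}4g_i .$$
   Context: Let $m_1,m_2\ge-1$ be odd with $m_1+m_2=4g-4$, $h\ge1$, and $g_1,\dots,g_h\ge1$ with $\sum g_i=g$. The number $\mathrm{vol}(\widetilde\mu)$ is the intersection-theoretic volume of the genus zero quadratic stratum $\widetilde\mu=(m_1,m_2,-4g_1,\dots,-4g_h)$, which equals the displayed sum. Here $f_2(a,1)=\frac1{a+2}$ and $f_2(a,r)=\frac{a!!}{(a-2(r-2))!!}=a(a-2)\cdots(a-2(r-3))$ for $r\ge2$ (so $f_2(a,2)=1$). **Pieces.** $G_1^*,\dots,G_h^*$ are connected bipartite ribbon graphs, each with one face, $G_i^*$ having $2g_i-1$ edges (so its face has degree $\kappa_i=4g_i-2$). The vertices of $\bigsqcup G_i^*$ are labelled by $\{1,\dots,2c\}$ with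 a fixed-point free involution $W$ such that $s$ and $W(s)$ belong to the same piece; the labels are chosen such that $W(s)=s+c$ for $s\le c$, with the vertices with label $\le c$ forming one color class (black) and those with label $>c$ the other (white) in the bipartite coloring of each piece. **Degeneration.** $\mathbf b=(b_1,\dots,b_{2c})$ is a generic point of the wall $\{b_s=b_{s+c}\}$ and $\mathbf b'(\epsilon)\to\mathbf b$, $\epsilon\in[0,1]$, satisfies $b'_{s+c}-b'_s=2^s\epsilon$ for $s=1,\dots,c$. **What is counted.** One counts the ways to insert $h$ edges into $\bigsqcup G_i^*$ (attached at corners of the pieces; two insertions are identified if they are related by an isomorphism that is the identity on $\bigsqcup G_i^*$) so that the result is a connected ribbon graph $G^*$ such that: $G^*$ has exactly two faces, of degrees $m_1+2$ and $m_2+2$; the inserted edges are exactly the static edges of $G^*$, so that the static graph with vertices $G_i^*$ and the inserted edges as edges has precisely one cycle, consisting of non-bridge edges of $G^*$; and for $\epsilon>0$ the weight $w(e)$ of every inserted edge, as determined by the vertex parameters $\mathbf b'(\epsilon)$, is positive (it tends to $0$ as $\epsilon\to0$). An edge $e$ of $G^*$ is static if a connected component of $G^*-e$ is bipartite. The vertex parameter at a vertex is the sum of the weights of its half-edges; the weight of a static edge is determined by them: if $e$ is a bridge, with bipartite component $S$ of $G^*-e$, then $w(e)$ is the sum of the vertex parameters over vertices of $S$ of the color of the end of $e$ in $S$ minus the sum over the vertices of $S$ of the other color; if $e$ is not a bridge, both ends of $e$ have the same color in $G^*-e$ and $w(e)$ is half the difference of the sum of vertex parameters of that color and that of the other color.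
   Formalization: The clause that the inserted edges are exactly the static edges is read as: exactly the static edges whose weight tends to 0, other than edges of a piece already of weight 0 in that piece at b; literally it fails (h=g_1=1, m=(1,-1): count 0, formula 1). *)

(* Defs.v *)
From mathcomp Require Import all_boot all_order all_fingroup all_algebra.
From mathcomp Require Import all_classical all_reals all_analysis.

Set Implicit Arguments.
Unset Strict Implicit.
Unset Printing Implicit Defensive.

Import Order.TTheory GRing.Theory Num.Theory.
Import numFieldNormedType.Exports.

Local Open Scope ring_scope.

(** * Ribbon graphs *)

(* A finite graph, possibly disconnected and without isolated vertices, given
   by its half-edges ("darts"): [rot] is the cyclic order of the darts at each
   vertex and [flip] exchanges the two darts of an edge. *)
Record ribbon_graph := RibbonGraph {
  dart :> finType;
  rot : {perm dart};
  flip : {perm dart};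
  flipK : involutive flip;
  flip_neq : forall x, flip x != x }.

Section RibbonGraph.
Variable G : ribbon_graph.
Implicit Types (x y : G) (e : {set G}) (E S : {set G}).

Definition vertices : {set {set G}} := porbits (rot G).
Definition edges : {set {set G}} := porbits (flip G).

(* [flip * rot] maps [x] to [rot (flip x)]; the cardinal of one of its orbits
   is the degree of the face. *)
Definition faces : {set {set G}} := porbits (flip G * rot G)%g.

Definition vertex_of x : {set G} := porbit (rot G) x.
Definition edge_of x : {set G} := porbit (flip G) x.

(* [x] and [y] sit at vertices of the same connected component of the graph
   obtained by deleting the edges whose darts form [E]. The deleted darts still
   mark their vertices, so that a vertex is never lost. *)
Definition linked E : rel G :=
  connect [rel x y | (y == rot G x) || (x \notin E) && (y == flip G x)].

Definition component E x : {set G} := [set y | linked E x y].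

Definition is_connected : Prop := forall x y, linked finset.set0 x y.

(* [col] is a proper 2-coloring of the vertices of [S], in the graph obtained
   by deleting [E]. *)
Definition proper_coloring E S (col : G -> bool) : Prop :=
  {in S, forall x, col (rot G x) = col x /\
                   (x \notin E -> col (flip G x) = ~~ col x)}.

Definition bipartite : Prop :=
  exists col, proper_coloring finset.set0 finset.setT col.

Definition static e : Prop :=
  exists x col, proper_coloring e (component e x) col.

Definition bridge e : bool := [exists x in e, ~~ linked e x (flip G x)].

(* [C] is the edge set of a simple cycle of the graph whose vertices are the
   components left after deleting [E] and whose edges are those of [E]. The
   cycle is the closed walk [p] of oriented edges, where [x] leads from the
   component of [x] to that of [flip x]; it visits pairwise distinct components
   and edges (loops and 2-cycles made of parallel edges are allowed). *)
Definition contracted_cycle E (C : {set {set G}}) : Prop :=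
  exists p : seq G,
    [/\ p != [::], {subset p <= E},
        path.cycle (fun x y => linked E (flip G x) y) p,
        pairwise (fun x y => ~~ linked E x y && (edge_of x != edge_of y)) p &
        C = [set:: map edge_of p]].

Section Weight.
Variable R : realType.

Definition color_sum (b : {set G} -> R) S (col : G -> bool) (a : bool) : R :=
  \sum_(v in vertices | v \subset [set x in S | col x == a]%SET) b v.

(* The weight of a static edge [e] is [w] for the vertex parameters [b]; here
   [x] is an end of [e] in the bipartite component. *)
Definition static_weight (b : {set G} -> R) e (w : R) : Prop :=
  exists x col, let S := component e x in
  let d := color_sum b S col (col x) - color_sum b S col (~~ col x) in
  [/\ x \in e, proper_coloring e S col &
      if bridge e then w = d else col (flip G x) = col x /\ w = d / 2].

Definition degenerating (b : R -> {set G} -> R) e : Prop :=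
  static e /\
  exists2 w : R -> R, forall t, 0 < t <= 1 -> static_weight (b t) e (w t) &
    (w t @[t --> 0^'+] --> (0 : R))%classic.

End Weight.

End RibbonGraph.

(** * Disjoint unions *)

Section DisjointUnion.
Variables (h : nat) (G : 'I_h -> ribbon_graph).
Let D : finType := {i : 'I_h & G i}.

Definition du_map (f : forall i, {perm G i}) (x : D) : D :=
  Tagged (fun i => G i : Type) (f (tag x) (tagged x)).

Lemma du_map_inj f : injective (du_map f).
Proof.
move=> [i x] [j y] /= eq_f; have eij : i = j by exact: (congr1 tag eq_f).
case: j / eij y eq_f => y /eqP; rewrite eq_Tagged /= => /eqP/perm_inj -> //.
Qed.

Definition du_rot : {perm D} := perm (du_map_inj (f := fun i => rot (G i))).
Definition du_flip : {perm D} := perm (du_map_inj (f := fun i => flip (G i))).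

Lemma du_flipK : involutive du_flip.
Proof. by case=> i x; rewrite !permE /du_map /= flipK. Qed.

Lemma du_flip_neq x : du_flip x != x.
Proof. by case: x => i x; rewrite permE /du_map eq_Tagged /= flip_neq. Qed.

Definition disjoint_union : ribbon_graph := RibbonGraph du_rot du_flipK du_flip_neq.

Definition piece_of (x : disjoint_union) : 'I_h := tag (x : D).

End DisjointUnion.

(** * Insertion of edges *)

Section Insertion.
Variables (P : ribbon_graph) (h : nat).

Definition ins_dart : finType := (P + 'I_h * bool)%type.

Definition ins_flip_fun (x : ins_dart) : ins_dart :=
  match x with inl y => inl (flip P y) | inr (k, a) => inr (k, ~~ a) end.

Lemma ins_flip_funK : involutive ins_flip_fun.
Proof. by case=> [y|[k a]] /=; rewrite ?flipK ?negbK. Qed.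

Definition ins_flip : {perm ins_dart} := perm (inv_inj ins_flip_funK).

Lemma ins_flipK : involutive ins_flip.
Proof. by move=> x; rewrite !permE ins_flip_funK. Qed.

Lemma ins_flip_neq x : ins_flip x != x.
Proof.
rewrite permE; case: x => [y|[k a]] /=.
  by apply: contra_neq (flip_neq y) => -[].
by case: a; apply/eqP => -[].
Qed.

(* The graph obtained by adding [h] edges to [P], [r] being the new rotation. *)
Definition ins_graph (r : {perm ins_dart}) : ribbon_graph :=
  RibbonGraph r ins_flipK ins_flip_neq.

Definition ins_edge (k : 'I_h) : {set ins_dart} :=
  [set inr (k, false); inr (k, true)]%SET.

Definition ins_darts : {set ins_dart} := [set inr k | k in [set: 'I_h * bool]]%SET.

(* The new darts lie in corners of [P]: there is no new vertex, and forgetting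
   the new darts in the cyclic orders [r] leaves those of [P]. *)
Definition is_insertion (r : {perm ins_dart}) : Prop :=
  (forall k, exists x : P, inl x \in porbit r (inr k)) /\
  (forall x : P, exists n : nat,
     iter n.+1 r (inl x) = inl (rot P x) /\
     forall j : nat, (0 < j <= n)%N -> iter j r (inl x) \in ins_darts).

(* Isomorphism of ribbon graphs restricting to the identity on [P]. *)
Definition same_insertion (r r' : {perm ins_dart}) : bool :=
  [exists p : {perm ins_dart},
    [&& [forall x : P, p (inl x) == inl x],
        [forall x, p (ins_flip x) == ins_flip (p x)] &
        [forall x, p (r x) == r' (p x)]]].

End Insertion.

(** * Static graphs with one cycle over given pieces *)

(* Vertices are labelled by ['I_(c + c)]: the black labels are the
   [lshift c s] and the white ones the [rshift c s], for [s : 'I_c], and the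
   involution [W] exchanges [lshift c s] and [rshift c s]. *)
Definition black (c : nat) (l : 'I_(c + c)) : bool := (l < c)%N.

Record vertex_pairing (h c : nat) (G : 'I_h -> ribbon_graph)
    (lab : {set disjoint_union G} -> 'I_(c + c)) : Prop := VertexPairing {
  pairing_inj : {in vertices (disjoint_union G) &, injective lab};
  pairing_surj : forall l, exists2 v, v \in vertices (disjoint_union G) & lab v = l;
  pairing_piece : forall (s : 'I_c) (x y : disjoint_union G),
    lab (vertex_of x) = lshift c s -> lab (vertex_of y) = rshift c s ->
    piece_of x = piece_of y;
  pairing_color : proper_coloring finset.set0 finset.setT
    (fun x : disjoint_union G => black (lab (vertex_of x))) }.

(* A generic point of the wall [b_s = b_(s + c)]: the only equalities between
   sums of [b] over disjoint sets of labels are consequences of the equations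
   of the wall. *)
Definition generic_on_wall (R : realType) (c : nat) (b : 'I_(c + c) -> R) : Prop :=
  (forall s : 'I_c, b (lshift c s) = b (rshift c s)) /\
  (forall I J : {set 'I_(c + c)}, [disjoint I & J] ->
     \sum_(i in I) b i = \sum_(j in J) b j ->
     forall s : 'I_c, ((lshift c s \in I) + (rshift c s \in I) =
                       (lshift c s \in J) + (rshift c s \in J))%N).

(* The labels [1, ..., c] are shifted to [0, ..., c - 1], whence [s.+1]. *)
Definition degeneration (R : realType) (c : nat) (b : 'I_(c + c) -> R)
    (b' : R -> 'I_(c + c) -> R) : Prop :=
  (forall l, (b' t l @[t --> 0^'+] --> b l)%classic) /\
  (forall t, 0 <= t <= 1 ->
     forall s : 'I_c, b' t (rshift c s) - b' t (lshift c s) = 2 ^+ s.+1 * t).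

Section Count.
Variables (R : realType) (h c : nat) (G : 'I_h -> ribbon_graph).
Variables (m1 m2 : int) (lab : {set disjoint_union G} -> 'I_(c + c)).
Variables (b : 'I_(c + c) -> R) (b' : R -> 'I_(c + c) -> R).

Local Notation P := (disjoint_union G).

(* Deleting the new darts of a vertex leaves a vertex of [P], hence a label. *)
Definition ins_param (r : {perm ins_dart P h}) (t : R) (v : {set ins_graph r}) : R :=
  b' t (lab (inl @^-1: v)%SET).

(* [e] is an edge of a piece which has weight 0 in that piece already, at the
   limit point [b]: it is not the passage to the limit that contracts it. *)
Definition null_in_piece (e : {set ins_dart P h}) : Prop :=
  exists2 e0 : {set P}, e0 \in edges P &
    e = (inl @: e0)%SET /\ static_weight (fun v => b (lab v)) e0 0.

(* In [oci_static] the static edges are restricted to those that degenerate: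
   deleting a bridge of a piece, e.g. the edge of a piece with one edge, may
   leave a bipartite component as well, but the weight of such an edge has a
   nonzero limit unless the piece itself forces it to vanish at [b].
   In [oci_cycle] the vertices of the static graph are the components left after
   deleting the new edges, i.e. the pieces. *)
Record one_cycle_insertion (r : {perm ins_dart P h}) : Prop := OneCycleInsertion {
  oci_insertion : is_insertion r;
  oci_connected : is_connected (ins_graph r);
  oci_faces : exists f1 f2 : {set ins_graph r},
    [/\ f1 != f2, faces (ins_graph r) = [set f1; f2]%SET,
        #|f1|%:Z = m1 + 2 & #|f2|%:Z = m2 + 2];
  oci_static : {in edges (ins_graph r), forall e,
    (exists k, e = ins_edge P k) <->
    degenerating (ins_param (r := r)) e /\ ~ null_in_piece e};
  oci_cycle : exists C : {set {set ins_graph r}},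
    (forall C', contracted_cycle (G := ins_graph r) (ins_darts P h) C' <-> C' = C) /\
    {in C, forall e, ~~ bridge e};
  oci_positive : forall (k : 'I_h) (t w : R), 0 < t <= 1 ->
    static_weight (G := ins_graph r) (ins_param t) (ins_edge P k) w -> 0 < w }.

Definition count_one_cycle : nat :=
  #|equivalence_partition (@same_insertion P h)
      [set r | `[< one_cycle_insertion r >]]%SET|.

End Count.

(** * Volume of the genus zero stratum *)

(* For [r >= 2] this is [a!! / (a - 2 (r - 2))!!], with [r - 2] factors; the
   value at [r = 0] is never used. *)
Definition f2 (a : int) (r : nat) : rat :=
  match r with
  | 0 => 0
  | 1 => (a + 2)%:~R^-1
  | r'.+2 => \prod_(j < r') (a - 2 * j%:Z)%:~R
  end.

Definition c1 (h : nat) (g : 'I_h -> nat) (m1 : int) (I : {set 'I_h}) : int :=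
  m1 + 2 - \sum_(i in I) (4 * g i)%N%:Z.

Definition vol (h : nat) (g : 'I_h -> nat) (m1 m2 : int) : rat :=
  \sum_(I : {set 'I_h} | 0 < c1 g m1 I)
    (c1 g m1 I)%:~R * f2 m1 #|I|.+1 * f2 m2 #|(~: I)%SET|.+1.

(* Enhancement of the edge of the star graph towards a piece with
   [2 * n - 1] edges: the degree of the unique face of that piece. *)
Definition kappa (n : nat) : nat := (4 * n - 2)%N.

(* Main.v *)
Require Import Defs.
From mathcomp Require Import all_boot all_order all_fingroup all_algebra.
From mathcomp Require Import all_classical all_reals all_analysis.
From mathcomp Require Import zify ring lra.

Set Implicit Arguments.
Unset Strict Implicit.
Unset Printing Implicit Defensive.

Import Order.TTheory GRing.Theory Num.Theory.
Import numFieldNormedType.Exports.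
Import mathcomp.boot.fintype mathcomp.boot.finset.

Local Open Scope ring_scope.

(** Call an insertion canonical when its edges are oriented and numbered in
    such a way that the edge [k] leaves the piece [k]. In a connected graph with
    as many edges as pieces this is possible in exactly two ways: the edges off
    the cycle have to point towards it, and those of the cycle have to follow one
    of its two directions. Hence the classes to be counted are half as many as
    the canonical insertions among them ([canonical_exists], [canonical_pair]).

    Weights. Subtract, in each piece, the parameters of the black vertices from
    those of the white ones; this gives [t * D i], where [D i] is the sum of the
    numbers [2 ^ s.+1] over the labels of the piece [i]. The weights of the
    inserted edges solve the linear system which expresses that these excesses
    are carried by the darts inserted in each piece, counted with the signs of
    their colors ([static_weight_flow]). They are therefore [t] times the solution
    [w] for [D], and the condition is that [w] is positive. Now among the pieces
    of any set, the one with the greatest label has a larger [D] than all the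
    others together ([deficit_dominated]). Consequently the signs of [w] are found
    by a walk along the oriented edges: at the first piece, chosen dominant, the
    edge is positive exactly when its tail is at a white vertex, and after that
    exactly when its tail and the head of the preceding edge have opposite colors
    ([chain_sign]). A walk which meets a piece already visited is continued from
    the dominant one of the remaining pieces. So positivity prescribes the color
    of the tail of each edge, and nothing else ([explore_pos]).

    Counting. The edges are inserted in the order of this exploration. The tail of
    the edge leaving the piece [i] has [kappa (g i) / 2] positions, which give the
    product in the theorem. Its head can be put in a corner of a new piece, or in
    one of the two faces completed before, which it enlarges, or back in the walk
    itself; as the graph is connected, the last happens in the first walk only,
    and divides a face of degree [n] into faces of degrees [k] and [n - k], each [k]
    with [0 < k < n] occurring once ([sum_porbit_split]). As only the degrees of
    the faces matter, the number of completions satisfies a recursion; its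
    solution is a sum over the sets [J] of pieces that end up in the first face
    ([chain_forests_rec], [unicycles_rec]). With the terms of the volume grouped
    according to whether they contain the dominant piece, that sum is the volume
    ([vol_unicycles]). It appears twice, once for either side of the oriented cycle
    on which the first face lies, and this compensates the two numberings.

    Conversely, for a canonical insertion that satisfies these conditions, the
    degenerating edges are the inserted ones: an edge of the cycle is static
    because a face of odd degree prevents the graph from being bipartite
    ([canonical_static_data]), and an edge of a piece that degenerates has weight
    zero in the piece already ([degenerating_edges]). *)

(** * Cycles of a permutation multiplied by a transposition *)

Section TpermOrbits.
Variable T : finType.
Implicit Types (s t : {perm T}) (x y z : T).

Lemma mem_porbit1 s x z : (s x \in porbit s z) = (x \in porbit s z).
Proof.
have e : porbit s (s x) = porbit s x by have := porbit_perm s 1 x; rewrite expg1.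
by rewrite -!eq_porbit_mem e.
Qed.

Lemma porbit_sub_closed s (S : {set T}) z :
  {in S, forall u, s u \in S} -> z \in S -> porbit s z \subset S.
Proof.
move=> clS zS; apply/subsetP=> u /porbitP [i ->]; elim: i => [|i IH].
  by rewrite expg0 perm1.
by rewrite expgSr permM clS.
Qed.

Lemma porbit_eq_on s t (S : {set T}) z :
  {in S, forall u, s u \in S} -> {in S, s =1 t} -> z \in S -> porbit t z = porbit s z.
Proof.
move=> clS est zS.
have ex i : (t ^+ i)%g z = (s ^+ i)%g z /\ (s ^+ i)%g z \in S.
  elim: i => [|i [e m]]; first by rewrite !expg0 !perm1.
  by rewrite !expgSr !permM e -est // clS.
apply/setP=> u; apply/porbitP/porbitP=> -[i ->]; exists i; have [e _] := ex i; by rewrite e.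
Qed.

(** The path from [v] to [y] along [s] avoids [x], and meets [y] only at its
    end; so the transposition does not disturb it. *)
Lemma tperm_reach s x y v : x \notin porbit s y -> v \in porbit s y ->
  y \in porbit (tperm x y * s) v.
Proof.
move=> xNy; rewrite porbit_sym => /porbitP [m Em].
have {Em xNy} : (x \notin porbit s v) /\ y = (s ^+ m)%g v.
  split=> //; apply: contraNN xNy => xv.
  have : y \in porbit s v by rewrite Em mem_porbit.
  by rewrite -eq_porbit_mem => /eqP ->.
elim: m v => [|m IH] v [xNv Em]; first by rewrite Em expg0 perm1 porbit_id.
have [->|yv] := eqVneq y v; first exact: porbit_id.
have tv : (tperm x y * s)%g v = s v.
  rewrite permM tpermD //; apply: contraNneq xNv => ->; exact: porbit_id.
have st : y \in porbit (tperm x y * s) (s v).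
  by apply: IH; split; [rewrite porbit_sym mem_porbit1 porbit_sym | rewrite Em expgS permM].
move: st; rewrite -!eq_porbit_mem -{1}tv.
by have := porbit_perm (tperm x y * s)%g 1 v; rewrite expg1 => ->.
Qed.

(** Entering the transposition at one of the two points means going on from
    the other one, so that the two cycles become one. *)
Lemma porbit_merge s x y z : y \notin porbit s x ->
  porbit (tperm x y * s) z =
    if z \in porbit s x :|: porbit s y then porbit s x :|: porbit s y
    else porbit s z.
Proof.
set S := _ :|: _ => yNx; set t := (_ * _)%g.
have xNy : x \notin porbit s y by rewrite porbit_sym.
have clS : {in S, forall u, t u \in S}.
  move=> u uS; rewrite permM; case: tpermP uS => [->|->|_ _] uS.
  - by rewrite !inE !mem_porbit1 porbit_id orbT.
  - by rewrite !inE !mem_porbit1 porbit_id.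
  by move: uS; rewrite !inE !mem_porbit1.
have xt v : v \in porbit s x -> x \in porbit t v.
  by rewrite /t tpermC; apply: tperm_reach.
have yt v : v \in porbit s y -> y \in porbit t v by apply: tperm_reach.
have txy : y \in porbit t x.
  have : y \in porbit t (t x).
    by apply: yt; rewrite /t permM tpermL mem_porbit1 porbit_id.
  rewrite -!eq_porbit_mem; have := porbit_perm t 1 x; by rewrite expg1 => ->.
case: ifP => [zS|/negbT zNS]; last first.
  apply: (@porbit_eq_on s t (~: S)); last by rewrite inE.
    by move=> u; rewrite !inE !mem_porbit1.
  move=> u; rewrite inE => uNS; rewrite permM tpermD //.
    by apply: contraNneq uNS => <-; rewrite inE porbit_id.
  by apply: contraNneq uNS => <-; rewrite inE porbit_id orbT.
apply/eqP; rewrite eqEsubset porbit_sub_closed //=.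
have eS v : v \in S -> porbit t v = porbit t x.
  rewrite inE => /orP[] vS; apply/eqP; first by rewrite eq_sym eq_porbit_mem xt.
  have := yt _ vS; rewrite -eq_porbit_mem => /eqP <-.
  by rewrite eq_porbit_mem.
by apply/subsetP=> u uS; rewrite -eq_porbit_mem !eS.
Qed.

(** Multiplying by the transposition adds a cycle if the two points share
    one and removes a cycle otherwise; doing it twice changes nothing. *)
Lemma tperm_split_notin s x y : y \in porbit s x -> y != x ->
  y \notin porbit (tperm x y * s) x.
Proof.
move=> yx ny; apply/negP => yt.
have := porbits_mul_tperm s x y; rewrite /= porbit_sym yx eq_sym ny addn0 => E1.
have := porbits_mul_tperm (tperm x y * s)%g x y; rewrite /=.
rewrite porbit_sym yt eq_sym ny addn0 mulgA tperm2 mul1g => E2.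
by move: E1; rewrite E2; lia.
Qed.

(** Multiplying once more by the transposition merges the parts again, so
    this follows from [porbit_merge]. *)
Lemma porbit_split s x y : y \in porbit s x -> y != x ->
  let t := (tperm x y * s)%g in
  [/\ porbit t x :|: porbit t y = porbit s x, porbit t x != porbit t y &
      forall z, z \notin porbit s x -> porbit t z = porbit s z].
Proof.
move=> yx ny t; have yNt := tperm_split_notin yx ny.
have M z := porbit_merge z yNt; rewrite -/t in M.
have ets : (tperm x y * t)%g = s by rewrite mulgA tperm2 mul1g.
rewrite ets in M.
have E : porbit t x :|: porbit t y = porbit s x by rewrite M inE porbit_id.
split=> // [|z]; last by rewrite -E => zN; rewrite M (negbTE zN).
by rewrite eq_sym eq_porbit_mem.
Qed.

Lemma card_porbit_order s x n : (0 < n)%N -> (s ^+ n)%g x = x ->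
  (forall m, (0 < m < n)%N -> (s ^+ m)%g x != x) -> #|porbit s x| = n.
Proof.
move=> n0 En Hm; set q := #|porbit s x|.
have q0 : (0 < q)%N by rewrite lt0n card_porbit_neq0.
have Eq : (s ^+ q)%g x = x by rewrite permX iter_porbit.
case: (ltngtP q n) => // [qn|nq].
  by have := Hm q; rewrite q0 qn Eq eqxx => /(_ isT).
have U := uniq_traject_porbit s x.
have : nth x (traject s x q) 0 = nth x (traject s x q) n.
  by rewrite !nth_traject //= -permX En.
move/eqP; rewrite nth_uniq ?size_traject //; by case: (n) n0.
Qed.

(** The cycle of [x] loses the first [i] points after [x]. *)
Lemma card_porbit_split s x i : (0 < i < #|porbit s x|)%N ->
  #|porbit (tperm x ((s ^+ i)%g x) * s) x| = (#|porbit s x| - i)%N.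
Proof.
set N := #|porbit s x|; move=> /andP[i0 iN]; set y := (s ^+ i)%g x; set t := (_ * _)%g.
have inj j k : (j < N)%N -> (k < N)%N -> (s ^+ j)%g x = (s ^+ k)%g x -> j = k.
  move=> jN kN E; have U := uniq_traject_porbit s x.
  apply/eqP; rewrite -(nth_uniq x _ _ U) ?size_traject //.
  by rewrite !nth_traject // -!permX E.
have nz j : (0 < j < N)%N -> (s ^+ j)%g x != x.
  case/andP=> j0 jN; apply/eqP=> E; have := @inj j 0%N jN (ltn_trans j0 jN).
  by rewrite expg0 perm1 => /(_ E); lia.
have Et m : (0 < m <= N - i)%N -> (t ^+ m)%g x = (s ^+ (i + m))%g x.
  elim: m => // -[|m] IH mN.
    by rewrite expg1 permM tpermL addn1 expgSr permM.
  rewrite expgSr permM IH; last by lia.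
  rewrite [in RHS]addnS (expgSr s (i + m.+1)) [RHS]permM permM tpermD //.
    by rewrite eq_sym nz //; lia.
  by apply/eqP => /inj; rewrite /y; lia.
apply: card_porbit_order; first by lia.
  rewrite Et ?subnKC; [|lia|lia].
  by rewrite permX iter_porbit.
by move=> m mN; rewrite Et; [apply: nz; lia | lia].
Qed.

(** The distance from [x] takes each value once on the rest of its cycle.
    This is what makes every pair of face degrees occur once when a cycle of
    edges is closed. *)
Lemma sum_porbit_split (V : nmodType) s x (F : nat -> V) :
  \sum_(y in porbit s x :\ x) F #|porbit (tperm x y * s) x| =
  \sum_(1 <= n < #|porbit s x|) F n.
Proof.
set N := #|porbit s x|.
have N0 : (0 < N)%N by rewrite lt0n card_porbit_neq0.
have P : perm_eq (enum (porbit s x :\ x)) [seq (s ^+ i)%g x | i <- index_iota 1 N].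
  have U := uniq_traject_porbit s x.
  have Em : [seq (s ^+ i)%g x | i <- iota 1 N.-1] = behead (traject s x N).
    case: (N) N0 => // n _ /=; apply: (@eq_from_nth _ x).
      by rewrite size_map size_iota size_traject.
    move=> i; rewrite size_map size_iota => ii.
    rewrite (nth_map 0%N) ?size_iota // nth_iota //.
    rewrite (set_nth_default (s x)) ?size_traject // nth_traject //.
    by rewrite expgS permM permX.
  rewrite /index_iota subn1 Em; apply: uniq_perm.
  - exact: enum_uniq.
  - by move: U; rewrite -/N; case: (N) N0 => //= n _ /andP[].
  move=> u; rewrite mem_enum !inE porbit_traject -/N.
  move: U; rewrite -/N; case: (N) N0 => //= n _ /andP[xN _].
  rewrite inE; have [->|] := eqVneq u x => //=.
  by rewrite (negbTE xN).
rewrite -big_enum /= (perm_big _ P) big_map /index_iota.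
rewrite [LHS]big_seq_cond [RHS]big_nat_rev /= [RHS]big_seq_cond /index_iota.
apply: eq_bigr => i; rewrite andbT mem_iota => ii.
by rewrite card_porbit_split -/N; [congr F; lia | lia].
Qed.

End TpermOrbits.

(** * Forgetting points of a permutation *)

Section Forget.
Variable T : finType.
Implicit Types (r : {perm T}) (A B : {set T}) (x y z : T).

(** The first return to the complement of [A], as a relation. *)
Inductive next_outside A r : T -> T -> Prop :=
| NextNow x : r x \notin A -> next_outside A r x (r x)
| NextLater x y : r x \in A -> next_outside A r (r x) y -> next_outside A r x y.

Definition forgets A r r0 : Prop :=
  {in A, forall x, r0 x = x} /\ forall x, x \notin A -> next_outside A r x (r0 x).

Lemma next_outside_notin A r x y : next_outside A r x y -> y \notin A.
Proof. by elim. Qed.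

Lemma next_outside_uniq A r x y y' :
  next_outside A r x y -> next_outside A r x y' -> y = y'.
Proof.
move=> H; elim: H y' => {x y} [x xA|x y xA _ IH] y' H'.
  by inversion H'; subst => //; rewrite H in xA.
by inversion H'; subst; [rewrite xA in H | apply: IH].
Qed.

Lemma forgets_uniq A r r0 r1 : forgets A r r0 -> forgets A r r1 -> r0 = r1.
Proof.
move=> [f0 n0] [f1 n1]; apply/permP=> x; have [xA|xA] := boolP (x \in A).
  by rewrite f0 ?f1.
exact: next_outside_uniq (n0 _ xA) (n1 _ xA).
Qed.

Lemma next_outside_sub A B r x y : A \subset B -> y \notin B ->
  next_outside A r x y -> next_outside B r x y.
Proof.
move=> /subsetP AB yB H; elim: H yB => {x y} [x xA|x y xA _ IH] yB.
  exact: NextNow.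
by apply: NextLater; [apply: AB | apply: IH].
Qed.

Lemma next_outside_trans A B r x z y : A \subset B -> z \in B ->
  next_outside A r x z -> next_outside B r z y -> next_outside B r x y.
Proof.
move=> /subsetP AB zB H; elim: H zB y => {x z} [x xA|x z xA _ IH] zB y Hy.
  exact: NextLater.
by apply: NextLater; [apply: AB | apply: IH].
Qed.

Lemma forgets_comp A B r r1 r0 :
  forgets A r r1 -> forgets B r1 r0 -> forgets (A :|: B) r r0.
Proof.
move=> [fA nA] [fB nB]; split=> x; rewrite inE; have [xB|xB] := boolP (x \in B).
- by rewrite fB.
- rewrite orbF => xA; have e := fA _ xA.
  by rewrite -[RHS]e; apply: next_outside_uniq (nB _ xB) _; apply: NextNow; rewrite e.
- by rewrite orbT.
rewrite orbF => xA; elim: (nB _ xB) xA => {xB x} [x xB|x y xB _ IH] xA.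
  have H := nA _ xA; apply: next_outside_sub H; first exact: subsetUl.
  by rewrite inE negb_or xB (next_outside_notin (nA _ xA)).
have H := nA _ xA; apply: next_outside_trans H _; rewrite ?subsetUl ?inE ?xB ?orbT //.
exact: IH (next_outside_notin (nA _ xA)).
Qed.

Definition forget1 r z : {perm T} := (tperm z ((r^-1)%g z) * r)%g.

Lemma forget1P r z : forgets [set z] r (forget1 r z).
Proof.
split=> [x /set1P ->|x]; first by rewrite permM tpermL permKV.
rewrite inE => xz; rewrite permM; case: tpermP => [e|e0|n1 n2]; first by rewrite e eqxx in xz.
  rewrite e0 in xz *.
  have e : r ((r^-1)%g z) = z by rewrite permKV.
  apply: NextLater; first by rewrite e inE.
  rewrite e; apply: NextNow; rewrite inE; apply/eqP=> rz.
  by move/eqP: xz; apply; rewrite -{1}rz permK.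
apply: NextNow; rewrite inE; apply/eqP=> e; apply: n2.
by rewrite -e permK.
Qed.

(** The points are removed one at a time; their order is immaterial by
    [forgets_uniq]. *)
Definition forget A r : {perm T} := foldr (fun z r' => forget1 r' z) r (enum A).

Lemma forgetP A r : forgets A r (forget A r).
Proof.
rewrite /forget; have -> : forgets A r = forgets [set z in enum A] r.
  by congr forgets; apply/setP=> z; rewrite inE mem_enum.
elim: (enum A) => [|z s IH] /=.
  by split=> x; rewrite !inE // => _; apply: NextNow; rewrite inE.
have := forgets_comp IH (forget1P (foldr (fun z r' => forget1 r' z) r s) z).
by congr forgets; apply/setP=> u; rewrite !inE orbC.
Qed.

Lemma forgetE A r r0 : forgets A r r0 -> forget A r = r0.
Proof. exact: forgets_uniq (forgetP A r). Qed.

Lemma forget_comp A B r : forget B (forget A r) = forget (A :|: B) r.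
Proof. by apply/esym/forgetE/forgets_comp; exact: forgetP. Qed.

Lemma forget_set1 r z : forget [set z] r = forget1 r z.
Proof. exact/forgetE/forget1P. Qed.

Lemma forget_fixed A r : {in A, forall x, r x = x} -> forget A r = r.
Proof.
move=> fA; apply: forgetE; split=> // x xA; apply: NextNow.
apply: contraNN xA => rA; have := fA _ rA => /perm_inj e.
by rewrite -e.
Qed.

Lemma forget_in A r x : x \in A -> forget A r x = x.
Proof. by have [f _] := forgetP A r; apply: f. Qed.

Lemma forget_notin A r x : x \notin A -> forget A r x \notin A.
Proof. by have [_ n] := forgetP A r => /n /next_outside_notin. Qed.

Lemma next_outside_porbit A r x y : next_outside A r x y -> y \in porbit r x.
Proof.
elim=> {x y} [x _|x y _ _]; first by rewrite mem_porbit1 porbit_id.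
have := porbit_perm r 1 x; by rewrite expg1 => ->.
Qed.

Lemma forget_porbit_sub A r x : x \notin A -> porbit (forget A r) x \subset porbit r x.
Proof.
move=> xA; pose S := porbit r x :&: ~: A.
apply: (@subset_trans _ _ (mem S)); last exact: subsetIl.
apply: porbit_sub_closed; last by rewrite !inE porbit_id xA.
move=> u; rewrite !inE => /andP[ux uA]; rewrite forget_notin // andbT.
have [_ n] := forgetP A r; have := next_outside_porbit (n _ uA).
by move: ux; rewrite -eq_porbit_mem => /eqP ->.
Qed.

Lemma forget_porbit_mem A r x y : x \notin A -> y \notin A ->
  y \in porbit r x -> y \in porbit (forget A r) x.
Proof.
move=> xA yA /porbitP [m Em].
suff G n : forall u v, next_outside A r u v -> y = (r ^+ n.+1)%g u ->
    y \in porbit (forget A r) v.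
  case: m Em => [|m] Em; first by rewrite Em expg0 perm1 porbit_id.
  have [_ nx] := forgetP A r; have := G _ _ _ (nx _ xA) Em.
  by have := porbit_perm (forget A r) 1 x; rewrite expg1 => ->.
elim: n => [|n IH] u v [{}u uA|{}u {}v uA H] Ey.
- by rewrite Ey expg1 porbit_id.
- by rewrite Ey expg1 uA in yA.
- have [_ nx] := forgetP A r.
  have := IH _ _ (nx _ uA); rewrite Ey expgS permM => /(_ erefl).
  by have := porbit_perm (forget A r) 1 (r u); rewrite expg1 => ->.
by apply: (IH _ _ H); rewrite Ey expgS permM.
Qed.

(** When [r z = z] this inserts [z] right after [x]. *)
Definition insert1 r x z : {perm T} := (tperm x z * r)%g.

Lemma insert1K r x z : r z = z -> forget1 (insert1 r x z) z = r.
Proof.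
move=> rz; rewrite /forget1; have -> : ((insert1 r x z)^-1)%g z = x.
  by apply: (@perm_inj _ (insert1 r x z)); rewrite permKV /insert1 permM tpermL.
by rewrite /insert1 mulgA (tpermC z x) tperm2 mul1g.
Qed.

Lemma forget1K r z : insert1 (forget1 r z) ((r^-1)%g z) z = r.
Proof. by rewrite /insert1 /forget1 mulgA tpermC tperm2 mul1g. Qed.

Definition insert2 r a b x y : {perm T} := insert1 (insert1 r x a) y b.

Definition positions2 r a b : T * T :=
  (((forget1 r b)^-1)%g a, (r^-1)%g b).

Lemma positions2K r a b :
  let p := positions2 r a b in insert2 (forget [set a; b] r) a b p.1 p.2 = r.
Proof.
rewrite /insert2 /=; have -> : forget [set a; b] r = forget1 (forget1 r b) a.
  by rewrite -!forget_set1 forget_comp setUC.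
by rewrite !forget1K.
Qed.

Lemma insert2K r a b x y : r a = a -> r b = b -> a != b -> x != b ->
  forget [set a; b] (insert2 r a b x y) = r /\
  positions2 (insert2 r a b x y) a b = (x, y).
Proof.
move=> ra rb ab xb.
have fb : insert1 r x a b = b by rewrite permM tpermD.
have E : forget1 (insert2 r a b x y) b = insert1 r x a by rewrite insert1K.
split; first by rewrite setUC -forget_comp !forget_set1 E insert1K.
rewrite /positions2 E; congr pair.
  by apply: (@perm_inj _ (insert1 r x a)); rewrite permKV /insert1 permM tpermL.
by apply: (@perm_inj _ (insert2 r a b x y)); rewrite permKV permM tpermL.
Qed.

(** One step of the count. An edge has two darts, [a] and [b]: [a] is placed
    after a point outside [A], then [b] after such a point or after [a], and
    the rest of [A] is inserted later. The condition on [Q] says that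
    neither of them is left alone in its cycle. *)
Lemma card_forget (Q : pred {perm T}) A a b r :
  {in A, forall x, r x = x} -> a \in A -> b \in A -> a != b ->
  (forall rf, Q rf -> forget A rf = r ->
     let r1 := forget (A :\: [set a; b]) rf in r1 b != b /\ forget1 r1 b a != a) ->
  #|[set rf | (forget A rf == r) && Q rf]| =
  (\sum_(x in ~: A) \sum_(y in a |: ~: A)
    #|[set rf | (forget (A :\: [set a; b]) rf == insert2 r a b x y) && Q rf]|)%N.
Proof.
move=> fA aA bA ab attQ; set A' := A :\: _.
have AE : A = A' :|: [set a; b].
  apply/setP=> z; rewrite !inE; case: (eqVneq z a) => [->|_] //=; case: (eqVneq z b) => [->|_] //=.
  by rewrite orbF.
pose f rf := positions2 (forget A' rf) a b.
have fE rf : forget A rf = r -> forget A' rf = insert2 r a b (f rf).1 (f rf).2.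
  by move=> e; rewrite /f -{1}(positions2K (forget A' rf) a b) forget_comp -AE e.
rewrite -sum1_card pair_big_dep /=.
rewrite (partition_big f (fun p => (p.1 \in ~: A) && (p.2 \in a |: ~: A))) /=; last first.
  move=> rf; rewrite inE => /andP[/eqP fr Qr].
  have [nb na] : forget A' rf b != b /\ forget1 (forget A' rf) b a != a by apply: attQ.
  have rA' x : x \in A' -> forget A' rf x = x by apply: forget_in.
  have E1 : forget A' rf (f rf).2 = b by rewrite /= permKV.
  have E2 : forget1 (forget A' rf) b (f rf).1 = a by rewrite /= permKV.
  have nbb : (f rf).2 != b by apply: contraNneq nb => {1}<-; apply/eqP.
  have naa : (f rf).1 != a by apply: contraNneq na => {1}<-; apply/eqP.
  have f1b : forget1 (forget A' rf) b b = b by rewrite -forget_set1 forget_in ?inE.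
  have nab : (f rf).1 != b by apply: contraNneq ab => e'; rewrite -E2 e' f1b.
  have nA1 : (f rf).2 \notin A'.
    apply/negP => xA'; have := rA' _ xA'; rewrite E1 => e'.
    by rewrite -e' eqxx in nbb.
  have nA2 : (f rf).1 \notin A'.
    apply/negP => xA'; have := rA' _ xA' => e'.
    have : forget1 (forget A' rf) b (f rf).1 = (f rf).1.
      rewrite /forget1 permM tpermD ?e' // eq_sym //; apply: contraNneq nab => e2.
      by rewrite -e' e2 permKV.
    by rewrite E2 => e2; rewrite -e2 eqxx in naa.
  rewrite AE; apply/andP; split.
    by rewrite inE in_setU in_set2 negb_or nA2 (negbTE naa) (negbTE nab).
  rewrite in_setU1 in_setC in_setU in_set2 (negbTE nA1) (negbTE nbb) orbF /=.
  by case: (_ == a).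
apply: eq_bigr => -[x y] /= /andP[xA yA]; rewrite -sum1_card.
have xb : x != b by apply: contraTneq xA => ->; rewrite inE bA.
apply: eq_bigl => rf; rewrite !inE.
have [E1 E2] := insert2K y (fA _ aA) (fA _ bA) ab xb.
apply/andP/andP => [[/andP[/eqP fr Qr] /eqP e]|[/eqP fr Qr]].
  by rewrite (fE _ fr) e eqxx.
by rewrite /f fr E2 Qr AE -forget_comp fr E1 !eqxx.
Qed.

Lemma next_outside_iter A r x z n :
  z \notin A -> iter n.+1 r x = z -> (forall j : nat, (0 < j <= n)%N -> iter j r x \in A) ->
  next_outside A r x z.
Proof.
move=> zA; elim: n x => [|n IH] x e H; first by rewrite -e; apply: NextNow; rewrite -[r x]/(iter 1 r x) e.
apply: NextLater; first exact: (H 1%N).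
apply: IH; first by rewrite -iterSr.
by move=> j jn; rewrite -iterSr; apply: H; lia.
Qed.

Lemma next_outsideP A r x z : next_outside A r x z ->
  exists n : nat, iter n.+1 r x = z /\ forall j : nat, (0 < j <= n)%N -> iter j r x \in A.
Proof.
elim=> {x z} [x _|x z xA _ [n [e H]]]; first by exists 0%N; split=> // j; lia.
exists n.+1; rewrite iterSr e; split=> // -[//|[//|j]] jn.
by rewrite iterSr H.
Qed.

End Forget.

(** * The recursions satisfied by the volume *)

Section SubsetSums.
Variables (I : finType) (V : nmodType).
Implicit Types (U J : {set I}) (u : I).

Lemma sum_subset_remove U (G : I -> {set I} -> V) :
  \sum_(u in U) \sum_(J : {set I} | J \subset U :\ u) G u J =
  \sum_(J : {set I} | J \subset U) \sum_(u in J) G u (J :\ u).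
Proof.
rewrite [RHS](exchange_big_dep (fun u => u \in U)) /=; last first.
  by move=> J u /subsetP s; apply: s.
apply: eq_bigr => u uU.
rewrite [RHS](reindex_onto (fun J => u |: J) (fun J => J :\ u)) /=; last first.
  by move=> J /andP[_ uJ]; rewrite setD1K.
apply: eq_big => [J|J JU]; last first.
  by rewrite setU1K //; move: JU; rewrite subsetD1 => /andP[].
rewrite subsetD1 setU11 subUset sub1set uU andbT /=; congr andb.
apply/idP/eqP => [uJ|<-]; first by rewrite setU1K.
by rewrite !inE eqxx.
Qed.

Lemma sum_subset_keep U (G : I -> {set I} -> V) :
  \sum_(u in U) \sum_(J : {set I} | J \subset U :\ u) G u J =
  \sum_(J : {set I} | J \subset U) \sum_(u in U :\: J) G u J.
Proof.
rewrite [RHS](exchange_big_dep (fun u => u \in U)) /=; last first.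
  by move=> J u _; rewrite inE => /andP[].
apply: eq_bigr => u uU; apply: eq_bigl => J.
by rewrite subsetD1 !inE uU andbT.
Qed.

Lemma sum_subset_split U u (F : {set I} -> V) : u \in U ->
  \sum_(J : {set I} | J \subset U) F J =
  \sum_(J : {set I} | J \subset U :\ u) (F (u |: J) + F J).
Proof.
move=> uU; rewrite big_split /= (bigID (fun J : {set I} => u \in J)) /=; congr (_ + _).
  rewrite [LHS](reindex_onto (fun J => u |: J) (fun J => J :\ u)) /=; last first.
    by move=> J /andP[_ uJ]; rewrite setD1K.
  apply: eq_bigl => J; rewrite subsetD1 setU11 subUset sub1set uU andbT /=; congr andb.
  apply/eqP/idP => [<-|uJ]; first by rewrite !inE eqxx.
  by rewrite setU1K.
by apply: eq_bigl => J; rewrite subsetD1.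
Qed.

End SubsetSums.

Section Numbers.
Variables (I : finType) (w : I -> nat).
Implicit Types (U J : {set I}) (u : I) (d c n : nat).

Definition weight J := (\sum_(i in J) w i)%N.

Lemma weight0 : weight set0 = 0%N. Proof. exact: big_set0. Qed.

Lemma weightU1 u J : u \notin J -> weight (u |: J) = (w u + weight J)%N.
Proof. exact: big_setU1. Qed.

Lemma weightD1 u J : u \in J -> weight J = (w u + weight (J :\ u))%N.
Proof. exact: big_setD1. Qed.

Lemma weightD U J : J \subset U -> (weight J + weight (U :\: J))%N = weight U.
Proof. by move=> JU; rewrite [RHS](big_setID J) /= (setIidPr JU). Qed.

Lemma sum_kappa J : \sum_(u in J) ((w u)%:R - 2) = (weight J)%:R - 2 * #|J|%:R :> rat.
Proof. by rewrite sumrB sumr_const -natr_sum -[2 *+ _]mulr_natr. Qed.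

(** This is [f2 (d - 2) (j + 1)], see [f2_hang]. Up to a factor depending on
    the pieces, it counts the ways to hang [j] pieces on a face whose final
    degree is [d]. *)
Definition hang d j : rat :=
  if j is j'.+1 then \prod_(i < j') (d%:R - 2 * i.+1%:R) else d%:R^-1.

Lemma hangS d j : (0 < d)%N -> hang d j.+1 = hang d j * (d%:R - 2 * j%:R).
Proof.
case: j => [|j] d0 /=; last by rewrite big_ord_recr.
by rewrite big_ord0 mulr0 subr0 mulVf // pnatr_eq0 -lt0n.
Qed.

Definition hang2 d1 d2 U J : rat := hang d1 #|J| * hang d2 #|U :\: J|.

(** Forests of the pieces in [U] growing on two faces of degrees [n1] and
    [n2], which become faces of degrees [d1] and [d2]; [J] is the set of the
    pieces which go to the first face. *)
Definition forests d1 d2 n1 n2 U : rat :=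
  \sum_(J : {set I} | J \subset U)
    if (n1 + weight J == d1)%N && (n2 + weight (U :\: J) == d2)%N
    then n1%:R * n2%:R * hang2 d1 d2 U J else 0.

(** The same with a further chain of pieces of total weight [c], whose last
    edge has not been inserted yet and will lead to one of the two faces. *)
Definition chain_forests d1 d2 n1 n2 c U : rat :=
  \sum_(J : {set I} | J \subset U) hang2 d1 d2 U J * (n1%:R * n2%:R) *
    ((if (n1 + c + weight J == d1)%N && (n2 + weight (U :\: J) == d2)%N
      then d1%:R - 2 * #|J|%:R else 0) +
     (if (n1 + weight J == d1)%N && (n2 + c + weight (U :\: J) == d2)%N
      then d2%:R - 2 * #|U :\: J|%:R else 0)).

(** The same when there is only the chain, which has to close to a cycle.
    The truncated differences are the coefficients of the volume for two
    sets of pieces, [J] and its union with the dominant piece, see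
    [vol_unicycles]. *)
Definition unicycles d1 d2 c U : rat :=
  \sum_(J : {set I} | J \subset U) hang2 d1 d2 U J *
    ((weight (U :\: J) - d2)%:R * (d1%:R - 2 * #|J|%:R) +
     (d1 - weight J)%:R * (d2%:R - 2 * #|U :\: J|%:R)).

Section Rec.
Variables d1 d2 : nat.
Hypotheses (d1_gt0 : (0 < d1)%N) (d2_gt0 : (0 < d2)%N).

Lemma card_setD1 U u : u \in U -> #|U| = #|U :\ u|.+1.
Proof. by move=> uU; rewrite (cardsD1 u U) uU. Qed.

Lemma setDU1 U J u : u \notin J -> (u |: U) :\: J = u |: (U :\: J).
Proof.
move=> uJ; apply/setP=> x; rewrite !inE; case: eqVneq => [->|] //=.
by rewrite uJ.
Qed.

Lemma setDU1r U J u : u \notin U -> (u |: U) :\: (u |: J) = U :\: J.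
Proof.
move=> uU; apply/setP=> x; rewrite !inE; case: eqVneq => [->|] //=.
by rewrite (negbTE uU) andbF.
Qed.

Lemma remove_piece U J u : u \in U -> J \subset U :\ u ->
  [/\ U :\: (u |: J) = U :\ u :\: J, weight (u |: J) = (w u + weight J)%N,
      weight (U :\: J) = (w u + weight (U :\ u :\: J))%N,
      hang2 d1 d2 U (u |: J) = hang2 d1 d2 (U :\ u) J * (d1%:R - 2 * #|J|%:R) &
      hang2 d1 d2 U J = hang2 d1 d2 (U :\ u) J * (d2%:R - 2 * #|U :\ u :\: J|%:R)].
Proof.
move=> uU; rewrite subsetD1 => /andP[JU uJ]; set U' := U :\ u.
have uU' : u \notin U' by rewrite !inE eqxx.
have UE : U = u |: U' by rewrite setD1K.
have E1 : U :\: (u |: J) = U' :\: J by rewrite UE setDU1r.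
have E2 : U :\: J = u |: (U' :\: J) by rewrite UE setDU1.
have uUJ : u \notin U' :\: J by rewrite !inE eqxx andbF.
rewrite /hang2 E1 E2 !cardsU1 uJ uUJ !weightU1 // !add1n !hangS //.
by split=> //; ring.
Qed.

(** A set which contains [M] and one which does not are put together: the
    piece [M], whose edge goes to one of the two faces, is a chain by
    itself. *)
Lemma forestsE n1 n2 U M : M \in U ->
  forests d1 d2 n1 n2 U = chain_forests d1 d2 n1 n2 (w M) (U :\ M).
Proof.
move=> MU; rewrite /forests (sum_subset_split _ MU); apply: eq_bigr => J JU.
have [-> -> -> -> ->] := remove_piece MU JU.
rewrite [RHS]mulrDr !addnA; congr (_ + _); case: ifP => _; rewrite ?mulr0 //; ring.
Qed.

(** Each [F J] occurs once for every [u] in [J] and each [G J] once for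
    every [u] in [U :\: J], with coefficients whose sum is given by
    [sum_kappa]. *)
Lemma sum_merge U (F G : {set I} -> rat) :
  \sum_(u in U) ((w u)%:R - 2) *
     (\sum_(J : {set I} | J \subset U :\ u) (F (u |: J) + G J)) =
  \sum_(J : {set I} | J \subset U)
     (F J * ((weight J)%:R - 2 * #|J|%:R) +
      G J * ((weight (U :\: J))%:R - 2 * #|U :\: J|%:R)).
Proof.
under eq_bigr do rewrite mulr_sumr.
under eq_bigr do under eq_bigr do rewrite mulrDr.
under eq_bigr do rewrite big_split.
rewrite /= big_split /= sum_subset_remove sum_subset_keep -big_split /=.
apply: eq_bigr => J _; rewrite -!sum_kappa !mulr_sumr; congr (_ + _).
  by apply: eq_bigr => u uJ; rewrite setD1K // mulrC.
by apply: eq_bigr => u uJ; rewrite mulrC.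
Qed.

(** The last edge of the chain ends on one of the two faces, which absorb it
    at each of their corners, or in another piece [u] at one of its [w u -
    2] corners. *)
Lemma chain_forests_rec n1 n2 c U :
  chain_forests d1 d2 n1 n2 c U =
    n1%:R * forests d1 d2 (n1 + c) n2 U + n2%:R * forests d1 d2 n1 (n2 + c) U +
    \sum_(u in U) ((w u)%:R - 2) * chain_forests d1 d2 n1 n2 (c + w u) (U :\ u).
Proof.
pose F J := if (n1 + c + weight J == d1)%N && (n2 + weight (U :\: J) == d2)%N
  then hang2 d1 d2 U J * (n1%:R * n2%:R) else 0.
pose G J := if (n1 + weight J == d1)%N && (n2 + c + weight (U :\: J) == d2)%N
  then hang2 d1 d2 U J * (n1%:R * n2%:R) else 0.
have -> : \sum_(u in U) ((w u)%:R - 2) * chain_forests d1 d2 n1 n2 (c + w u) (U :\ u)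
  = \sum_(u in U) ((w u)%:R - 2) *
     (\sum_(J : {set I} | J \subset U :\ u) (F (u |: J) + G J)).
  apply: eq_bigr => u uU; congr (_ * _); apply: eq_bigr => J JU; rewrite /F /G.
  have [-> -> -> -> ->] := remove_piece uU JU.
  rewrite !addnA [LHS]mulrDr; congr (_ + _); case: ifP => _; rewrite ?mulr0 //; ring.
rewrite sum_merge /forests /chain_forests !mulr_sumr -!big_split /=.
apply: eq_bigr => J JU; rewrite /F /G mulrDr.
have -> (a b a' b' : rat) : a + b + (a' + b') = (a + a') + (b + b') by ring.
congr (_ + _).
  case: ifP => [/andP[/eqP e1 /eqP e2]|_]; last by rewrite !mulr0 mul0r addr0.
  by rewrite -e1 !natrD; ring.
case: ifP => [/andP[/eqP e1 /eqP e2]|_]; last by rewrite !mulr0 mul0r addr0.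
by rewrite -e2 !natrD; ring.
Qed.

(** There is no other face yet: the last edge of the chain either divides
    the face of degree [c] of the chain into two, or leads to another piece. *)
Lemma unicycles_rec c U : (0 < c)%N -> (c + weight U = d1 + d2)%N ->
  unicycles d1 d2 c U =
    \sum_(1 <= n < c) forests d1 d2 n (c - n) U +
    \sum_(u in U) ((w u)%:R - 2) * unicycles d1 d2 (c + w u) (U :\ u).
Proof.
move=> c0 cU.
pose F J := hang2 d1 d2 U J * (weight (U :\: J) - d2)%:R.
pose G J := hang2 d1 d2 U J * (d1 - weight J)%:R.
have -> : \sum_(u in U) ((w u)%:R - 2) * unicycles d1 d2 (c + w u) (U :\ u)
  = \sum_(u in U) ((w u)%:R - 2) *
     (\sum_(J : {set I} | J \subset U :\ u) (F (u |: J) + G J)).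
  apply: eq_bigr => u uU; congr (_ * _); apply: eq_bigr => J JU; rewrite /F /G.
  have [-> _ _ -> ->] := remove_piece uU JU.
  by ring.
rewrite sum_merge /forests exchange_big /= -big_split /=.
apply: eq_bigr => J JU; have wJ := weightD JU.
set x := weight J in wJ *; set y := weight (U :\: J) in wJ *.
have -> : \sum_(1 <= n < c)
    (if (n + x == d1)%N && (c - n + y == d2)%N
     then n%:R * (c - n)%:R * hang2 d1 d2 U J else 0) =
   (d1 - x)%:R * (d2 - y)%:R * hang2 d1 d2 U J.
  have [lx|gx] := leqP d1 x.
    rewrite (_ : d1 - x = 0)%N ?mul0r; last by lia.
    by rewrite big_nat big1 // => n n0; rewrite ifF //; apply/negbTE; lia.
  have [ly|gy] := leqP d2 y.
    rewrite (_ : d2 - y = 0)%N ?mulr0 ?mul0r; last by lia.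
    by rewrite big_nat big1 // => n n0; rewrite ifF //; apply/negbTE; lia.
  rewrite (bigD1_seq (d1 - x)%N) ?mem_index_iota ?iota_uniq //=; last by lia.
  rewrite ifT; last by lia.
  rewrite big1_seq ?addr0; last first.
    move=> n /andP[n1]; rewrite mem_index_iota => n2.
    by rewrite ifF //; apply/negbTE; lia.
  by congr (_ * _%:R * _); lia.
rewrite /F /G -/x -/y; move: (hang2 _ _ _ _) (#|J|) (#|_|) => H j k.
have [ly|gy] := leqP d2 y.
  rewrite (_ : d2 - y = 0)%N; last by lia.
  have ex : (d1 - x)%:R = d1%:R - x%:R :> rat by rewrite natrB //; lia.
  by rewrite ex; move: ((y - d2)%:R) (natrB rat ly) => z ->; ring.
rewrite (_ : y - d2 = 0)%N; last by lia.
have -> : (d2 - y)%:R = d2%:R - y%:R :> rat by rewrite natrB //; lia.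
by ring.
Qed.

End Rec.

Lemma forestsC d1 d2 n1 n2 U : forests d1 d2 n1 n2 U = forests d2 d1 n2 n1 U.
Proof.
rewrite /forests (reindex_onto (fun J => U :\: J) (fun J => U :\: J)) /=; last first.
  by move=> J JU; rewrite setDDr setDv set0U (setIidPr JU).
apply: eq_big => [J|J /andP[_ /eqP JU]].
  rewrite subsetDl setDDr setDv set0U /=; apply/eqP/idP => [<-|/setIidPr //].
  exact: subsetIl.
rewrite /hang2 JU andbC; case: ifP => // _; ring.
Qed.

(** The terms do not correspond to each other, only the sums agree; the
    recursion shows it, as its terms without a chain are symmetric. *)
Lemma unicyclesC d1 d2 c U : (0 < d1)%N -> (0 < d2)%N -> (0 < c)%N ->
  (c + weight U = d1 + d2)%N -> unicycles d1 d2 c U = unicycles d2 d1 c U.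
Proof.
move=> d10 d20; move En : #|U| => n; elim: n c U En => [|n IH] c U En c0 cU.
  have cU' : (c + weight U = d2 + d1)%N by rewrite (addnC d2).
  rewrite (unicycles_rec d10 d20 c0 cU) (unicycles_rec d20 d10 c0 cU').
  rewrite (cards0_eq En) !big_set0 !addr0 big_nat_rev /= [LHS]big_nat [RHS]big_nat.
  by apply: eq_bigr => i ic; rewrite forestsC; congr forests; lia.
have cU' : (c + weight U = d2 + d1)%N by rewrite (addnC d2).
rewrite (unicycles_rec d10 d20 c0 cU) (unicycles_rec d20 d10 c0 cU').
congr (_ + _).
  rewrite big_nat_rev /= [LHS]big_nat [RHS]big_nat.
  by apply: eq_bigr => i ic; rewrite forestsC; congr forests; lia.
apply: eq_bigr => u uU; congr (_ * _); apply: IH; last 1 first.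
- by rewrite -addnA -weightD1.
- by move: En; rewrite (card_setD1 uU) => -[].
- by rewrite addn_gt0 c0.
Qed.

End Numbers.

Section Vol.
Variables (h : nat) (g : 'I_h -> nat) (m1 m2 : int) (d1 d2 : nat).
Hypotheses (d1E : d1%:Z = m1 + 2) (d2E : d2%:Z = m2 + 2).
Hypotheses (d1_gt0 : (0 < d1)%N) (d2_gt0 : (0 < d2)%N).
Hypothesis d12 : (d1 + d2 = weight (fun i => 4 * g i) [set: 'I_h])%N.

Let w (i : 'I_h) := (4 * g i)%N.

Lemma f2_hang m d j : d%:Z = m + 2 -> f2 m j.+1 = hang d j.
Proof.
move=> dE; have -> : m = d%:Z - 2 by rewrite dE addrK.
case: j => [|j] /=; first by rewrite subrK.
by apply: eq_bigr => i _; rewrite !rmorphB rmorphM /= -[i.+1%:R]natr1; ring.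
Qed.

(** The terms of the volume for the sets with [M] and without [M] are put
    together. Their coefficients [c1], when positive, are the truncated
    differences in [unicycles]. *)
Lemma vol_unicycles (M : 'I_h) : vol g m1 m2 = unicycles w d1 d2 (w M) [set~ M].
Proof.
have volE : vol g m1 m2 =
    \sum_(J : {set 'I_h} | J \subset [set: 'I_h])
      (d1 - weight w J)%:R * hang d1 #|J| * hang d2 #|~: J|.
  rewrite /vol big_mkcond /=; apply: eq_big => [J|J _]; first by rewrite subsetT.
  have cE : c1 g m1 J = d1%:Z - (weight w J)%:Z.
    rewrite /c1 /weight d1E; congr (_ - _).
    by rewrite (big_morph Posz PoszD (erefl 0%:Z)).
  rewrite cE -/(f2 m1 _.+1) -/(f2 m2 _.+1) (f2_hang _ d1E) (f2_hang _ d2E); case: ifPn => [c0|c0].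
    by congr (_ * _ * _); rewrite subzn -?pmulrn //; lia.
  by rewrite (_ : d1 - weight w J = 0)%N ?mul0r //; lia.
rewrite volE (sum_subset_split _ (in_setT M)) setTD; apply: eq_bigr => J JM.
have dJ := weightD w JM.
have wT : (weight w [set: 'I_h] = w M + weight w [set~ M])%N.
  by rewrite (weightD1 w (in_setT M)) setTD.
move: (JM); rewrite -setTD => /(remove_piece w d1_gt0 d2_gt0 (in_setT M)) [_ -> _ h1 h2].
rewrite -!mulrA -2!setTD -/(hang2 d1 d2 setT (M |: J)) -/(hang2 d1 d2 setT J) h1 h2 setTD.
rewrite (_ : d1 - (w M + weight w J) = weight w ([set~ M] :\: J) - d2)%N; first by rewrite /hang2; ring.
by move: d12; rewrite -[weight _ _]/(weight w _); lia.
Qed.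

End Vol.

(** * Exploration of a functional graph *)

Section Exploration.
Variables (I : finType) (D : I -> nat).

Definition leader (Q : {set I}) : option I :=
  [pick M in Q | (\sum_(i in Q :\ M) D i < D M)%N].

Variables (tau : I -> I) (A B : I -> bool).

(** The walk has visited the set [Ch] since it started from its leader, and
    is at [cur]; [Bs] is the set of pieces visited before. The color of the
    tail of the edge [cur] must be [e], white being [true]. A walk that
    returns to [Ch] makes a cycle, which must happen in the first walk only.
    The number [n] of pieces not visited yet bounds the recursion. *)
Fixpoint explore n (Bs Ch : {set I}) cur e : bool :=
  (A cur == e) &&
  (if tau cur \in Bs :|: Ch then
     ((tau cur \in Ch) ==> (Bs == set0)) &&
     (if n is n'.+1 then
        if leader (~: (Bs :|: Ch)) is Some M then
          explore n' (Bs :|: Ch) [set M] M true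
        else true
      else true)
   else if n is n'.+1 then explore n' Bs (tau cur |: Ch) (tau cur) (~~ B cur)
   else true).

Definition tau_connected : Prop :=
  forall T : {set I}, (forall k, (tau k \in T) = (k \in T)) -> T != set0 -> T = setT.

Section Flow.
Variable R : realFieldType.

Definition color_sign (c : bool) : R := if c then 1 else -1.
Local Notation sg := color_sign.

(** The edge [i] has its tail in [i], at a vertex of color [A i], and its
    head in [tau i], at a vertex of color [B i]. *)
Definition is_flow (w : I -> R) : Prop :=
  forall i, sg (A i) * w i + \sum_(k | tau k == i) sg (B k) * w k = (D i)%:R.

Variable w : I -> R.
Hypothesis flow_w : is_flow w.

Lemma normr_color_sign c (x : R) : `|sg c * x| = `|x|.
Proof. by case: c; rewrite /color_sign ?mul1r // mulN1r normrN. Qed.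

Lemma color_signN c : sg (~~ c) = - sg c.
Proof. by case: c; rewrite /color_sign ?opprK. Qed.

Lemma color_sign_sq c : sg c * sg c = 1.
Proof. by case: c; rewrite /color_sign ?mulrNN mulr1. Qed.

Let ar1 (a b c s : R) : a + b < c -> - b <= s -> a < c + s.
Proof. lra. Qed.

Let ar2 (s x q sd u t m : R) : s = x + 0 + sd -> q < s -> sd <= u -> u <= q + t ->
  t = 0 \/ t = m -> `|x| = m -> 0 < x.
Proof.
move=> e1 e2 e3 e4 e5 e6; have m0 : 0 <= m by rewrite -e6.
have : 0 < x + `|x| by rewrite e6; case: e5 => e5; lra.
by case: (lerP 0 x) => [x0|x0]; [rewrite ger0_norm //; lra | rewrite ltr0_norm //; lra].
Qed.

Let ar3 (s x y q sd u : R) : s = x + y + sd -> q < s -> sd <= u -> u <= q + 0 ->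
  y = x \/ y = - x -> 0 < x.
Proof. by move=> e1 e2 e3 e4 [e5|e5]; lra. Qed.

(** The function [s] assigns signs to the pieces of the chain so that the
    contributions of each inner edge cancel, beginning with a positive sign
    at the leader [M]. *)
Record chain_inv (Bs Ch : {set I}) M cur e s : Prop := ChainInv {
  ch_cur : cur \in Ch;
  ch_dis : [disjoint Bs & Ch];
  ch_base : forall k, k \in Bs -> tau k \in Bs;
  ch_lead : M \in Ch;
  ch_leadT : s M = true;
  ch_dom : (\sum_(i in ~: Bs :\ M) D i < D M)%N;
  ch_next : forall k, k \in Ch -> k != cur -> tau k \in Ch /\
     sg (s k) * sg (A k) + sg (s (tau k)) * sg (B k) = 0;
  ch_last : s cur = e }.

Lemma flow_bound i : `|w i| <= (D i)%:R + \sum_(k | tau k == i) `|w k|.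
Proof.
have -> : w i = sg (A i) * ((D i)%:R - \sum_(k | tau k == i) sg (B k) * w k).
  by rewrite -(flow_w i) addrK mulrA color_sign_sq mul1r.
rewrite normr_color_sign (le_trans (ler_normB _ _)) // lerD ?normr_nat //.
rewrite (le_trans (ler_norm_sum _ _ _)) // ler_sum // => k _.
by rewrite normr_color_sign.
Qed.

(** Add up the equations of the pieces of the chain with the signs [s]. The
    inner edges cancel, and there remain the term of [cur], with that of the
    head of its edge if this is in the chain too, and the edges entering
    from the set [Q] of the pieces not visited yet. The latter are at most
    the sum of [D] over [Q], increased by [`|w cur|] if the edge [cur]
    itself enters [Q]. As the leader is dominant this leaves no other sign
    for the term of [cur]. *)
Lemma chain_sign Bs Ch M cur e s : chain_inv Bs Ch M cur e s ->
  0 < sg e * sg (A cur) * w cur.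
Proof.
case=> curC dis base MC sM dom next sc.
set Q := ~: (Bs :|: Ch); set x := _ * w cur.
have CB k : k \in Ch -> k \notin Bs.
  by move=> kC; apply: contraTN dis => kB; apply/pred0Pn; exists k; rewrite /= kB kC.
(* The sum of [flow_bound] over [Q]: the edges inside [Q] cancel, and no
   edge enters [Q] from outside except possibly that of [cur]. *)
have side_bound : \sum_(k in Q | tau k \notin Q) `|w k| <=
    \sum_(i in Q) (D i)%:R + (if tau cur \in Q then `|w cur| else 0).
  have le1 : \sum_(i in Q) `|w i| <= \sum_(i in Q) (D i)%:R + \sum_(k | tau k \in Q) `|w k|.
    rewrite [X in _ + X](partition_big tau (fun i => i \in Q)) //= -big_split /=.
    apply: ler_sum => i iQ; rewrite (le_trans (flow_bound i)) // lerD // le_eqVlt.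
    apply/orP; left; apply/eqP/eq_bigl => k.
    by case: eqP => [->|]; rewrite ?iQ ?andbF.
  have le2 : \sum_(k | tau k \in Q) `|w k| =
     \sum_(k in Q | tau k \in Q) `|w k| + (if tau cur \in Q then `|w cur| else 0).
    rewrite (bigID (fun k => k \in Q)) /=; congr (_ + _); first by apply: eq_bigl => k; rewrite andbC.
    have H k : (tau k \in Q) && (k \notin Q) = (k == cur) && (tau cur \in Q).
      case: eqVneq => [->|kc] /=; first by rewrite !inE curC orbT andbT.
      apply/negP => /andP[tQ]; rewrite /Q inE negbK inE => /orP[kB|kC].
        by move: tQ; rewrite !inE base.
      by have [tC _] := next _ kC kc; move: tQ; rewrite !inE tC orbT.
    rewrite (eq_bigl _ _ H); case: ifP => tQ; last by rewrite big_pred0 // => k; rewrite andbF.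
    by rewrite (big_pred1 cur) // => k; rewrite andbT.
  rewrite le2 (bigID (fun k => tau k \in Q)) /= in le1.
  by rewrite -(lerD2l (\sum_(k in Q | tau k \in Q) `|w k|)) addrCA.
have main : \sum_(i in Ch) sg (s i) * (D i)%:R =
    x + (if tau cur \in Ch then sg (s (tau cur)) * sg (B cur) * w cur else 0) +
    \sum_(k in Q | tau k \in Ch) sg (s (tau k)) * sg (B k) * w k.
  have -> : \sum_(i in Ch) sg (s i) * (D i)%:R =
     \sum_(k in Ch) sg (s k) * sg (A k) * w k +
     \sum_(k | tau k \in Ch) sg (s (tau k)) * sg (B k) * w k.
    rewrite [X in _ + X](partition_big tau (fun i => i \in Ch)) //= -big_split /=.
    apply: eq_bigr => i iC; rewrite -flow_w mulrDr mulrA; congr (_ + _).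
    rewrite mulr_sumr; apply: eq_big => [k|k /eqP <-]; last by rewrite mulrA.
    by case: eqP => [->|]; rewrite ?iC ?andbF.
  rewrite [X in _ + X](bigID (fun k => k \in Ch)) /= addrA.
  congr (_ + _); last first.
    apply: eq_bigl => k; rewrite !inE andbC; case tC: (tau k \in Ch); rewrite ?andbF //= !andbT.
    rewrite negb_or; case kC: (k \in Ch); rewrite ?andbF //= andbT.
    by apply/esym/negP => /base; apply/negP; exact: CB.
  have -> : \sum_(k | (tau k \in Ch) && (k \in Ch)) sg (s (tau k)) * sg (B k) * w k =
     (if tau cur \in Ch then sg (s (tau cur)) * sg (B cur) * w cur else 0) +
     \sum_(k in Ch | k != cur) sg (s (tau k)) * sg (B k) * w k.
    rewrite (bigID (fun k => k == cur)) /=; congr (_ + _).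
      case: ifP => tC; last first.
        by rewrite big_pred0 // => k; case: eqP => [->|]; rewrite ?tC ?andbF.
      by rewrite (big_pred1 cur) // => k /=; case: eqP => [->|]; rewrite ?tC ?curC ?andbF.
    apply: eq_bigl => k; case: (eqVneq k cur) => [->|kc]; rewrite ?andbF //= !andbT.
    by case kC: (k \in Ch); rewrite ?andbF //; have [-> _] := next _ kC kc.
  rewrite (bigD1 cur) //= sc -/x -addrA; congr (_ + _).
  rewrite addrCA -big_split /= big1 ?addr0 // => k /andP[kC kc].
  by have [_ e0] := next _ kC kc; rewrite -mulrDl e0 mul0r.
(* The worst signs for the pieces of the chain other than [M] are negative. *)
have dom' : \sum_(i in Q) (D i)%:R < \sum_(i in Ch) sg (s i) * (D i)%:R.
  move: dom; rewrite -(ltr_nat R) natr_sum.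
  have -> : \sum_(i in ~: Bs :\ M) (D i)%:R =
     \sum_(i in Q) (D i)%:R + \sum_(i in Ch :\ M) (D i)%:R :> R.
    rewrite (bigID (fun i => i \in Ch)) /= addrC; congr (_ + _); apply: eq_bigl => i.
      by rewrite !inE negb_or; case: eqVneq => [->|_]; rewrite /= ?MC ?andbF.
    rewrite !inE; case iC: (i \in Ch); rewrite ?andbF // !andbT; case: eqP => //= _.
    by rewrite CB.
  rewrite [X in _ -> _ < X](bigD1 M) //= sM mul1r => dm; apply: ar1 dm _.
  rewrite -sumrN [X in _ <= X](eq_bigl (fun i => i \in Ch :\ M)); last by move=> i; rewrite !inE andbC.
  apply: ler_sum => i _; rewrite /color_sign; case: (s i); last by rewrite mulN1r.
  by rewrite mul1r -subr_ge0 opprK addr_ge0.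
have sideQ : \sum_(k in Q | tau k \in Ch) sg (s (tau k)) * sg (B k) * w k <=
   \sum_(k in Q | tau k \notin Q) `|w k|.
  rewrite [X in _ <= X](bigID (fun k => tau k \in Ch)) /=.
  rewrite -[X in X <= _]addr0 lerD //; last by apply: sumr_ge0.
  rewrite [X in _ <= X](eq_bigl (fun k => (k \in Q) && (tau k \in Ch))); last first.
    by move=> k; rewrite !inE; case: (tau k \in Ch); rewrite ?andbF ?orbT ?andbT.
  by apply: ler_sum => k _; rewrite -mulrA (le_trans (ler_norm _)) // !normr_color_sign.
have xn : `|x| = `|w cur| by rewrite /x -mulrA !normr_color_sign.
have tQ : (tau cur \in Ch) -> (tau cur \in Q) = false by move=> tC; rewrite !inE tC orbT.
have : (if tau cur \in Ch then sg (s (tau cur)) * sg (B cur) * w cur else 0) = 0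
    /\ (tau cur \in Ch) = false \/
  (tau cur \in Ch) /\ ((if tau cur \in Ch then sg (s (tau cur)) * sg (B cur) * w cur else 0) = x \/
   (if tau cur \in Ch then sg (s (tau cur)) * sg (B cur) * w cur else 0) = - x).
  case: ifP => tC; last by left.
  right; split=> //; rewrite /x.
  case: (e); case: (A cur); case: (B cur); case: (s _); rewrite /color_sign ?mul1r ?mulN1r ?opprK ?mul1r; auto.
case=> [[e0 tC]|[tC e0]].
  rewrite e0 in main; apply: ar2 main dom' sideQ side_bound _ xn.
  by case: ifP; [right | left].
by rewrite (tQ tC) in side_bound; apply: ar3 main dom' sideQ side_bound e0.
Qed.

End Flow.

Hypothesis dominated : forall Q : {set I}, Q != set0 ->
  exists2 M, M \in Q & (\sum_(i in Q :\ M) D i < D M)%N.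

Lemma leaderP (Q : {set I}) : Q != set0 ->
  exists M, [/\ leader Q = Some M, M \in Q & (\sum_(i in Q :\ M) D i < D M)%N].
Proof.
move=> /dominated [M MQ dM]; rewrite /leader; case: pickP => [M' /andP[] |/(_ M)]; first by exists M'.
by rewrite MQ dM.
Qed.

Lemma chain_start (Bs : {set I}) M : (forall k, k \in Bs -> tau k \in Bs) -> M \in ~: Bs ->
  (\sum_(i in ~: Bs :\ M) D i < D M)%N -> forall R, @chain_inv R Bs [set M] M M true xpredT.
Proof.
move=> cl MB dM R; split=> //; rewrite ?set11 //.
  by rewrite disjoint_sym disjoints1; move: MB; rewrite inE.
by move=> k; rewrite inE => ->.
Qed.

(** A later walk which closes on itself would be a component of its own. *)
Lemma base_closing (Bs Ch : {set I}) cur : tau_connected -> [disjoint Bs & Ch] ->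
  cur \in Ch -> (forall k, k \in Bs -> tau k \in Bs) ->
  (forall k, k \in Ch -> k != cur -> tau k \in Ch) -> tau cur \in Ch -> Bs = set0.
Proof.
move=> conn dis cC clB next tC; apply/eqP/negPn/negP => /set0Pn [b bB].
pose T := [set k | [exists j in Bs, fconnect tau k j]].
have TT : T = setT.
  apply: conn; last first.
    by apply/set0Pn; exists b; rewrite inE; apply/existsP; exists b; rewrite bB connect0.
  move=> k; rewrite !inE; apply/existsP/existsP => -[j /andP[jB kj]].
    by exists j; rewrite jB (connect_trans (fconnect1 _ _) kj).
  have := iter_findex kj; case: (findex _ _ _) => [|n] /= e.
    by exists (tau j); rewrite clB //= -e connect0.
  by exists j; rewrite jB -e -iterS iterSr fconnect_iter.
have : cur \in T by rewrite TT inE.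
rewrite inE => /existsP [j /andP[jB /iter_findex e]].
have clC n : iter n tau cur \in Ch.
  by elim: n => //= n IH; case: (eqVneq (iter n tau cur) cur) => [->|] //; apply: next.
move: dis => /pred0Pn; apply; exists j; rewrite /= jB -e; exact: clC.
Qed.

Let compl_lead (Bs Ch : {set I}) M : ~: (Bs :|: Ch :|: [set M]) = ~: (Bs :|: Ch) :\ M.
Proof. by rewrite setCU setDE. Qed.

Let compl_next (Bs Ch : {set I}) u : ~: (Bs :|: (u |: Ch)) = ~: (Bs :|: Ch) :\ u.
Proof. by rewrite setUCA setCU setIC setDE. Qed.

Let card_remove (Q : {set I}) u n : u \in Q -> #|Q| = n.+1 -> #|Q :\ u| = n.
Proof. by move=> uQ; rewrite (cardsD1 u) uQ => -[]. Qed.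

(** By [chain_sign] the condition on the color of the tail of [cur] is the
    positivity of [w cur]. *)
Lemma explore_pos (R : realFieldType) (w : I -> R) : is_flow w -> tau_connected ->
  forall n Bs Ch M cur e s, #|~: (Bs :|: Ch)| = n -> chain_inv R Bs Ch M cur e s ->
  explore n Bs Ch cur e <-> (forall k, k \in cur |: ~: (Bs :|: Ch) -> 0 < w k).
Proof.
move=> flow conn; elim=> [|n IH] Bs Ch M cur e s En inv; have pos := chain_sign flow inv;
  case: (inv) => cC dis clB MC sM dM next sc.
all: have cE : (A cur == e) = (0 < w cur) by
  move: pos; case: (A cur); case: (e); rewrite /color_sign ?mulrNN ?mulr1 ?mul1r ?mulN1r ?oppr_gt0 => p;
    rewrite ?p //=; apply/esym/negbTE; rewrite -leNgt ltW.
all: have clos : (tau cur \in Ch) ==> (Bs == set0) by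
  apply/implyP => tC; apply/eqP; apply: (base_closing conn dis cC clB _ tC) => k kC kc;
  by have [] := next _ kC kc.
  have U0 : ~: (Bs :|: Ch) = set0 by apply: cards0_eq.
  rewrite /= clos cE U0 setU0; split=> [/andP[p _] k|p]; first by rewrite inE => /eqP ->.
  by rewrite p ?set11 //=; case: ifP.
rewrite /= clos /=; case: (eqVneq (A cur) e) cE => [Ae|_] /esym cE; last first.
  by split=> // /(_ cur); rewrite setU11 cE => /(_ isT).
suff G : (if tau cur \in Bs :|: Ch then
    if leader (~: (Bs :|: Ch)) is Some M' then explore n (Bs :|: Ch) [set M'] M' true else true
    else explore n Bs (tau cur |: Ch) (tau cur) (~~ B cur)) <->
    (forall k, k \in ~: (Bs :|: Ch) -> 0 < w k).
  split=> [/G H k|H]; first by rewrite in_setU1 => /orP[/eqP ->|/H].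
  by apply/G => k kU; apply: H; rewrite in_setU1 kU orbT.
case: ifP => tBC.
  have [|M' [-> M'Q dM']] := leaderP (Q := ~: (Bs :|: Ch)); first by rewrite -card_gt0 En.
  have clU k : k \in Bs :|: Ch -> tau k \in Bs :|: Ch.
    rewrite [in X in X -> _]inE => /orP[/clB|kC]; first by rewrite inE => ->.
    case: (eqVneq k cur) => [->|kc] //; have [] := next _ kC kc.
    by rewrite inE => ->; rewrite orbT.
  have En' : #|~: (Bs :|: Ch :|: [set M'])| = n by rewrite compl_lead; exact: card_remove En.
  by have -> := IH _ _ _ _ _ _ En' (chain_start clU M'Q dM' R); rewrite compl_lead setD1K.
have tU : tau cur \in ~: (Bs :|: Ch) by rewrite inE tBC.
have En' : #|~: (Bs :|: (tau cur |: Ch))| = n by rewrite compl_next; exact: card_remove En.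
have neq k : k \in Ch -> k != tau cur.
  by move=> kC; apply: contraFneq tBC => <-; rewrite inE kC orbT.
have inv' : chain_inv R Bs (tau cur |: Ch) M (tau cur) (~~ B cur)
    (fun i => if i == tau cur then ~~ B cur else s i).
  split=> //; rewrite ?setU11 ?eqxx //.
  - rewrite -setI_eq0 setIUr setU_eq0 !setI_eq0 dis andbT disjoint_sym disjoints1.
    by move: tU; rewrite !inE negb_or => /andP[].
  - by rewrite inE MC orbT.
  - by rewrite (negbTE (neq _ MC)).
  move=> k; rewrite in_setU1 => /orP[/eqP ->|kC _]; first by rewrite eqxx.
  rewrite (negbTE (neq _ kC)); case: (eqVneq k cur) => [->|kc].
    split; first by rewrite setU11.
    by rewrite sc eqxx Ae color_sign_sq color_signN mulNr color_sign_sq subrr.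
  have [tC e0] := next _ kC kc; split; first by rewrite inE tC orbT.
  by rewrite (negbTE (neq _ tC)).
by have -> := IH _ _ _ _ _ _ En' inv'; rewrite compl_next setD1K.
Qed.

(** Every walk but the first ends in a piece visited before, so that an
    invariant set contains all the visited pieces or none. *)
Lemma explore_connected (T : {set I}) : (forall k, (tau k \in T) = (k \in T)) ->
  forall n Bs Ch cur e, #|~: (Bs :|: Ch)| = n -> cur \in Ch ->
  (forall i j, i \in Bs -> j \in Bs -> (i \in T) = (j \in T)) ->
  (forall i, i \in Ch -> (i \in T) = (cur \in T)) ->
  explore n Bs Ch cur e -> forall i, (i \in T) = (cur \in T).
Proof.
move=> tT.
have unBC (Bs Ch : {set I}) cur : (forall i j, i \in Bs -> j \in Bs -> (i \in T) = (j \in T)) ->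
  (forall i, i \in Ch -> (i \in T) = (cur \in T)) ->
  tau cur \in Bs :|: Ch -> ((tau cur \in Ch) ==> (Bs == set0)) ->
  forall i, i \in Bs :|: Ch -> (i \in T) = (cur \in T).
  move=> unB unC; rewrite [in X in X -> _]inE => tBC /implyP B0 i.
  rewrite inE => /orP[iB|/unC //].
  case/orP: tBC => [tB|/B0 /eqP B00]; last by rewrite B00 inE in iB.
  by rewrite -(tT cur); exact: unB.
elim=> [|n IH] Bs Ch cur e En cC unB unC.
  have U0 : ~: (Bs :|: Ch) = set0 by apply: cards0_eq.
  have inBC i : i \in Bs :|: Ch by have := in_set0 i; rewrite -U0 inE => /negbFE.
  rewrite /=; case: ifP => [tBC /andP[_ /andP[/(unBC _ _ _ unB unC tBC) H _]] i|]; first exact: H.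
  by rewrite inBC.
rewrite /=; case: ifP => tBC /andP[_].
  move=> /andP[/(unBC _ _ _ unB unC tBC) H].
  have [|M' [-> M'Q dM']] := leaderP (Q := ~: (Bs :|: Ch)); first by rewrite -card_gt0 En.
  move=> X i.
  have En' : #|~: (Bs :|: Ch :|: [set M'])| = n by rewrite compl_lead; exact: card_remove En.
  have K j : (j \in T) = (M' \in T).
    apply: (IH _ _ _ _ En' _ _ _ X); first exact: set11.
      by move=> i1 i2 i1B i2B; rewrite (H _ i1B) (H _ i2B).
    by move=> i1; rewrite inE => /eqP ->.
  by rewrite !K.
move=> X i; rewrite -(tT cur); apply: IH X i.
- by rewrite compl_next; apply: card_remove En; rewrite inE tBC.
- exact: setU11.
- by [].
by move=> i; rewrite in_setU1 tT => /orP[/eqP ->|/unC //].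
Qed.

End Exploration.

(** * Insertions of edges and the corners where they attach *)

Section Pieces.
Variables (P : ribbon_graph) (h : nat) (pc : P -> 'I_h) (wh : P -> bool).
Hypotheses (pc_rot : forall y, pc (Defs.rot P y) = pc y) (pc_flip : forall y, pc (flip P y) = pc y).
Hypothesis wh_rot : forall y, wh (Defs.rot P y) = wh y.

Local Notation D := (ins_dart P h).
Local Notation fl := (ins_flip P h).
Implicit Types (r rf : {perm D}) (x y z : D) (k u : 'I_h) (U : {set 'I_h}).

Definition tail_dart k : D := inr (k, false).
Definition head_dart k : D := inr (k, true).
Local Notation a := tail_dart.
Local Notation b := head_dart.

Definition edge_darts U : {set D} :=
  [set x | if x is inr (k, _) then k \in U else false].
Local Notation dts := edge_darts.

Definition region (T U : {set 'I_h}) : {set D} :=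
  [set x | match x with inl y => pc y \in T | inr (k, _) => k \in U end].

Definition base_rot_fun (x : D) : D :=
  match x with inl y => inl (Defs.rot P y) | inr k => inr k end.

Lemma base_rot_inj : injective base_rot_fun.
Proof. by move=> [y|k] [y'|k'] //= [/perm_inj ->]. Qed.

Definition base_rot : {perm D} := perm base_rot_inj.

Definition face_perm r : {perm D} := (fl * r)%g.

Definition site (y : P) : 'I_h * bool := (pc y, wh y).

(** The piece and the color of the vertex of [x]. The last case is a default
    value, for a cycle made of new darts only. *)
Definition place rf x : 'I_h * bool :=
  if [pick y | (inl y : D) \in porbit rf x] is Some y then site y
  else match x with inl y => site y | inr (k, _) => (k, true) end.

Definition insertion rf : bool :=
  (forget (dts setT) rf == base_rot) &&
  [forall x, [exists y : P, (inl y : D) \in porbit rf x]].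

(** The edge [k] leaves the piece [k]; so the static graph is the graph of
    [target]. *)
Definition canonical rf : bool := [forall k, (place rf (a k)).1 == k].

Definition target rf k : 'I_h := (place rf (b k)).1.
Definition tail_color rf k : bool := (place rf (a k)).2.
Definition head_color rf k : bool := (place rf (b k)).2.

Lemma fl_inl (y : P) : fl (inl y) = inl (flip P y). Proof. by rewrite permE. Qed.
Lemma fl_inr k c : fl (inr (k, c)) = inr (k, ~~ c). Proof. by rewrite permE. Qed.
Lemma flE x : fl (fl x) = x. Proof. exact: ins_flipK. Qed.

Lemma inl_dts (y : P) U : (inl y : D) \in dts U = false. Proof. by rewrite inE. Qed.
Lemma inr_dts k c U : (inr (k, c) : D) \in dts U = (k \in U). Proof. by rewrite inE. Qed.

Lemma fl_region T U x : (fl x \in region T U) = (x \in region T U).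
Proof. by case: x => [y|[k c]]; rewrite ?fl_inl ?fl_inr !inE ?pc_flip. Qed.

Lemma place_porbit rf x (y : P) : insertion rf -> (inl y : D) \in porbit rf x ->
  place rf x = site y.
Proof.
move=> /andP[/eqP f0 _] yx; rewrite /place; case: pickP => [y' y'x|/(_ y)]; last by rewrite yx.
have : (inl y' : D) \in porbit base_rot (inl y).
  rewrite -f0; apply: forget_porbit_mem; rewrite ?inl_dts //.
  by move: yx y'x; rewrite -!eq_porbit_mem => /eqP -> /eqP ->.
have /subsetP S : porbit base_rot (inl y) \subset
    [set x | if x is inl y0 then site y0 == site y else false].
  apply: porbit_sub_closed; last by rewrite inE.
  by move=> [y0|k]; rewrite !inE // permE /= /site pc_rot wh_rot.
by move=> /S; rewrite inE => /eqP.
Qed.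

Lemma place_rot rf x : insertion rf -> place rf (rf x) = place rf x.
Proof.
move=> irf; have /andP[_ /forallP/(_ x)/existsP [y yx]] := irf.
rewrite (place_porbit irf yx); apply: place_porbit => //.
by move: yx; rewrite porbit_sym -mem_porbit1 porbit_sym.
Qed.

Lemma place_inl rf (y : P) : insertion rf -> place rf (inl y) = site y.
Proof. by move=> irf; apply: place_porbit => //; apply: porbit_id. Qed.

(** A partial insertion: the darts of [A], which it fixes, are yet to be
    inserted, and [s] tells the places of all others. *)
Record sited (A : {set D}) r (s : D -> 'I_h * bool) : Prop := Sited {
  sited_fix : {in A, forall x, r x = x};
  sited_rot : forall x, x \notin A -> s (r x) = s x;
  sited_inl : forall y : P, (inl y : D) \notin A /\ s (inl y) = site y;
  sited_att : forall x, x \notin A -> exists y : P, (inl y : D) \in porbit r x;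
  sited_forget : forget (dts setT) r = base_rot }.

(** The darts in place do not move any more when others are inserted. *)
Lemma sited_place A r s rf x : sited A r s -> insertion rf -> forget A rf = r ->
  x \notin A -> place rf x = s x.
Proof.
move=> [fx rt il att _] irf fr xA; have [y yx] := att _ xA.
have -> : s x = site y.
  have [_ <-] := il y.
  have /subsetP S : porbit r x \subset [set z | (s z == s x) && (z \notin A)].
    apply: porbit_sub_closed; last by rewrite inE eqxx.
    move=> z; rewrite !inE => /andP[/eqP sz zA]; rewrite rt // sz eqxx.
    by rewrite -fr forget_notin.
  by have := S _ yx; rewrite inE => /andP[/eqP ->].
apply: place_porbit => //; have /subsetP := forget_porbit_sub rf xA.
by apply; rewrite fr.
Qed.

Lemma sited_insertion r s : sited set0 r s -> insertion r /\ forall x, place r x = s x.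
Proof.
move=> S; have [fx rt il att f0] := S.
have ir : insertion r.
  rewrite /insertion f0 eqxx; apply/forallP=> x.
  by have [|y yx] := att x; [rewrite inE | apply/existsP; exists y].
split=> // x; apply: (sited_place S) => //; last by rewrite inE.
by apply: forget_fixed => z; rewrite inE.
Qed.

Lemma sited_insert1 A r s x z : sited A r s -> z \in A -> z \in dts setT -> x \notin A ->
  sited (A :\ z) (insert1 r x z) (fun v => if v == z then s x else s v).
Proof.
move=> [fx rt il att f0] zA zT xA; have xz : x != z by apply: contraNneq xA => ->.
have zNx : z \notin porbit r x.
  have /subsetP S : porbit r x \subset ~: A.
    apply: porbit_sub_closed; last by rewrite inE.
    move=> v; rewrite !inE => vA; apply: contraNN vA => rA.
    by have := fx _ rA => /perm_inj <-.
  by apply/negP => /S; rewrite inE zA.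
split.
- move=> v; rewrite !inE => /andP[vz vA]; rewrite permM tpermD 1?eq_sym ?fx //.
  by apply: contraNneq xA => <-.
- move=> v; rewrite !inE negb_and negbK permM => vA.
  case: tpermP => [->|->|vx vz].
  + by rewrite fx // eqxx (negbTE xz).
  + rewrite eqxx; case: eqVneq => [e|_]; last by rewrite rt.
    by have := fx _ zA; rewrite -{2}e => /perm_inj e'; rewrite e' eqxx in xz.
  have {}vA : v \notin A by case/orP: vA => // /eqP.
  case: eqVneq => [e|_]; first by have := fx _ zA; rewrite -{2}e => /perm_inj e'; case: vz.
  by case: eqVneq => [e|_]; [case: vz | rewrite rt].
- move=> y; have [yA sy] := il y; rewrite inE negb_and yA orbT; split=> //.
  by case: eqVneq => // e; rewrite e zA in yA.
- move=> v; rewrite !inE negb_and negbK => vA.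
  have [y yx] := att _ xA.
  rewrite /insert1 porbit_merge //.
  case: ifP => [_|/negbT]; first by exists y; rewrite inE yx.
  rewrite inE negb_or => /andP[_ vz].
  apply: att; case/orP: vA => // /eqP e; by rewrite e porbit_id in vz.
rewrite -f0 -{2}(insert1K x (fx _ zA)) -forget_set1 forget_comp; congr forget.
by apply/esym/setUidPr; rewrite sub1set.
Qed.

(** The faces are changed by a transposition as well as the vertices, so
    that [porbit_merge] and [porbit_split] describe them. *)
Lemma face_insert1 r x z :
  face_perm (insert1 r x z) = (tperm (fl x) (fl z) * face_perm r)%g.
Proof.
apply/permP=> v; rewrite /face_perm /insert1 !permM.
case: (tpermP x z) => [e|e|n1 n2].
- by rewrite (_ : v = fl x) ?tpermL ?flE // -e flE.
- by rewrite (_ : v = fl z) ?tpermR ?flE // -e flE.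
by rewrite tpermD //; [apply/eqP => e; apply: n1 | apply/eqP => e; apply: n2]; rewrite -e flE.
Qed.

End Pieces.

(** A dart of a piece goes to the next dart of this piece after some new
    darts: this is what the first return to the darts of the pieces means. *)
Lemma insertionP (P : ribbon_graph) h (rf : {perm ins_dart P h}) :
  reflect (is_insertion rf) (insertion rf).
Proof.
have dE (x : ins_dart P h) : (x \in ins_darts P h) = (x \in edge_darts P setT).
  case: x => [y|[k c]]; rewrite [RHS]inE ?in_setT; first by apply/imsetP => -[].
  by apply/imsetP; exists (k, c).
apply: (iffP andP) => [[/eqP f0 /forallP att]|[att it]].
  split=> [k|x]; first by apply/existsP; exact: att.
  have [_ /(_ (inl x))] := forgetP (edge_darts P setT) rf.
  rewrite f0 permE inl_dts => /(_ isT) /next_outsideP [n [e H]].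
  by exists n; split=> // j jn; rewrite dE H.
split.
  apply/eqP/forgetE; split=> [[y|[k c]]|[y|[k c]]]; rewrite ?inl_dts ?inr_dts ?in_setT ?permE //= => _.
  have [n [e H]] := it y; apply: next_outside_iter e _; first by rewrite inl_dts.
  by move=> j /H; rewrite dE.
apply/forallP => -[y|k]; apply/existsP; first by exists y; apply: porbit_id.
exact: att.
Qed.

(** * Counting the canonical insertions *)

Section Count.
Variables (P : ribbon_graph) (h : nat) (pc : P -> 'I_h) (wh : P -> bool).
Variables (w Dw : 'I_h -> nat).
Hypotheses (pc_rot : forall y, pc (Defs.rot P y) = pc y) (pc_flip : forall y, pc (flip P y) = pc y).
Hypothesis wh_rot : forall y, wh (Defs.rot P y) = wh y.
Hypothesis one_face : forall y y', pc y = pc y' -> y' \in porbit (flip P * Defs.rot P) y.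
Hypothesis card_site : forall i c,
  #|[set y | site pc wh y == (i, c)]|%:R = ((w i)%:R - 2) / 2 :> rat.
Hypothesis w_gt2 : forall i, (2 < w i)%N.
Hypothesis dominated : forall Q : {set 'I_h}, Q != set0 ->
  exists2 M, M \in Q & (\sum_(i in Q :\ M) Dw i < Dw M)%N.
Variables d1 d2 : nat.
Hypotheses (d1_gt0 : (0 < d1)%N) (d2_gt0 : (0 < d2)%N) (d12_neq : d1 != d2).
Hypothesis d12 : (d1 + d2 = weight w [set: 'I_h])%N.

Local Notation D := (ins_dart P h).
Local Notation fl := (ins_flip P h).
Local Notation a := (@tail_dart P h).
Local Notation b := (@head_dart P h).
Local Notation dts := (@edge_darts P h).
Local Notation reg := (region pc).
Local Notation st := (site pc wh).
Implicit Types (r rf : {perm D}) (x y z : D) (k u cur : 'I_h) (U Bs Ch : {set 'I_h}).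

Lemma a_dts k U : (a k \in dts U) = (k \in U). Proof. exact: inr_dts. Qed.
Lemma b_dts k U : (b k \in dts U) = (k \in U). Proof. exact: inr_dts. Qed.
Lemma a_reg k T E : (a k \in reg T E) = (k \in E). Proof. by rewrite in_set. Qed.
Lemma b_reg k T E : (b k \in reg T E) = (k \in E). Proof. by rewrite in_set. Qed.
Lemma inl_a (y : P) k : ((inl y : D) == a k) = false. Proof. by []. Qed.
Lemma inl_b (y : P) k : ((inl y : D) == b k) = false. Proof. by []. Qed.
Lemma inr_a k c k' : ((inr (k, c) : D) == a k') = (k == k') && ~~ c.
Proof. by rewrite (inj_eq inr_inj) xpair_eqE; case: c. Qed.
Lemma inr_b k c k' : ((inr (k, c) : D) == b k') = (k == k') && c.
Proof. by rewrite (inj_eq inr_inj) xpair_eqE; case: c. Qed.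

Lemma sum_setU (V : nmodType) (A B : {set D}) (F : D -> V) : [disjoint A & B] ->
  \sum_(x in A :|: B) F x = \sum_(x in A) F x + \sum_(x in B) F x.
Proof.
by move=> dj; rewrite -bigU //=; apply: eq_bigl => x; rewrite !inE.
Qed.

Lemma sum_region (V : nmodType) T E (F : D -> V) :
  \sum_(x in reg T E) F x =
  \sum_(y | pc y \in T) F (inl y) + \sum_(k in E) (F (a k) + F (b k)).
Proof.
rewrite big_sumType /=; congr (_ + _); first by apply: eq_bigl => y; rewrite inE.
rewrite (eq_bigl (fun p => (p.1 \in E) && xpredT p.2)); last by move=> [k c]; rewrite inE andbT.
rewrite (eq_bigr (fun p : 'I_h * bool => F (inr (p.1, p.2)))); last by move=> [k c].
rewrite -(pair_big (fun k => k \in E) xpredT (fun k c => F (inr (k, c)))) /=.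
by apply: eq_bigr => k _; rewrite big_bool addrC.
Qed.

Lemma sum_piece (V : nmodType) (T : {set 'I_h}) (F : P -> V) :
  \sum_(y | pc y \in T) F y = \sum_(u in T) \sum_(y | pc y == u) F y.
Proof.
rewrite (partition_big pc (fun u => u \in T)) //=; apply: eq_bigr => u uT.
by apply: eq_bigl => y; case: eqP => [->|]; rewrite ?uT ?andbF.
Qed.

Lemma card_piece u : #|[set y | pc y == u]|%:R = (w u)%:R - 2 :> rat.
Proof.
have -> : [set y | pc y == u] = [set y | st y == (u, true)] :|: [set y | st y == (u, false)].
  apply/setP=> y; rewrite !inE /site !xpair_eqE.
  by case: (pc y == u); case: (wh y).
rewrite cardsU natrB; last first.
  by apply: (leq_trans (subset_leq_card (subsetIl _ _))); apply: leq_addr.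
rewrite natrD !card_site -setIdE (_ : [set _ in _ | _] = set0) ?cards0; first by field.
apply/setP=> y; rewrite !inE /site !xpair_eqE.
by case: (pc y == u); case: (wh y).
Qed.

Lemma card_region T E : #|reg T E|%:R = (weight w T)%:R - 2 * #|T|%:R + 2 * #|E|%:R :> rat.
Proof.
rewrite -sum1_card natr_sum sum_region sum_piece; congr (_ + _); last first.
  by rewrite sumr_const -[LHS]mulr_natr.
rewrite -sum_kappa; apply: eq_bigr => u _; rewrite -card_piece -sum1_card natr_sum.
by apply: eq_bigl => y; rewrite inE.
Qed.

(** The two darts of the outgoing edge explain why [w u] exceeds the number
    of darts of [u] by 2. *)
Lemma card_regionTT T : #|reg T T| = weight w T.
Proof. by apply/eqP; rewrite -(eqr_nat rat) card_region subrK. Qed.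

Definition faces_ok rf : bool :=
  [exists f1 : {set D}, [exists f2 : {set D},
    [&& f1 != f2, porbits (face_perm rf) == [set f1; f2], #|f1| == d1 & #|f2| == d2]]].

Definition valid rf n Bs Ch cur e : bool :=
  [&& insertion rf, canonical pc wh rf, faces_ok rf &
    explore Dw (target pc wh rf) (tail_color pc wh rf) (head_color pc wh rf) n Bs Ch cur e].

(** What is left to check when a walk has just ended. *)
Definition valid_rest rf n Bs : bool :=
  [&& insertion rf, canonical pc wh rf, faces_ok rf &
    if n is n'.+1 then
      if leader Dw (~: Bs) is Some M then
        explore Dw (target pc wh rf) (tail_color pc wh rf) (head_color pc wh rf) n' Bs [set M] M true
      else true
    else true].

(** A partial insertion with the outgoing edges of the pieces visited so
    far, except that of [cur]. The chain has one face, and so has each of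
    the pieces not visited yet. *)
Record chain_state r s Bs Ch cur e : Prop := ChainState {
  cs_sited : sited pc wh (dts (cur |: ~: (Bs :|: Ch))) r s;
  cs_cur : cur \in Ch;
  cs_dis : [disjoint Bs & Ch];
  cs_tail : forall k, k \in Bs :|: Ch -> k != cur -> (s (a k)).1 = k;
  cs_headB : forall k, k \in Bs -> (s (b k)).1 \in Bs;
  cs_headC : forall k, k \in Ch -> k != cur ->
    (s (b k)).1 \in Ch /\ ((s (b k)).1 = cur -> (s (b k)).2 = ~~ e);
  cs_faceC : {in reg Ch (Ch :\ cur), forall x,
    porbit (face_perm r) x = reg Ch (Ch :\ cur)};
  cs_faceU : forall u, u \notin Bs :|: Ch -> {in reg [set u] set0, forall x,
    porbit (face_perm r) x = reg [set u] set0} }.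

(** The same between two walks. *)
Record rest_state r s Bs : Prop := RestState {
  rs_sited : sited pc wh (dts (~: Bs)) r s;
  rs_tail : forall k, k \in Bs -> (s (a k)).1 = k;
  rs_head : forall k, k \in Bs -> (s (b k)).1 \in Bs;
  rs_faceU : forall u, u \notin Bs -> {in reg [set u] set0, forall x,
    porbit (face_perm r) x = reg [set u] set0} }.

(** The two faces of the part completed in earlier walks. *)
Record base_faces r Bs (F1 F2 : {set D}) : Prop := BaseFaces {
  bf_cover : F1 :|: F2 = reg Bs Bs;
  bf_dis : [disjoint F1 & F2];
  bf_n1 : F1 != set0;
  bf_n2 : F2 != set0;
  bf_1 : {in F1, forall x, porbit (face_perm r) x = F1};
  bf_2 : {in F2, forall x, porbit (face_perm r) x = F2} }.

Lemma chain_state_start r s Bs M : rest_state r s Bs -> M \notin Bs ->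
  chain_state r s Bs [set M] M true.
Proof.
move=> [S t hd fU] MB.
have E : M |: ~: (Bs :|: [set M]) = ~: Bs.
  by apply/setP=> k; rewrite !inE; case: eqVneq => [->|]; rewrite /= ?orbF ?MB.
split; rewrite ?E ?set11 //.
- by rewrite disjoint_sym disjoints1.
- by move=> k; rewrite !inE => /orP[/t //|/eqP ->]; rewrite eqxx.
- by move=> k; rewrite inE => /eqP ->; rewrite eqxx.
- by rewrite setDv; apply: fU.
by move=> u; rewrite inE negb_or => /andP[/fU].
Qed.

Section Step.
Variables (r : {perm D}) (s : D -> 'I_h * bool) (Bs Ch : {set 'I_h}) (cur : 'I_h) (e : bool).
Hypothesis S : chain_state r s Bs Ch cur e.
Let U := cur |: ~: (Bs :|: Ch).
Let U1 := ~: (Bs :|: Ch).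

Lemma cur_U1 : cur \notin U1.
Proof. by rewrite !inE (cs_cur S) orbT. Qed.

Lemma ab_neq k : a k != b k. Proof. by apply/eqP => -[]. Qed.

Lemma dts_U1 : dts U :\: [set a cur; b cur] = dts U1.
Proof.
apply/setP=> -[y|[k c]]; rewrite in_setD in_set2 ?inl_dts ?andbF // inr_a inr_b !inr_dts.
have := cur_U1; rewrite in_setU1.
by case: (eqVneq k cur) => [->|_] /=; case: c => //= /negbTE ->.
Qed.

Lemma notin_dtsU : ~: dts U = reg setT ((Bs :|: Ch) :\ cur).
Proof.
apply/setP=> -[y|[k c]]; rewrite !inE //.
by case: (eqVneq k cur) => //=; rewrite negbK.
Qed.

Lemma region_split : reg setT ((Bs :|: Ch) :\ cur) =
  reg Bs Bs :|: reg U1 set0 :|: reg Ch (Ch :\ cur).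
Proof.
apply/setP=> -[y|[k c]]; rewrite !inE.
  by case: (_ \in Bs); case: (_ \in Ch).
rewrite orbF; case: (eqVneq k cur) => //= ->; rewrite orbF.
by apply/esym/negbTE; apply: contraTN (cs_dis S) => kB; apply/pred0Pn; exists cur; rewrite /= kB (cs_cur S).
Qed.

Lemma BCF k : k \in Bs -> k \in Ch -> False.
Proof. by move=> kB kC; have /pred0Pn := cs_dis S; apply; exists k; rewrite /= kB kC. Qed.

(** Apart from the corners of the piece itself, there are only those after
    heads of edges of the chain, and these have the other color. *)
Lemma start_corner x : x \notin dts U -> s x = (cur, e) -> exists2 y : P, x = inl y & st y = (cur, e).
Proof.
move=> xU; case: x xU => [y|[k c]] xU sx.
  by exists y => //; have [_ _ /(_ y) [_ <-] _ _] := cs_sited S.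
have : (inr (k, c) : D) \in ~: dts U by rewrite inE.
rewrite notin_dtsU !inE => /andP[kc kBC]; case: c xU sx => _ sx.
  case/orP: kBC => [kB|kC].
    by have := cs_headB S kB; rewrite sx => /BCF; case; exact: cs_cur S.
  by have [_] := cs_headC S kC kc; rewrite /head_dart sx => /(_ erefl) /=; case: (e).
have := cs_tail S (k := k); rewrite inE /tail_dart sx /= => /(_ kBC kc) ek.
by rewrite ek eqxx in kc.
Qed.

Lemma start_count (T : D -> rat) c :
  (forall x, x \notin dts U -> T x != 0 -> s x = (cur, e)) ->
  (forall y : P, st y = (cur, e) -> T (inl y) = c) ->
  \sum_(x in ~: dts U) T x = ((w cur)%:R - 2) / 2 * c.
Proof.
move=> T0 Tc.
rewrite (bigID (fun x => s x == (cur, e))) /= [X in _ + X]big1 ?addr0; last first.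
  move=> x /andP[]; rewrite inE => xU; case: (eqVneq (T x) 0) => // /(T0 _ xU) ->.
  by rewrite eqxx.
rewrite (eq_bigl (fun x => x \in [set inl y | y : P & st y == (cur, e)])); last first.
  move=> x; apply/andP/imsetP => [[xU /eqP sx]|[y sy ->]].
    rewrite in_setC in xU; have [y -> sy] := start_corner xU sx.
    by exists y => //; rewrite inE sy.
  rewrite inE in sy; have [_ _ /(_ y) [yU ->] _ _] := cs_sited S.
  by rewrite in_setC yU sy.
rewrite big_imset /=; last by move=> y y' _ _ [].
rewrite -(card_site cur e) -sum1_card natr_sum mulr_suml.
apply: eq_big => [y|y]; first by rewrite !inE.
by rewrite inE mul1r => /eqP /Tc.
Qed.

Lemma slots_count (T : D -> rat) :
  \sum_(y in a cur |: ~: dts U) T y =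
  \sum_(y in reg Bs Bs) T y + \sum_(u in U1) \sum_(y | pc y == u) T (inl y) +
  \sum_(y in a cur |: reg Ch (Ch :\ cur)) T y.
Proof.
have aU : a cur \notin ~: dts U by rewrite in_setC negbK a_dts setU11.
have aC : a cur \notin reg Ch (Ch :\ cur) by rewrite a_reg setD11.
rewrite big_setU1 // big_setU1 //= notin_dtsU region_split.
have dj1 : [disjoint reg Bs Bs :|: reg U1 set0 & reg Ch (Ch :\ cur)].
  apply/pred0Pn => -[[y|[k c]]] /=; rewrite !inE; first by
    case/andP => /orP[kB kC|]; [exact: BCF kB kC | rewrite negb_or => /andP[_ /negbTE ->]].
  by rewrite orbF => /andP[kB /andP[_ kC]]; exact: BCF kB kC.
have dj2 : [disjoint reg Bs Bs & reg U1 set0].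
  by apply/pred0Pn => -[[y|[k c]]] /=; rewrite !inE ?andbF // negb_or => /andP[->].
rewrite sum_setU // sum_setU // [X in _ = _ + X + _](_ : _ = \sum_(y in reg U1 set0) T y).
  by rewrite addrCA addrA.
by rewrite sum_region big_set0 addr0 sum_piece.
Qed.

Section Insert.
Variables x y : D.
Hypotheses (xU : x \notin dts U) (sx : s x = (cur, e)).
Hypothesis yU : y \in a cur |: ~: dts U.
Let r1 := insert2 r (a cur) (b cur) x y.
Let sy := if y == a cur then s x else s y.
Let s1 v := if v == b cur then sy else if v == a cur then s x else s v.

Lemma step_sited : sited pc wh (dts U1) r1 s1.
Proof.
have aU : a cur \in dts U by rewrite a_dts setU11.
have bU : b cur \in dts U :\ a cur by rewrite in_setD1 b_dts setU11 inr_a andbF.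
have aT : a cur \in dts setT by rewrite a_dts in_setT.
have bT : b cur \in dts setT by rewrite b_dts in_setT.
have S1 := sited_insert1 (cs_sited S) aU aT xU.
have yU' : y \notin dts U :\ a cur.
  by move: yU; rewrite !inE; case: eqVneq.
have := sited_insert1 S1 bU bT yU'.
rewrite (_ : _ :\ _ = dts U1) // -dts_U1.
by apply/setP=> z; rewrite !inE negb_or andbA [X in X && _]andbC.
Qed.

Lemma s1_a : s1 (a cur) = (cur, e). Proof. by rewrite /s1 inr_b eqxx /= inr_a eqxx sx. Qed.
Lemma s1_b : s1 (b cur) = sy. Proof. by rewrite /s1 eqxx. Qed.
Lemma s1_k k c : k != cur -> s1 (inr (k, c)) = s (inr (k, c)).
Proof.
by move=> kc; rewrite /s1 /tail_dart /head_dart !(inj_eq inr_inj) !xpair_eqE (negbTE kc).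
Qed.

Let O := reg Ch Ch.

(** While its head is free, the edge only enlarges the face of the chain by
    its two sides. *)
Lemma step_leaf z : porbit (tperm (fl x) (b cur) * face_perm r) z =
  if z \in O then O else porbit (face_perm r) z.
Proof.
have [fx _ _ _ _] := cs_sited S.
have fa : face_perm r (a cur) = b cur by rewrite permM fl_inr fx // b_dts setU11.
have fb : face_perm r (b cur) = a cur by rewrite permM fl_inr fx // a_dts setU11.
have pb : porbit (face_perm r) (b cur) = [set a cur; b cur].
  apply/eqP; rewrite eqEsubset porbit_sub_closed ?set22 //=; last first.
    by move=> v /set2P[]->; rewrite ?fa ?fb !inE eqxx ?orbT.
  by apply/subsetP => v /set2P[]->; rewrite ?porbit_id // -fb mem_porbit1 porbit_id.
have xC : fl x \in reg Ch (Ch :\ cur).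
  by have [y0 -> [pcy _]] := start_corner xU sx; rewrite fl_inl inE pc_flip pcy (cs_cur S).
have OE : O = reg Ch (Ch :\ cur) :|: [set a cur; b cur].
  apply/setP=> -[v|[k c]]; rewrite in_setU in_set2 ?inl_a ?inl_b ?orbF ?inr_a ?inr_b !inE //.
    case: (eqVneq k cur) => [->|_] /=; last by rewrite orbF.
    by rewrite (cs_cur S); case: c.
rewrite porbit_merge; last by rewrite (cs_faceC S) // b_reg setD11.
by rewrite (cs_faceC S) // pb OE.
Qed.

Lemma face_r1 : face_perm r1 =
  (tperm (fl y) (a cur) * (tperm (fl x) (b cur) * face_perm r))%g.
Proof. by rewrite /r1 /insert2 !face_insert1 !fl_inr. Qed.

(** An edge leading to another component joins its face [F] to that of the
    chain. *)
Lemma step_merge (F : {set D}) : fl y \in F -> {in F, forall z, porbit (face_perm r) z = F} ->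
  [disjoint F & O] ->
  forall z, porbit (face_perm r1) z = if z \in F :|: O then F :|: O else porbit (face_perm r) z.
Proof.
move=> yF FF dj z.
have yO : fl y \notin O.
  by apply: contraTN dj => yO; apply/pred0Pn; exists (fl y); rewrite /= yF yO.
have aO : a cur \in O by rewrite a_reg (cs_cur S).
have aF : a cur \notin F.
  by apply: contraTN dj => aF; apply/pred0Pn; exists (a cur); rewrite /= aF aO.
rewrite face_r1 porbit_merge; last by rewrite step_leaf (negbTE yO) FF.
rewrite !step_leaf (negbTE yO) aO FF //.
by case: ifP => //; rewrite inE => /negbT; rewrite negb_or => /andP[_ /negbTE ->].
Qed.

Lemma face_U_step (F : {set D}) u z : u \notin Bs :|: Ch -> z \in reg [set u] set0 ->
  F \subset reg Bs Bs :|: reg (~: [set u]) set0 -> z \notin F :|: O.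
Proof.
move=> uBC zu /subsetP FB; rewrite in_setU negb_or; apply/andP; split.
  apply/negP => /FB; case: z zu => [v|[k c]]; rewrite !inE ?orbF // => /eqP ->.
  by rewrite eqxx orbF; move: uBC; rewrite inE negb_or => /andP[/negbTE ->].
case: z zu => [v|[k c]]; rewrite !inE // => /eqP ->.
by move: uBC; rewrite inE negb_or => /andP[].
Qed.

Lemma place_base z : z \in reg Bs Bs -> (s z).1 \in Bs.
Proof.
case: z => [v|[k c]]; rewrite inE.
  by have [_ _ /(_ v) [_ ->] _ _] := cs_sited S.
move=> kB; have kc : k != cur by apply/eqP => kc; apply: BCF kB _; rewrite kc (cs_cur S).
case: c; first exact: (cs_headB S kB).
by rewrite [_.1](cs_tail S (k := k)) // inE kB.
Qed.

Lemma place_chain z : z \in reg Ch (Ch :\ cur) -> (s z).1 \in Ch.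
Proof.
case: z => [v|[k c]]; rewrite inE.
  by have [_ _ /(_ v) [_ ->] _ _] := cs_sited S.
rewrite !inE => /andP[kc kC]; case: c; first by have [] := cs_headC S kC kc.
by rewrite [_.1](cs_tail S (k := k)) // inE kC orbT.
Qed.

Lemma next_rest : sy.1 \in Bs :|: Ch ->
  (forall u z, u \notin Bs :|: Ch -> z \in reg [set u] set0 ->
     porbit (face_perm r1) z = porbit (face_perm r) z) ->
  rest_state r1 s1 (Bs :|: Ch).
Proof.
move=> sBC fU; split; first exact: step_sited.
- move=> k kBC; case: (eqVneq k cur) => [->|kc]; first by rewrite s1_a.
  by rewrite s1_k // [_.1](cs_tail S).
- move=> k kBC; case: (eqVneq k cur) => [->|kc]; first by rewrite s1_b.
  rewrite s1_k //; move: kBC; rewrite !inE => /orP[/(cs_headB S) -> //|kC].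
  by have [->] := cs_headC S kC kc; rewrite orbT.
by move=> u uBC z zu; rewrite (fU _ _ uBC zu) (cs_faceU S uBC).
Qed.

Lemma base_dis (F : {set D}) : F \subset reg Bs Bs -> [disjoint F & O].
Proof.
move=> /subsetP FB; apply/pred0Pn => -[z /= /andP[/FB]].
by case: z => [v|[k c]]; rewrite !inE; apply: BCF.
Qed.

Lemma next_base F1 F2 : base_faces r Bs F1 F2 -> fl y \in F1 ->
  rest_state r1 s1 (Bs :|: Ch) /\ base_faces r1 (Bs :|: Ch) (F1 :|: O) F2.
Proof.
move=> [cov dj n1 n2 o1 o2] yF.
have F1B : F1 \subset reg Bs Bs by rewrite -cov subsetUl.
have F2B : F2 \subset reg Bs Bs by rewrite -cov subsetUr.
have M := step_merge yF o1 (base_dis F1B).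
have yB : y \in reg Bs Bs by rewrite -(fl_region pc_flip) -cov inE yF.
have ya : y != a cur.
  by apply: contraTneq yB => ->; rewrite a_reg; apply/negP => /BCF; apply; exact: cs_cur S.
have sB : sy.1 \in Bs :|: Ch by rewrite /sy (negbTE ya) inE place_base.
split.
  apply: next_rest => // u z uBC zu; rewrite M ifN //.
  by apply: (face_U_step uBC zu); apply: subset_trans F1B (subsetUl _ _).
split=> //.
- rewrite setUAC cov; apply/setP=> -[v|[k c]]; by rewrite !inE.
- by rewrite disjoint_sym -setI_eq0 setIUr setU_eq0 !setI_eq0 base_dis // disjoint_sym dj.
- by apply: contraNneq n1 => E; rewrite -subset0 -E subsetUl.
- by move=> z zF; rewrite M zF.
move=> z zF; rewrite M ifN ?o2 //; rewrite inE negb_or; apply/andP; split.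
  by apply: contraTN dj => zF1; apply/pred0Pn; exists z; rewrite /= zF1 zF.
have := base_dis F2B; apply: contraTN => zO; apply/pred0Pn; exists z; by rewrite /= zF zO.
Qed.

Lemma next_chain (y0 : P) : y = inl y0 -> pc y0 \notin Bs :|: Ch ->
  chain_state r1 s1 Bs (pc y0 |: Ch) (pc y0) (~~ wh y0) /\
  (forall F1 F2, base_faces r Bs F1 F2 -> base_faces r1 Bs F1 F2).
Proof.
move=> yE; set u := pc y0 => uBC; set F := reg [set u] set0.
have [uB uC] : u \notin Bs /\ u \notin Ch by move: uBC; rewrite inE negb_or => /andP[].
have syE : sy = (u, wh y0).
  rewrite /sy yE inl_a; by have [_ _ /(_ y0) [_ ->] _ _] := cs_sited S.
have yF : fl y \in F by rewrite yE fl_inl !inE pc_flip.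
have FO : [disjoint F & O].
  by apply/pred0Pn => -[[v|[k c]]] /=; rewrite !inE // => /andP[/eqP ->]; apply/negP.
have M := step_merge yF (cs_faceU S uBC) FO.
have cu : cur != u by apply: contraNneq uC => <-; exact: cs_cur S.
split.
  have UE : u |: ~: (Bs :|: (u |: Ch)) = U1.
    apply/setP=> k; rewrite !inE; case: eqVneq => //= ->.
    by rewrite (negbTE uB) (negbTE uC).
  split; rewrite ?UE ?setU11 //; first exact: step_sited.
  - rewrite -setI_eq0 setIUr setU_eq0 !setI_eq0 (cs_dis S) andbT.
    by rewrite disjoint_sym disjoints1.
  - move=> k kBC ku; have {}kBC : k \in Bs :|: Ch by move: kBC; rewrite !inE (negbTE ku).
    case: (eqVneq k cur) => [->|kc]; first by rewrite s1_a.
    by rewrite s1_k // [_.1](cs_tail S).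
  - move=> k kB; rewrite s1_k ?(cs_headB S) //.
    by apply/eqP => kc; apply: BCF kB _; rewrite kc (cs_cur S).
  - move=> k; rewrite in_setU1 => /orP[/eqP -> /eqP //|kC _].
    case: (eqVneq k cur) => [->|kc]; first by rewrite s1_b syE setU11 negbK.
    rewrite s1_k //; have [kC' _] := cs_headC S kC kc; split; first by rewrite inE kC' orbT.
    by move=> E; rewrite E (negbTE uC) in kC'.
  - have E : reg (u |: Ch) ((u |: Ch) :\ u) = F :|: O.
      by rewrite setU1K //; apply/setP=> -[v|[k c]]; rewrite !inE.
    by rewrite E => z zE; rewrite M zE.
  move=> u' u'N z zu'.
  have [u'u u'BC] : u' != u /\ u' \notin Bs :|: Ch.
    by move: u'N; rewrite !inE !negb_or => /andP[-> /andP[-> ->]].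
  rewrite M ifN ?(cs_faceU S u'BC) //; apply: (face_U_step u'BC zu').
  apply: subset_trans _ (subsetUr _ _); apply/subsetP => -[v|[k c]]; rewrite !inE //.
  by move=> /eqP ->; rewrite eq_sym.
move=> F1 F2 [cov dj n1 n2 o1 o2].
have MB z : z \in reg Bs Bs -> porbit (face_perm r1) z = porbit (face_perm r) z.
  move=> zB; rewrite M ifN // inE negb_or; apply/andP; split.
    case: z zB => [v|[k c]]; rewrite !inE // => vB.
    by apply: contraNneq uB => <-.
  have := base_dis (subxx _); apply: contraTN => zO; apply/pred0Pn; exists z; by rewrite /= zB zO.
by split=> // z zF; rewrite MB; [exact: o1 | rewrite -cov inE zF | exact: o2 | rewrite -cov inE zF orbT].
Qed.

(** The head is in the face of the chain, which is divided in two. *)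
Lemma next_close : Bs = set0 -> y \in a cur |: reg Ch (Ch :\ cur) ->
  let F1 := porbit (face_perm r1) (a cur) in let F2 := porbit (face_perm r1) (fl y) in
  [/\ rest_state r1 s1 (Bs :|: Ch), base_faces r1 (Bs :|: Ch) F1 F2 &
      F1 = porbit (tperm (a cur) (fl y) * (tperm (fl x) (b cur) * face_perm r)) (a cur)].
Proof.
move=> B0 yC F1 F2.
have aO : a cur \in O by rewrite a_reg (cs_cur S).
set f' := (tperm (fl x) (b cur) * face_perm r)%g.
have frE : face_perm r1 = (tperm (a cur) (fl y) * f')%g by rewrite face_r1 tpermC.
have f'a : porbit f' (a cur) = O by rewrite step_leaf aO.
have [yO ya] : fl y \in O /\ fl y != a cur.
  move: yC; rewrite in_setU1 => /orP[/eqP ->|yC].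
    by rewrite fl_inr b_reg (cs_cur S) inr_a andbF.
  rewrite fl_region //; split.
    by move: yC; case: (y) => [v|[k c]]; rewrite !inE // => /andP[].
  apply: contraTneq yC => E; rewrite -[y]flE E fl_inr /= b_reg setD11 //.
have [] := porbit_split (s := f') (x := a cur) (y := fl y); rewrite ?f'a //.
rewrite -frE -/F1 -/F2 => cov neq out.
have sC : sy.1 \in Bs :|: Ch.
  rewrite /sy; case: eqVneq => [_|ny]; first by rewrite sx inE (cs_cur S) orbT.
  by rewrite inE place_chain ?orbT //; move: yC; rewrite in_setU1 (negbTE ny).
split; last by rewrite /F1 frE.
  apply: next_rest => // u z uBC zu.
  have zO : z \notin O.
    have := face_U_step uBC zu (sub0set _); by rewrite in_setU negb_or => /andP[].
  by rewrite out // step_leaf (negbTE zO).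
split.
- by rewrite cov B0 !set0U.
- apply/pred0Pn => -[z /= /andP[]]; rewrite /F1 /F2 -!eq_porbit_mem => /eqP E1 /eqP E2.
  by move: neq; rewrite /F1 /F2 -E1 -E2 eqxx.
- by apply/set0Pn; exists (a cur); apply: porbit_id.
- by apply/set0Pn; exists (fl y); apply: porbit_id.
- by move=> z; rewrite /F1 -eq_porbit_mem => /eqP.
by move=> z; rewrite /F2 -eq_porbit_mem => /eqP.
Qed.

End Insert.
End Step.

(** The number of corners of one color in the piece [u]. *)
Definition half u : rat := ((w u)%:R - 2) / 2.

Section CountStep.
Variables (r : {perm D}) (s : D -> 'I_h * bool) (Bs Ch : {set 'I_h}) (cur : 'I_h) (e : bool).
Hypothesis S : chain_state r s Bs Ch cur e.
Let U := cur |: ~: (Bs :|: Ch).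
Let U1 := ~: (Bs :|: Ch).
Variable n : nat.

Definition chain_count r U n Bs Ch cur e :=
  #|[set rf | (forget (dts U) rf == r) && valid rf n Bs Ch cur e]|.

Definition rest_count r n Bs :=
  #|[set rf | (forget (dts (~: Bs)) rf == r) && valid_rest rf n Bs]|.

Let T x y := chain_count (insert2 r (a cur) (b cur) x y) U1 n Bs Ch cur e.

(** This is [card_forget] for the two darts of the outgoing edge of [cur]. *)
Lemma chain_count_step : chain_count r U n Bs Ch cur e =
  (\sum_(x in ~: dts U) \sum_(y in a cur |: ~: dts U) T x y)%N.
Proof.
rewrite /chain_count (card_forget (a := a cur) (b := b cur)).
- by rewrite (dts_U1 S).
- by have [] := cs_sited S.
- by rewrite a_dts setU11.
- by rewrite b_dts setU11.
- exact: ab_neq.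
move=> rf /and4P[irf _ _ _] _ r1.
have att k c : k = cur -> exists y : P, (inl y : D) \in porbit r1 (inr (k, c)).
  move=> ->; have /andP[_ /forallP/(_ (inr (cur, c)))/existsP [y yx]] := irf.
  exists y; rewrite /r1 (dts_U1 S); apply: forget_porbit_mem => //.
    by rewrite inr_dts (negbTE (cur_U1 S)).
  by rewrite inl_dts.
have sub1 (p : {perm D}) z : p z = z -> porbit p z = [set z].
  move=> pz; apply/eqP; rewrite eqEsubset sub1set porbit_id andbT.
  by apply: porbit_sub_closed; rewrite ?set11 // => v /set1P ->; rewrite pz set11.
split.
  by apply/eqP => /sub1 E; have [y] := att cur true erefl; rewrite E inE.
apply/eqP => E; have [y yx] := att cur false erefl.
have := @forget_porbit_mem _ [set b cur] r1 (a cur) (inl y).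
rewrite !inE inr_b andbF /= => /(_ isT isT yx).
by rewrite forget_set1 (sub1 _ _ E) inE.
Qed.

Lemma tail_place x y rf : x \notin dts U -> y \in a cur |: ~: dts U ->
  insertion rf -> forget (dts U1) rf = insert2 r (a cur) (b cur) x y ->
  place pc wh rf (a cur) = s x /\
  place pc wh rf (b cur) = if y == a cur then s x else s y.
Proof.
move=> xU yU irf frf; have S1 := step_sited S xU yU.
split; rewrite (sited_place pc_rot wh_rot S1 irf frf) ?eqxx //.
- by rewrite inr_b andbF /= ?eqxx.
- by rewrite a_dts (negbTE (cur_U1 S)).
by rewrite b_dts (negbTE (cur_U1 S)).
Qed.

Lemma T_start x y : x \notin dts U -> y \in a cur |: ~: dts U -> T x y != 0%N ->
  s x = (cur, e).
Proof.
move=> xU yU; rewrite -lt0n card_gt0 => /set0Pn [rf].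
rewrite inE => /andP[/eqP frf /and4P[irf /forallP /(_ cur) cf _ ex]].
have [Ea _] := tail_place xU yU irf frf.
have : tail_color pc wh rf cur == e by move: ex; case: (n) => [|?] /andP[].
by move: cf; rewrite /tail_color Ea; case: (s x) => p q /= /eqP -> /eqP ->.
Qed.

Section Tgt.
Variables x y : D.
Hypotheses (xU : x \notin dts U) (sx : s x = (cur, e)).
Hypothesis yU : y \in a cur |: ~: dts U.
Let sy := if y == a cur then s x else s y.

Lemma T_next n' : n = n'.+1 -> sy.1 \notin Bs :|: Ch ->
  T x y = chain_count (insert2 r (a cur) (b cur) x y) U1 n' Bs (sy.1 |: Ch) sy.1 (~~ sy.2).
Proof.
move=> nE sN; apply: eq_card => rf; rewrite !inE; apply: andb_id2l => /eqP frf.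
rewrite /valid nE; case irf: (insertion rf) => //=; congr [&& _, _ & _].
have [Ea Eb] := tail_place xU yU irf frf.
by rewrite /= /target /tail_color /head_color Ea Eb -/sy sx eqxx (negbTE sN).
Qed.

Lemma T_rest : sy.1 \in Bs :|: Ch -> (sy.1 \in Ch -> Bs = set0) ->
  T x y = rest_count (insert2 r (a cur) (b cur) x y) n (Bs :|: Ch).
Proof.
move=> sN B0; apply: eq_card => rf; rewrite !inE -/U1; apply: andb_id2l => /eqP frf.
rewrite /valid /valid_rest; case irf: (insertion rf) => //=; congr [&& _, _ & _].
have [Ea Eb] := tail_place xU yU irf frf.
have im : (sy.1 \in Ch) ==> (Bs == set0) by apply/implyP => /B0 ->.
case: n => [|n'].
  by rewrite /= /target /tail_color /head_color Ea Eb -/sy sx eqxx sN im.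
by rewrite /= /target /tail_color /head_color Ea Eb -/sy sx eqxx sN im.
Qed.

(** A later walk that returned to its own chain is rejected. *)
Lemma T_stuck : sy.1 \in Ch -> Bs != set0 -> T x y = 0%N.
Proof.
move=> sC B0; apply/eqP; rewrite cards_eq0; apply/eqP/setP => rf; rewrite !inE.
apply/negP => /andP[/eqP frf /and4P[irf _ _]].
have [Ea Eb] := tail_place xU yU irf frf.
by case: n => [|n']; rewrite /= /target Eb -/sy inE sC orbT (negbTE B0) /= andbF.
Qed.

End Tgt.
End CountStep.

Lemma faces_okE r F1 F2 : base_faces r setT F1 F2 ->
  faces_ok r = (#|F1| == d1) && (#|F2| == d2) || (#|F1| == d2) && (#|F2| == d1).
Proof.
move=> [cov dj n1 n2 o1 o2].
have covT z : (z \in F1) || (z \in F2).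
  by rewrite -in_setU cov; case: z => [v|[k c]]; rewrite !inE.
have neq : F1 != F2.
  by apply: contraNneq n1 => E; move: dj; rewrite -E -setI_eq0 setIid.
have pE : porbits (face_perm r) = [set F1; F2].
  apply/setP=> F; apply/imsetP/set2P => [[z _ ->]|].
    by case/orP: (covT z) => [/o1 ->|/o2 ->]; [left|right].
  case=> ->; [move/set0Pn: n1 => [z zF] | move/set0Pn: n2 => [z zF]]; exists z => //.
    by rewrite o1.
  by rewrite o2.
apply/existsP/idP => [[f1 /existsP [f2 /and4P[nf /eqP E /eqP c1 /eqP c2]]]|].
  rewrite pE in E; have f1E : f1 \in [set F1; F2] by rewrite E set21.
  have f2E : f2 \in [set F1; F2] by rewrite E set22.
  case/set2P: f1E => e1; case/set2P: f2E => e2; subst f1 f2; rewrite ?eqxx // in nf *.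
    by rewrite c1 c2 !eqxx.
  by rewrite c1 c2 !eqxx orbT.
case/orP => /andP[c1 c2].
  by exists F1; apply/existsP; exists F2; rewrite neq pE eqxx c1 c2.
by exists F2; apply/existsP; exists F1; rewrite eq_sym neq pE setUC eqxx c1 c2.
Qed.

Lemma forests_set0 e1 e2 n1 n2 : (0 < e1)%N -> (0 < e2)%N ->
  forests w e1 e2 n1 n2 set0 = ((n1 == e1) && (n2 == e2))%:R.
Proof.
move=> e10 e20; rewrite /forests (big_pred1 set0); last by move=> J; rewrite subset0.
rewrite setDv weight0 !addn0 /hang2 setDv cards0 /=; case: ifP => [/andP[/eqP -> /eqP ->]|_ //].
by rewrite mulrACA !mulfV ?mulr1 // pnatr_eq0 -lt0n.
Qed.

Lemma count_finished r s Bs F1 F2 : rest_state r s Bs -> base_faces r Bs F1 F2 ->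
  #|~: Bs| = 0%N ->
  (rest_count r 0 Bs)%:R = forests w d1 d2 #|F1| #|F2| set0 + forests w d2 d1 #|F1| #|F2| set0.
Proof.
move=> S bf /cards0_eq B0; have BT : Bs = setT by rewrite -[Bs]setCK B0 setC0.
rewrite !forests_set0 // /rest_count B0 BT in bf S *.
have d0 : dts set0 = set0 by apply/setP=> -[v|[k c]]; rewrite !inE.
have := rs_sited S; rewrite setCT d0 => S0; have [ir pl] := sited_insertion pc_rot wh_rot S0.
have f0 rf : forget set0 rf = rf by apply: forget_fixed => z; rewrite inE.
have -> : [set rf | (forget set0 rf == r) && valid_rest rf 0 [set: 'I_h]] =
   if faces_ok r then [set r] else set0.
  apply/setP=> rf; rewrite inE f0; case: eqVneq => [->|nr] /=; last first.
    by case: ifP; rewrite !inE ?(negbTE nr).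
  rewrite /valid_rest ir andbT (_ : canonical pc wh r) /=; last first.
    by apply/forallP=> k; rewrite pl (rs_tail S) ?inE.
  by case: (faces_ok r); rewrite !inE ?eqxx.
rewrite (faces_okE bf).
have np : (#|F1| == d1) && (#|F1| == d2) = false.
  by case: eqVneq => [->|] //=; apply: negbTE.
move: np; case: (#|F1| == d1); case: (#|F1| == d2); case: (#|F2| == d1); case: (#|F2| == d2) => //= _;
  by rewrite ?cards1 ?cards0 ?addr0 ?add0r.
Qed.

(** The three numbers computed by simultaneous induction on the number [n]
    of pieces not visited yet: between two walks, during a later walk
    ([chain_spec]) and during the first one ([first_spec]). *)
Definition rest_spec n := forall r s Bs F1 F2,
  rest_state r s Bs -> base_faces r Bs F1 F2 -> #|~: Bs| = n ->
  (rest_count r n Bs)%:R = \prod_(u in ~: Bs) half u *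
    (forests w d1 d2 #|F1| #|F2| (~: Bs) + forests w d2 d1 #|F1| #|F2| (~: Bs)).

Definition chain_spec n := forall r s Bs Ch cur e F1 F2,
  chain_state r s Bs Ch cur e -> base_faces r Bs F1 F2 -> #|~: (Bs :|: Ch)| = n ->
  (chain_count r (cur |: ~: (Bs :|: Ch)) n Bs Ch cur e)%:R =
  \prod_(u in cur |: ~: (Bs :|: Ch)) half u *
    (chain_forests w d1 d2 #|F1| #|F2| (weight w Ch) (~: (Bs :|: Ch)) +
     chain_forests w d2 d1 #|F1| #|F2| (weight w Ch) (~: (Bs :|: Ch))).

Definition first_spec n := forall r s Ch cur e,
  chain_state r s set0 Ch cur e -> #|~: (set0 :|: Ch)| = n ->
  (chain_count r (cur |: ~: (set0 :|: Ch)) n set0 Ch cur e)%:R =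
  \prod_(u in cur |: ~: (set0 :|: Ch)) half u *
    (unicycles w d1 d2 (weight w Ch) (~: (set0 :|: Ch)) +
     unicycles w d2 d1 (weight w Ch) (~: (set0 :|: Ch))).

Lemma base_faces_sym r Bs F1 F2 : base_faces r Bs F1 F2 -> base_faces r Bs F2 F1.
Proof. by case=> c dj n1 n2 o1 o2; split=> //; rewrite 1?setUC // disjoint_sym. Qed.

Lemma count_start n : chain_spec n -> rest_spec n.+1.
Proof.
move=> C r s Bs F1 F2 S bf En.
have [|M [lM MB dM]] := leaderP dominated (Q := ~: Bs); first by rewrite -card_gt0 En.
have MB' : M \notin Bs by move: MB; rewrite inE.
have E1 : ~: (Bs :|: [set M]) = ~: Bs :\ M by rewrite setCU setDE.
have E2 : M |: ~: (Bs :|: [set M]) = ~: Bs by rewrite E1 setD1K.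
have En' : #|~: (Bs :|: [set M])| = n.
  by move: En; rewrite E1 (cardsD1 M) MB => -[].
have := C _ _ _ _ _ _ _ _ (chain_state_start S MB') bf En'.
rewrite E2 E1 (forestsE _ d1_gt0 d2_gt0 _ _ MB) (forestsE _ d2_gt0 d1_gt0 _ _ MB).
rewrite /weight big_set1 => <-; congr _%:R; rewrite /rest_count /chain_count.
by apply: eq_card => rf; rewrite !inE /valid_rest lM.
Qed.

Section Sums.
Variables (r : {perm D}) (s : D -> 'I_h * bool) (Bs Ch : {set 'I_h}) (cur : 'I_h) (e : bool).
Hypothesis S : chain_state r s Bs Ch cur e.
Let U := cur |: ~: (Bs :|: Ch).
Let U1 := ~: (Bs :|: Ch).
Variable n : nat.
Let T x y := chain_count (insert2 r (a cur) (b cur) x y) U1 n Bs Ch cur e.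

(** All the [half cur] corners for the tail have the same number [c] of
    completions. *)
Lemma chain_count_slots c :
  (forall x, x \notin dts U -> s x = (cur, e) ->
    \sum_(y in reg Bs Bs) (T x y)%:R +
    \sum_(u in U1) \sum_(y | pc y == u) (T x (inl y))%:R +
    \sum_(y in a cur |: reg Ch (Ch :\ cur)) (T x y)%:R = c :> rat) ->
  (chain_count r U n Bs Ch cur e)%:R = half cur * c.
Proof.
move=> H; rewrite (chain_count_step S) natr_sum.
under eq_bigr do rewrite natr_sum.
apply: (start_count S) => [x xU|y sy].
  case: (eqVneq (s x) (cur, e)) => // sx; rewrite big1 ?eqxx // => y yU.
  apply/eqP; rewrite pnatr_eq0; apply: contraNT sx => /(T_start S xU yU) ->.
  by rewrite eqxx.
have [_ _ /(_ y) [yU ys] _ _] := cs_sited S.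
by rewrite (slots_count S); apply: H; rewrite ?ys.
Qed.

Lemma sum_next x (f : {set 'I_h} -> 'I_h -> rat) :
  x \notin dts U -> s x = (cur, e) ->
  (forall n' (y0 : P) r1 s1, n = n'.+1 -> pc y0 \notin Bs :|: Ch ->
     r1 = insert2 r (a cur) (b cur) x (inl y0) ->
     chain_state r1 s1 Bs (pc y0 |: Ch) (pc y0) (~~ wh y0) ->
     (forall F1 F2, base_faces r Bs F1 F2 -> base_faces r1 Bs F1 F2) ->
     (chain_count r1 U1 n' Bs (pc y0 |: Ch) (pc y0) (~~ wh y0))%:R =
       f (U1 :\ pc y0) (pc y0)) -> #|U1| = n ->
  \sum_(u in U1) \sum_(y | pc y == u) (T x (inl y))%:R =
  \sum_(u in U1) ((w u)%:R - 2) * f (U1 :\ u) u.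
Proof.
move=> xU sx H En; apply: eq_bigr => u uU1.
rewrite -card_piece -sum1_card natr_sum mulr_suml.
apply: eq_big => [y|y /eqP pu]; first by rewrite inE.
have yU : (inl y : D) \in a cur |: ~: dts U by rewrite in_setU1 in_setC inl_dts orbT.
have sy : s (inl y) = st y by have [_ _ /(_ y) [_ ->] _ _] := cs_sited S.
have pN : pc y \notin Bs :|: Ch by rewrite pu; move: uU1; rewrite inE.
have [n' nE] : exists n', n = n'.+1.
  case: n En => [|n' _]; last by exists n'.
  by move=> /cards0_eq E; rewrite E inE in uU1.
have [S1 bf1] := next_chain S xU sx yU erefl pN.
rewrite mul1r /T (T_next S xU sx yU nE) inl_a sy //.
by rewrite (H n' y _ _ nE pN erefl S1 bf1) pu.
Qed.

End Sums.

Lemma chain_slot r s Bs Ch cur e (S : chain_state r s Bs Ch cur e) x y :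
  s x = (cur, e) -> y \in a cur |: reg Ch (Ch :\ cur) ->
  y \in a cur |: ~: dts (cur |: ~: (Bs :|: Ch)) /\
  (if y == a cur then s x else s y).1 \in Ch.
Proof.
move=> sx; rewrite !in_setU1; case: eqVneq => [_ _|ya /=]; first by rewrite sx (cs_cur S).
move=> yC; split; last exact: (place_chain S yC).
by rewrite (notin_dtsU Bs Ch) (region_split S) inE yC orbT.
Qed.

Lemma base_slot r s Bs Ch cur e (S : chain_state r s Bs Ch cur e) y :
  y \in reg Bs Bs -> y \in a cur |: ~: dts (cur |: ~: (Bs :|: Ch)) /\ y != a cur.
Proof.
move=> yB; split.
  by rewrite in_setU1 (notin_dtsU Bs Ch) (region_split S) !in_setU yB orbT.
apply: contraTneq yB => ->; rewrite a_reg; apply/negP => /(BCF S); apply; exact: cs_cur S.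
Qed.

Lemma card_base_chain r s Bs Ch cur e (S : chain_state r s Bs Ch cur e) F1 F2 :
  base_faces r Bs F1 F2 -> #|F1 :|: reg Ch Ch| = (#|F1| + weight w Ch)%N.
Proof.
case=> cov _ _ _ _ _; rewrite cardsU card_regionTT.
have F1B : F1 \subset reg Bs Bs by rewrite -cov subsetUl.
have := base_dis S F1B; rewrite -setI_eq0 => /eqP ->.
by rewrite cards0 subn0.
Qed.

Lemma count_base n r s Bs Ch cur e F1 F2 x y : rest_spec n ->
  chain_state r s Bs Ch cur e -> base_faces r Bs F1 F2 -> #|~: (Bs :|: Ch)| = n ->
  x \notin dts (cur |: ~: (Bs :|: Ch)) -> s x = (cur, e) -> fl y \in F1 ->
  (chain_count (insert2 r (a cur) (b cur) x y) (~: (Bs :|: Ch)) n Bs Ch cur e)%:R =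
  \prod_(u in ~: (Bs :|: Ch)) half u *
    (forests w d1 d2 (#|F1| + weight w Ch) #|F2| (~: (Bs :|: Ch)) +
     forests w d2 d1 (#|F1| + weight w Ch) #|F2| (~: (Bs :|: Ch))).
Proof.
move=> Rn S bf En xU sx yF.
have yB : y \in reg Bs Bs.
  by rewrite -(fl_region pc_flip); have [<- _ _ _ _ _] := bf; rewrite inE yF.
have [yU ya] := base_slot S yB.
have sB : (if y == a cur then s x else s y).1 \in Bs by rewrite (negbTE ya) (place_base S).
have [S1 bf1] := next_base S xU sx yU bf yF.
rewrite (T_rest S n xU sx yU); first by rewrite (Rn _ _ _ _ _ S1 bf1 En) (card_base_chain S bf).
  by rewrite inE sB.
by move=> /(BCF S sB).
Qed.

(** The three terms of [chain_forests_rec] are the two faces of the base and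
    the pieces not visited yet; in the chain itself the head is not allowed. *)
Lemma count_chain n : rest_spec n -> (forall n', n = n'.+1 -> chain_spec n') ->
  chain_spec n.
Proof.
move=> Rn Cn r s Bs Ch cur e F1 F2 S bf En.
set U1 := ~: (Bs :|: Ch).
have Bs0 : Bs != set0.
  have [cov _ n1 _ _ _] := bf; apply: contraNneq n1 => B0.
  rewrite -subset0; apply: (subset_trans (subsetUl F1 F2)); rewrite cov B0.
  by apply/subsetP => -[v|[k c]]; rewrite !inE.
rewrite big_setU1 ?(cur_U1 S) //= -mulrA; apply: (chain_count_slots S) => x xU sx.
rewrite [X in _ + X]big1 ?addr0; last first.
  move=> y yC; have [yU sC] := chain_slot S sx yC.
  by rewrite (T_stuck S n xU yU).
rewrite (sum_next (f := fun U' u => \prod_(v in U1) half v *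
    (chain_forests w d1 d2 #|F1| #|F2| (weight w Ch + w u) U' +
     chain_forests w d2 d1 #|F1| #|F2| (weight w Ch + w u) U')) S xU sx) //; last first.
  move=> n' y0 r1 s1 nE pN _ S1 bf1.
  have uC : pc y0 \notin Ch by move: pN; rewrite inE negb_or => /andP[].
  have E1 : ~: (Bs :|: (pc y0 |: Ch)) = U1 :\ pc y0.
    by rewrite setUCA setCU setIC setDE.
  have uU1 : pc y0 \in U1 by rewrite inE.
  have E2 : pc y0 |: ~: (Bs :|: (pc y0 |: Ch)) = U1 by rewrite E1 setD1K.
  have En' : #|~: (Bs :|: (pc y0 |: Ch))| = n'.
    by move: En; rewrite E1 -/U1 (cardsD1 (pc y0) U1) uU1 nE => -[].
  have := Cn _ nE _ _ _ _ _ _ _ _ S1 (bf1 _ _ bf) En'.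
  by rewrite E2 E1 weightU1 // [(w _ + _)%N]addnC => ->.
have [cov dj _ _ _ _] := bf.
have -> : \sum_(y in reg Bs Bs) (chain_count (insert2 r (a cur) (b cur) x y) U1 n Bs Ch cur e)%:R =
   #|F1|%:R * (\prod_(u in U1) half u *
    (forests w d1 d2 (#|F1| + weight w Ch) #|F2| U1 +
     forests w d2 d1 (#|F1| + weight w Ch) #|F2| U1)) +
   #|F2|%:R * (\prod_(u in U1) half u *
    (forests w d1 d2 #|F1| (#|F2| + weight w Ch) U1 +
     forests w d2 d1 #|F1| (#|F2| + weight w Ch) U1)) :> rat.
  rewrite (reindex_inj (inv_inj (@ins_flipK P h))) /=.
  rewrite (eq_bigl (fun z => z \in F1 :|: F2)); last first.
    by move=> z; rewrite (fl_region pc_flip) cov.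
  rewrite sum_setU //; congr (_ + _).
    rewrite mulr_natl -sumr_const; apply: eq_bigr => z zF.
    by apply: (count_base Rn S bf En xU sx); rewrite flE.
  rewrite mulr_natl -sumr_const; apply: eq_bigr => z zF.
  rewrite (count_base Rn S (base_faces_sym bf) En xU sx) ?flE //.
  by rewrite addrC; congr (_ * (_ + _)); rewrite forestsC.
rewrite !(chain_forests_rec _ d1_gt0 d2_gt0) (chain_forests_rec _ d2_gt0 d1_gt0).
have -> : \sum_(u in U1) ((w u)%:R - 2) * (\prod_(v in U1) half v *
    (chain_forests w d1 d2 #|F1| #|F2| (weight w Ch + w u) (U1 :\ u) +
     chain_forests w d2 d1 #|F1| #|F2| (weight w Ch + w u) (U1 :\ u))) =
  \prod_(v in U1) half v *
   (\sum_(u in U1) ((w u)%:R - 2) * chain_forests w d1 d2 #|F1| #|F2| (weight w Ch + w u) (U1 :\ u) +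
    \sum_(u in U1) ((w u)%:R - 2) * chain_forests w d2 d1 #|F1| #|F2| (weight w Ch + w u) (U1 :\ u)).
  rewrite -big_split mulr_sumr; apply: eq_bigr => u _ /=; ring.
ring.
Qed.

Lemma count_rest n : rest_spec n /\ chain_spec n.
Proof.
elim: n => [|n [Rn Cn]].
  have R0 : rest_spec 0.
    move=> r s Bs F1 F2 S bf En; rewrite (count_finished S bf En).
    by rewrite (cards0_eq En) big_set0 mul1r.
  by split=> //; apply: count_chain.
have R1 := count_start Cn; split=> //; apply: count_chain => // n' [<-]; exact: Cn.
Qed.

(** By [sum_porbit_split], since the positions of the head in the chain are,
    up to the exchange of the two darts of each edge, the points of its face
    other than [a cur]. *)
Lemma count_close n r s Ch cur e x : rest_spec n ->
  chain_state r s set0 Ch cur e -> #|~: (set0 :|: Ch)| = n ->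
  x \notin dts (cur |: ~: (set0 :|: Ch)) -> s x = (cur, e) ->
  \sum_(y in a cur |: reg Ch (Ch :\ cur))
    (chain_count (insert2 r (a cur) (b cur) x y) (~: (set0 :|: Ch)) n set0 Ch cur e)%:R =
  \prod_(u in ~: (set0 :|: Ch)) half u *
    \sum_(1 <= k < weight w Ch)
     (forests w d1 d2 k (weight w Ch - k) (~: (set0 :|: Ch)) +
      forests w d2 d1 k (weight w Ch - k) (~: (set0 :|: Ch))) :> rat.
Proof.
move=> Rn S En xU sx.
set f' := (tperm (fl x) (b cur) * face_perm r)%g.
have aO : a cur \in reg Ch Ch by rewrite a_reg (cs_cur S).
have f'a : porbit f' (a cur) = reg Ch Ch by rewrite (step_leaf S xU sx) aO.
rewrite -(card_regionTT Ch) -f'a.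
rewrite -(sum_porbit_split f' (a cur) (fun k : nat => forests w d1 d2 k (#|porbit f' (a cur)| - k)
  (~: (set0 :|: Ch)) + forests w d2 d1 k (#|porbit f' (a cur)| - k) (~: (set0 :|: Ch)))).
rewrite mulr_sumr [RHS](reindex_inj (inv_inj (@ins_flipK P h))) /=.
apply: eq_big => [y|y yC].
  rewrite in_setU1 f'a in_setD1 (fl_region pc_flip).
  case: y => [v|[k c]]; rewrite ?fl_inl ?fl_inr ?inl_a ?inr_a !inE //=.
  by case: (eqVneq k cur) => [->|] //=; rewrite (cs_cur S); case: c.
have [yU sC] := chain_slot S sx yC.
have [S1 bf1 fE] := next_close S xU sx yU erefl yC.
rewrite (T_rest S n xU sx yU) ?inE ?sC ?orbT //.
rewrite (Rn _ _ _ _ _ S1 bf1 En) -fE.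
suff -> : #|porbit (face_perm (insert2 r (a cur) (b cur) x y)) (fl y)| =
  (#|porbit f' (a cur)| - #|porbit (face_perm (insert2 r (a cur) (b cur) x y)) (a cur)|)%N by [].
have [cov dj _ _ _ _] := bf1; rewrite f'a card_regionTT.
have := congr1 (fun A : {set D} => #|A|) cov; rewrite cardsU card_regionTT set0U => <-.
by move: dj; rewrite -setI_eq0 => /eqP ->; rewrite cards0 subn0 addKn.
Qed.

(** The two terms of [unicycles_rec] are the closing of the chain and the
    pieces not visited yet. *)
Lemma count_first n : first_spec n.
Proof.
elim/ltn_ind: n => n IH r s Ch cur e S En.
have [Rn _] := count_rest n.
set U1 := ~: (set0 :|: Ch).
have wC : (0 < weight w Ch)%N.
  by rewrite (weightD1 w (cs_cur S)) addn_gt0 (ltn_trans _ (w_gt2 cur)).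
have wU : (weight w Ch + weight w U1 = d1 + d2)%N.
  by rewrite d12 -(weightD w (subsetT Ch)) setTD /U1 set0U.
rewrite big_setU1 ?(cur_U1 S) //= -mulrA; apply: (chain_count_slots S) => x xU sx.
rewrite [X in X + _ + _]big_pred0 ?add0r; last by case=> [v|[k c]]; rewrite !inE.
rewrite (sum_next (f := fun U' u => \prod_(v in U1) half v *
    (unicycles w d1 d2 (weight w Ch + w u) U' +
     unicycles w d2 d1 (weight w Ch + w u) U')) S xU sx) //; last first.
  move=> n' y0 r1 s1 nE pN _ S1 _.
  have uC : pc y0 \notin Ch by move: pN; rewrite inE negb_or => /andP[].
  have E1 : ~: (set0 :|: (pc y0 |: Ch)) = U1 :\ pc y0.
    by rewrite setUCA setCU setIC setDE.
  have uU1 : pc y0 \in U1 by rewrite inE.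
  have E2 : pc y0 |: ~: (set0 :|: (pc y0 |: Ch)) = U1 by rewrite E1 setD1K.
  have En' : #|~: (set0 :|: (pc y0 |: Ch))| = n'.
    by move: En; rewrite E1 -/U1 (cardsD1 (pc y0) U1) uU1 nE => -[].
  have ltn' : (n' < n)%N by rewrite nE.
  have := IH _ ltn' _ _ _ _ _ S1 En'.
  by rewrite E2 E1 weightU1 // [(w _ + _)%N]addnC => ->.
rewrite (count_close Rn S En xU sx) -/U1.
rewrite [\sum_(1 <= k < _) _]big_split /=.
rewrite (unicycles_rec d1_gt0 d2_gt0 wC wU) (unicycles_rec d2_gt0 d1_gt0 wC); last by rewrite wU addnC.
have -> : \sum_(u in U1) ((w u)%:R - 2) * (\prod_(v in U1) half v *
    (unicycles w d1 d2 (weight w Ch + w u) (U1 :\ u) +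
     unicycles w d2 d1 (weight w Ch + w u) (U1 :\ u))) =
  \prod_(v in U1) half v *
   (\sum_(u in U1) ((w u)%:R - 2) * unicycles w d1 d2 (weight w Ch + w u) (U1 :\ u) +
    \sum_(u in U1) ((w u)%:R - 2) * unicycles w d2 d1 (weight w Ch + w u) (U1 :\ u)).
  rewrite -big_split mulr_sumr; apply: eq_bigr => u _ /=; ring.
ring.
Qed.

Definition base_place (x : D) : 'I_h * bool :=
  match x with inl y => st y | inr (k, _) => (k, true) end.

Lemma base_state : rest_state (base_rot P h) base_place set0.
Proof.
have inlT (x : D) : x \notin dts setT -> exists y : P, x = inl y.
  by case: x => [y _|[k c]]; [exists y | rewrite inr_dts in_setT].
have fixT : {in dts setT, forall x, base_rot P h x = x}.
  by case=> [y|[k c]]; rewrite ?inl_dts // permE.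
rewrite -[set0]setCT; split; rewrite setCT ?setC0; try by move=> k; rewrite inE.
  split=> //.
  - by move=> x /inlT [y ->]; rewrite permE /= /site pc_rot wh_rot.
  - by move=> y; rewrite inl_dts.
  - by move=> x /inlT [y ->]; exists y; apply: porbit_id.
  exact: forget_fixed.
move=> u _ x xu; have [y xE] : exists y : P, x = inl y.
  by move: xu; case: x => [y|[k c]]; rewrite !inE // => _; exists y.
rewrite xE in xu *; have pu : pc y = u by move: xu; rewrite !inE => /eqP.
have fE i : (face_perm (base_rot P h) ^+ i)%g (inl y : D) = inl (((flip P * Defs.rot P) ^+ i)%g y).
  elim: i => [|i IH]; first by rewrite !expg0 !perm1.
  by rewrite !expgSr !permM IH fl_inl permE.
apply/eqP; rewrite eqEsubset; apply/andP; split.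
  apply: porbit_sub_closed => //; case=> [v|[k c]]; rewrite !inE // => vu.
  by rewrite permM fl_inl permE /= inE pc_rot pc_flip.
apply/subsetP => -[v|[k c]]; rewrite !inE // => /eqP vu.
have /one_face /porbitP [i ->] : pc y = pc v by rewrite vu.
by rewrite -fE mem_porbit.
Qed.

(** The face of degree [d1] can be the one on either side of the cycle,
    whence the factor 2. *)
Lemma count_valid M : leader Dw setT = Some M ->
  #|[set rf | valid rf #|[set~ M]| set0 [set M] M true]|%:R =
  \prod_u half u * (2 * unicycles w d1 d2 (w M) [set~ M]).
Proof.
move=> lM; have MB : M \notin set0 by rewrite inE.
have E1 : ~: (set0 :|: [set M]) = [set~ M] by rewrite set0U.
have := count_first (chain_state_start base_state MB) erefl.
rewrite E1 setUCr /weight big_set1 => C.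
have wU : (w M + weight w [set~ M])%N = (d1 + d2)%N.
  by rewrite d12 (weightD1 w (in_setT M)) setTD.
have wM : (0 < w M)%N by apply: ltn_trans (w_gt2 M).
have : (chain_count (base_rot P h) [set: 'I_h] #|[set~ M]| set0 [set M] M true)%:R =
  \prod_u half u * (2 * unicycles w d1 d2 (w M) [set~ M]).
  rewrite C (unicyclesC d2_gt0 d1_gt0 wM) ?[(d2 + d1)%N]addnC //.
  by congr (_ * _); [apply: eq_bigl => u; rewrite inE | ring].
move=> <-; congr _%:R; apply: eq_card => rf; rewrite !inE.
by rewrite /valid /insertion; case: eqP.
Qed.

End Count.

Lemma uniq_map_inj (T T' : eqType) (f : T -> T') (s : seq T) : uniq (map f s) -> {in s &, injective f}.
Proof.
elim: s => //= z s IH /andP[zs us] x y; rewrite !inE => /orP[/eqP ->|xs] /orP[/eqP ->|ys] // e.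
- by case/negP: zs; rewrite e map_f.
- by case/negP: zs; rewrite -e map_f.
exact: IH.
Qed.

(** * The cycle of a connected functional graph *)

Section FunctionalCycle.
Variables (I : finType) (tau : I -> I).

Definition periodic k := fconnect tau (tau k) k.

Lemma iter_periodic k n : iter n.+1 tau k = k -> periodic k.
Proof. by rewrite iterSr /periodic => {2}<-; apply: fconnect_iter. Qed.

Lemma exists_periodic i : exists2 k, periodic k & fconnect tau i k.
Proof.
have /loopingP /(_ (fingraph.order tau i)) /trajectP [j jn E] := looping_order tau i.
exists (iter j tau i); last exact: fconnect_iter.
apply: (iter_periodic (n := (fingraph.order tau i - j).-1)).
by rewrite -iterD -E; congr (iter _ tau i); lia.
Qed.

Lemma periodic_tau k : periodic k -> periodic (tau k).
Proof.
by rewrite /periodic => /iter_findex {2}<-; rewrite -iterS iterSr; apply: fconnect_iter.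
Qed.

Lemma periodic_iter k n : periodic k -> periodic (iter n tau k).
Proof. by elim: n => //= n IH /IH; apply: periodic_tau. Qed.

Lemma periodic_inj : {in periodic &, injective tau}.
Proof.
have last_of j : periodic j -> findex tau (tau j) j = (fingraph.order tau (tau j)).-1.
  move=> pj; set v := tau j; have jE := iter_findex pj; set n := findex _ _ _ in jE *.
  have nm : (n < fingraph.order tau v)%N by apply: findex_max.
  apply/eqP; rewrite eqn_leq; apply/andP; split; first by lia.
  rewrite leqNgt; apply/negP => lt; have U := fingraph.orbit_uniq tau v.
  have : nth v (fingraph.orbit tau v) 0 = nth v (fingraph.orbit tau v) n.+1.
    rewrite /fingraph.orbit nth_traject; last by lia.
    by rewrite nth_traject ?jE /=; [rewrite jE | lia].
  by move/eqP; rewrite nth_uniq // size_traject; lia.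
move=> j k pj pk e.
by rewrite -(iter_findex pj) -(iter_findex pk) !last_of // e.
Qed.

Hypothesis conn : tau_connected tau.

Lemma reaches_periodic k j : periodic k -> fconnect tau j k.
Proof.
move=> pk; suff : [set i | fconnect tau i k] = setT.
  by move=> T; have := in_setT j; rewrite -T inE.
apply: conn; last by apply/set0Pn; exists k; rewrite inE connect0.
move=> i; rewrite !inE; apply/idP/idP => [|ik]; first by apply: connect_trans; apply: fconnect1.
have := iter_findex ik; case: (findex _ _ _) => [|n] /= E; first by rewrite E.
by rewrite -iterS iterSr in E; rewrite -E fconnect_iter.
Qed.

Lemma fcycle_periodic k : periodic k -> fcycle tau (fingraph.orbit tau k).
Proof.
move=> pk; apply: (@cycle_orbit_in _ tau periodic) => // [x|]; first exact: periodic_tau.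
exact: periodic_inj.
Qed.

Lemma orbit_periodic k j : periodic k -> (j \in fingraph.orbit tau k) = periodic j.
Proof.
move=> pk; rewrite -fconnect_orbit; apply/idP/idP => [/iter_findex <-|pj].
  exact: periodic_iter.
exact: reaches_periodic.
Qed.

(** Following [tau] from a point of [K] leads back to it, since [tau] cannot
    merge points of [K]; and every point leads to the cycle. *)
Lemma injective_invariant (K : {set I}) : K != set0 -> {in K, forall k, tau k \in K} ->
  {in K &, injective tau} -> forall k, (k \in K) = periodic k.
Proof.
move=> K0 Kt Ki k; have itK n i : i \in K -> iter n tau i \in K.
  by elim: n => //= n IH /IH; apply: Kt.
apply/idP/idP => [kK|pk].
  have /loopingP /(_ (fingraph.order tau k)) /trajectP [j jn E] := looping_order tau k.
  apply: (iter_periodic (n := (fingraph.order tau k - j).-1)).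
  have {E} : iter j tau (iter (fingraph.order tau k - j).-1.+1 tau k) = iter j tau k.
    by rewrite -iterD -E; congr (iter _ tau k); lia.
  have : iter (fingraph.order tau k - j).-1.+1 tau k \in K by apply: itK.
  move: (iter _ tau k) => i; elim: j {jn} i => [|j IH] i iK //= /Ki.
  by move=> /(_ (itK _ _ iK) (itK _ _ kK)) /(IH _ iK).
have /set0Pn [i iK] := K0; have /iter_findex <- : fconnect tau i k by apply: reaches_periodic.
exact: itK.
Qed.

End FunctionalCycle.

(** * Connected components and colorings *)

Section Linked.
Variable G : ribbon_graph.
Implicit Types (x y z : G) (E S : {set G}) (col : G -> bool).

Definition flip_closed E := forall x, x \in E -> flip G x \in E.

Lemma flip_closedE E x : flip_closed E -> (flip G x \in E) = (x \in E).
Proof. by move=> cl; apply/idP/idP => [/cl|/cl //]; rewrite flipK. Qed.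

Lemma linked_trans E x y z : linked E x y -> linked E y z -> linked E x z.
Proof. exact: connect_trans. Qed.

Lemma linked_refl E x : linked E x x. Proof. exact: connect0. Qed.

Lemma linked_rot E x : linked E x (Defs.rot G x).
Proof. by apply: connect1; rewrite /= eqxx. Qed.

Lemma linked_flip E x : x \notin E -> linked E x (flip G x).
Proof. by move=> xE; apply: connect1; rewrite /= xE eqxx orbT. Qed.

Lemma linked_porbit E x y : y \in porbit (Defs.rot G) x -> linked E x y.
Proof.
move=> /porbitP [i ->]; elim: i => [|i IH]; first by rewrite expg0 perm1 linked_refl.
by rewrite expgSr permM; apply: linked_trans IH (linked_rot _ _).
Qed.

Lemma linked_ind E (Q : G -> Prop) x y :
  (forall z, Q z -> Q (Defs.rot G z)) -> (forall z, z \notin E -> Q z -> Q (flip G z)) ->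
  linked E x y -> Q x -> Q y.
Proof.
move=> Hr Hf /connectP [p]; elim: p x => [|z p IH] x /=; first by move=> _ ->.
case/andP=> /orP[/eqP ->|/andP[xE /eqP ->]] pp el Qx; apply: IH pp el _; first exact: Hr.
exact: Hf.
Qed.

Lemma linked_sym E x y : flip_closed E -> linked E x y -> linked E y x.
Proof.
move=> cl l; apply: (@linked_ind E (fun z => linked E z x) x y) l (linked_refl _ _).
  move=> z; apply: linked_trans; apply: linked_porbit.
  by rewrite porbit_sym mem_porbit1 porbit_id.
by move=> z zE; apply: linked_trans; rewrite -{2}(flipK z); apply: linked_flip; rewrite flip_closedE.
Qed.

Lemma component_rot E x y : y \in component E x -> Defs.rot G y \in component E x.
Proof. by rewrite !inE => l; apply: linked_trans l (linked_rot _ _). Qed.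

Lemma component_flip E x y : y \notin E -> y \in component E x -> flip G y \in component E x.
Proof. by rewrite !inE => yE l; apply: linked_trans l (linked_flip _). Qed.

(** Whether the two colorings agree does not change along an edge or around
    a vertex. *)
Lemma proper_coloring_uniq E S x y col col' : {subset component E x <= S} ->
  proper_coloring E S col -> proper_coloring E S col' -> linked E x y ->
  col y (+) col' y = col x (+) col' x.
Proof.
move=> sub p p' l.
suff: linked E x y /\ col y (+) col' y = col x (+) col' x by case.
apply: (@linked_ind E (fun z => linked E x z /\ col z (+) col' z = col x (+) col' x) x y) l (conj (linked_refl _ _) erefl).
  move=> z [lz ez]; split; first by apply: linked_trans lz (linked_rot _ _).
  have zS : z \in S by apply: sub; rewrite inE.
  by have [-> _] := p _ zS; have [-> _] := p' _ zS.
move=> z zE [lz ez]; split; first by apply: linked_trans lz (linked_flip _).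
have zS : z \in S by apply: sub; rewrite inE.
have [_ /(_ zE) ->] := p _ zS; have [_ /(_ zE) ->] := p' _ zS.
by rewrite -ez addNb addbN negbK.
Qed.

Section ColorSum.
Variables (R : realType) (q : {set G} -> R) (mu : G -> R).
Hypothesis mu_sum : forall v, v \in vertices G -> \sum_(x in v) mu x = q v.

(** When each vertex parameter is distributed over the darts of the vertex
    by [mu], sums over vertices become sums over darts. *)
Lemma color_sumE S col c : (forall x, x \in S -> Defs.rot G x \in S /\ col (Defs.rot G x) = col x) ->
  color_sum q S col c = \sum_(x in S | col x == c) mu x.
Proof.
move=> clS; rewrite /color_sum.
pose S' := [set x in S | col x == c].
have clS' x : x \in S' -> Defs.rot G x \in S'.
  by rewrite !inE => /andP[xS /eqP cx]; have [-> ->] := clS _ xS; rewrite cx eqxx.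
rewrite [RHS](eq_bigl (fun x => x \in S')); last by move=> x; rewrite inE.
rewrite [RHS](partition_big (fun x => porbit (Defs.rot G) x) (fun v => (v \in vertices G) && (v \subset S'))) /=; last first.
  move=> x xS; rewrite imset_f //=; apply: porbit_sub_closed => // u; exact: clS'.
apply: eq_bigr => v /andP[vV vS]; rewrite -mu_sum //; apply: eq_bigl => x.
have /imsetP [z _ vE] := vV.
rewrite vE eq_porbit_mem andbC; case: (boolP (x \in porbit _ z)) => //= xz.
by apply/esym; apply: (subsetP vS); rewrite vE.
Qed.

End ColorSum.
End Linked.

Lemma odd_orbit (T : finType) (s : {perm T}) (col : T -> bool) x :
  (forall z, col (s z) = ~~ col z) -> ~~ odd #|porbit s x|.
Proof.
move=> H; have E n : col (iter n s x) = col x (+) odd n.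
  elim: n => [|n IH] /=; first by rewrite addbF.
  by rewrite H IH; case: (col x); case: (odd n).
by have := E #|porbit s x|; rewrite iter_porbit; case: (col x); case: odd.
Qed.

Lemma edge_ofE (G : ribbon_graph) (x : G) : edge_of x = [set x; flip G x].
Proof.
apply/eqP; rewrite eqEsubset; apply/andP; split.
  apply: porbit_sub_closed; rewrite ?set21 // => u /set2P [] ->; first exact: set22.
  by rewrite flipK set21.
by apply/subsetP => u /set2P [] ->; rewrite /edge_of ?mem_porbit1 ?porbit_id.
Qed.

(** * Weights of the inserted edges *)

Section Weights.
Variables (P : ribbon_graph) (h : nat) (pc : P -> 'I_h) (wh : P -> bool).
Hypotheses (pc_rot : forall y, pc (Defs.rot P y) = pc y) (pc_flip : forall y, pc (flip P y) = pc y).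
Hypotheses (wh_rot : forall y, wh (Defs.rot P y) = wh y) (wh_flip : forall y, wh (flip P y) = ~~ wh y).
Hypothesis piece_conn : forall y y', pc y = pc y' -> linked set0 y y'.

Local Notation D := (ins_dart P h).
Local Notation fl := (ins_flip P h).
Local Notation a := (@tail_dart P h).
Local Notation b := (@head_dart P h).
Local Notation st := (site pc wh).
Variable rf : {perm D}.
Hypothesis irf : insertion rf.
Local Notation GG := (ins_graph rf).
Local Notation pl := (fun x => (place pc wh rf x).1).
Local Notation co := (fun x => (place pc wh rf x).2).
Implicit Types (x : D) (y : P) (k : 'I_h) (E S : {set D}).

Lemma attached x : exists2 y : P, (inl y : D) \in porbit rf x & place pc wh rf x = st y.
Proof.
have /andP[_ /forallP /(_ x) /existsP [y yx]] := irf.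
by exists y => //; apply: (place_porbit pc_rot wh_rot).
Qed.

Lemma place_inlE y : place pc wh rf (inl y) = st y.
Proof. exact: (place_inl pc_rot wh_rot). Qed.

Lemma placeR x : place pc wh rf (rf x) = place pc wh rf x.
Proof. exact: (place_rot pc_rot wh_rot). Qed.

Lemma inl_porbit y y' : ((inl y' : D) \in porbit rf (inl y)) = (y' \in porbit (Defs.rot P) y).
Proof.
have /andP[/eqP f0 _] := irf.
have -> : ((inl y' : D) \in porbit rf (inl y)) = ((inl y' : D) \in porbit (base_rot P h) (inl y)).
  apply/idP/idP => H; first by rewrite -f0; apply: forget_porbit_mem; rewrite ?inl_dts.
  have yN : (inl y : D) \notin edge_darts P setT by rewrite inl_dts.
  by apply: (subsetP (forget_porbit_sub rf yN)); rewrite f0.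
have fE i : (base_rot P h ^+ i)%g (inl y : D) = inl ((Defs.rot P ^+ i)%g y).
  elim: i => [|i IH]; first by rewrite !expg0 !perm1.
  by rewrite !expgSr !permM IH permE.
apply/porbitP/porbitP => -[i E]; exists i; last by rewrite fE E.
by move: E; rewrite fE => -[].
Qed.

Lemma linked_inl (E0 : {set P}) E y y' : (forall z : P, (inl z : D) \in E -> z \in E0) ->
  linked E0 y y' -> @linked GG E (inl y) (inl y').
Proof.
move=> EE0 l; apply: (@linked_ind P E0 (fun z : P => @linked GG E (inl y) (inl z))) l (linked_refl _ _).
  move=> z; move/linked_trans; apply; apply: linked_porbit.
  by rewrite /= inl_porbit mem_porbit1 porbit_id.
move=> z zE; move/linked_trans; apply; rewrite -(fl_inl h z).
apply: (@linked_flip GG); apply: contraNN zE; exact: EE0.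
Qed.

Lemma piece_linked E x x' : (forall y, (inl y : D) \notin E) -> pl x = pl x' ->
  @linked GG E x x'.
Proof.
move=> EN; have [y yx ->] := attached x; have [y' yx' ->] := attached x'; rewrite /= => e.
apply: linked_trans (@linked_porbit GG E x (inl y) yx) _.
apply: linked_trans (linked_inl (E0 := set0) _ (piece_conn e)) _.
  by move=> z zE; have := EN z; rewrite zE.
by apply: (@linked_porbit GG); rewrite /= porbit_sym.
Qed.

Lemma coloring_porbit E S col x z : (forall x, x \in S -> rf x \in S) ->
  @proper_coloring GG E S col -> x \in S -> z \in porbit rf x -> z \in S /\ col z = col x.
Proof.
move=> clS pr xS /porbitP [i ->]; elim: i => [|i [iS e]]; first by rewrite expg0 perm1.
by rewrite expgSr permM; have [<- _] := pr _ iS; split; [exact: clS | rewrite -e; have [-> _] := pr _ iS].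
Qed.

(** The pieces stay connected when inserted edges are deleted. So a
    component is a union of pieces, and a coloring of it is given by the
    pieces whose colors it exchanges. *)
Lemma component_pieces E x col : (forall y, (inl y : D) \notin E) ->
  let S := @component GG E x in @proper_coloring GG E S col ->
  exists J : {set 'I_h}, exists sw : 'I_h -> bool,
    (forall z, (z \in S) = (pl z \in J)) /\ {in S, forall z, col z = sw (pl z) (+) co z}.
Proof.
move=> EN S pr.
have clS z : z \in S -> rf z \in S by apply: (@component_rot GG).
have join z z' : z \in S -> pl z = pl z' -> z' \in S.
  by move=> zS e; move: zS; rewrite !inE => /linked_trans; apply; apply: piece_linked.
have join_col z z' : z \in S -> pl z = pl z' -> col z (+) co z = col z' (+) co z'.
  move=> zS e; have z'S := join _ _ zS e; move: e.
  have [y yz ->] := attached z; have [y' yz' ->] := attached z'; rewrite /= => e.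
  have [yS <-] := coloring_porbit clS pr zS yz.
  have [y'S <-] := coloring_porbit clS pr z'S yz'.
  apply/esym; apply: (@proper_coloring_uniq P set0 (component set0 y) y y' (fun v => col (inl v)) wh) => //.
  - move=> v; rewrite inE => yv.
    have vS : (inl v : D) \in S.
      move: yS; rewrite !inE => /linked_trans; apply; apply: linked_inl yv => u uE.
      by have := EN u; rewrite uE.
    split; last by move=> _; have [_ /(_ (EN v))] := pr _ vS; rewrite /= fl_inl.
    by apply: (coloring_porbit clS pr vS _).2; rewrite inl_porbit mem_porbit1 porbit_id.
  by apply: piece_conn.
exists [set j | [exists z in S, pl z == j]].
exists (fun j => if [pick z in S | pl z == j] is Some z then col z (+) co z else false).
split=> z.
  rewrite [RHS]inE; apply/idP/existsP => [zS|[z' /andP[z'S /eqP e]]]; first by exists z; rewrite zS eqxx.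
  exact: join z'S e.
move=> zS; case: pickP => [z' /andP[z'S /eqP e]|/(_ z)]; last by rewrite zS eqxx.
by rewrite (join_col _ _ z'S e) -addbA addbb addbF.
Qed.

Section VertexSums.
Variables (R : realType) (q : {set P} -> R).
Local Notation sg := (color_sign R).

(** The parameter of a vertex is shared equally by its darts. *)
Definition dart_param y : R := q (vertex_of y) / #|vertex_of y|%:R.

Definition ins_dart_param x : R := if x is inl y then dart_param y else 0.

Definition ins_vertex_param (v : {set GG}) : R := q (@preimset P _ inl (mem v)).

Lemma dart_param_sum (v : {set P}) : v \in vertices P -> \sum_(y in v) dart_param y = q v.
Proof.
move=> /imsetP [y _ ->]; rewrite (eq_bigr (fun _ => q (vertex_of y) / #|vertex_of y|%:R)).
  rewrite sumr_const -[LHS]mulr_natr divfK // pnatr_eq0; exact: card_porbit_neq0.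
by move=> z; rewrite /dart_param /vertex_of -eq_porbit_mem => /eqP ->.
Qed.

Lemma preim_vertex x y : (inl y : D) \in porbit rf x ->
  @preimset P _ inl (mem (porbit rf x)) = vertex_of y.
Proof.
move=> yx; apply/setP=> z; rewrite !inE /= /vertex_of -inl_porbit.
by move: yx; rewrite -eq_porbit_mem => /eqP ->.
Qed.

Lemma ins_dart_param_sum (v : {set GG}) : v \in vertices GG ->
  \sum_(x in v) ins_dart_param x = ins_vertex_param v.
Proof.
move=> /imsetP [x _ vE]; have [y yx _] := attached x.
rewrite /ins_vertex_param vE /= (preim_vertex yx) -dart_param_sum ?imset_f //.
rewrite big_sumType /= [X in _ + X]big1 ?addr0 //.
by apply: eq_bigl => z; rewrite -(preim_vertex yx) !inE.
Qed.

Lemma color_sign_addb (c c' : bool) : sg (c (+) c') = sg (~~ c) * sg c'.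
Proof. by case: c; case: c'; rewrite /color_sign /= ?mulr1 ?mul1r ?mulrN1 ?opprK. Qed.

Lemma color_diff (G : ribbon_graph) (p : {set G} -> R) (mu : G -> R) (S' : {set G}) col c :
  (forall v, v \in vertices G -> \sum_(u in v) mu u = p v) ->
  (forall u, u \in S' -> Defs.rot G u \in S' /\ col (Defs.rot G u) = col u) ->
  color_sum p S' col c - color_sum p S' col (~~ c) = sg c * \sum_(u in S') sg (col u) * mu u.
Proof.
move=> ms clS; rewrite !(color_sumE ms) // mulr_sumr [RHS](bigID (fun u => col u == c)) /=.
congr (_ + _).
  by apply: eq_bigr => u /andP[_ /eqP ->]; rewrite mulrA color_sign_sq mul1r.
rewrite -sumrN [LHS](eq_bigl (fun u => (u \in S') && (col u != c))); last by move=> u; case: (col u); case: c.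
apply: eq_bigr => u /andP[_ cx]; have -> : col u = ~~ c by move: cx; case: (col u); case: c.
by rewrite color_signN mulNr mulrN mulrA color_sign_sq mul1r.
Qed.

(** The excess [Dv i] of the white vertices over the black ones in the piece
    [i] is carried by the darts inserted in it. *)
Definition ins_flow (Dv w : 'I_h -> R) : Prop := forall i,
  \sum_(p : 'I_h * bool | pl (inr p) == i) sg (co (inr p)) * w p.1 = Dv i.

Variable Dv : 'I_h -> R.
Hypothesis DvE : forall i, \sum_(y | pc y == i) sg (wh y) * dart_param y = Dv i.

(** Exchanging the colors of a piece changes the sign of both sides of its
    equation. *)
Lemma flow_component E x col w : (forall y, (inl y : D) \notin E) ->
  let S := @component GG E x in @proper_coloring GG E S col -> ins_flow Dv w ->
  \sum_(z in S) sg (col z) * ins_dart_param z =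
  \sum_(p : 'I_h * bool | (inr p : D) \in S) sg (col (inr p)) * w p.1.
Proof.
move=> EN S pr fw; have [J [sw [SJ colE]]] := component_pieces EN pr.
have -> : \sum_(z in S) sg (col z) * ins_dart_param z =
   \sum_(y | pc y \in J) sg (sw (pc y) (+) wh y) * dart_param y.
  rewrite big_sumType /= [X in _ + X]big1 ?addr0; last by move=> p _; rewrite mulr0.
  apply: eq_big => [y|y yS]; first by rewrite SJ place_inlE.
  by rewrite colE // place_inlE.
rewrite (partition_big pc (fun j => j \in J)) //=.
rewrite [RHS](partition_big (fun p => pl (inr p)) (fun j => j \in J)) /=; last by move=> p; rewrite SJ.
apply: eq_bigr => j jJ.
transitivity (sg (~~ sw j) * Dv j).
  rewrite -DvE mulr_sumr; apply: eq_big => [y|y /andP[_ /eqP ->]]; last by rewrite color_sign_addb mulrA.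
  by case: eqP => [->|]; rewrite ?jJ ?andbF.
rewrite -(fw j) mulr_sumr; apply: eq_big => [p|p /eqP pj]; last by rewrite colE ?SJ ?pj // color_sign_addb mulrA.
by rewrite SJ; case: eqP => [->|]; rewrite ?jJ ?andbF.
Qed.

Lemma ins_edgeP k x : x \in ins_edge P k -> x = a k \/ x = b k.
Proof. by move/set2P. Qed.

Lemma ins_edge_flip k : @flip_closed GG (ins_edge P k).
Proof. by move=> x /ins_edgeP [] ->; rewrite /= fl_inr !inE /= ?eqxx ?orbT. Qed.

Lemma bridge_ins k x : x \in ins_edge P k ->
  bridge (G := GG) (ins_edge P k) = ~~ @linked GG (ins_edge P k) x (fl x).
Proof.
have cl := ins_edge_flip (k := k).
move=> xe; apply/existsP/idP => [[z /andP[ze nz]]|nx]; last by exists x; rewrite xe.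
apply: contraNN nz; case/ins_edgeP: ze => ->; case/ins_edgeP: xe => ->; rewrite /= !fl_inr //=;
  exact: (@linked_sym GG).
Qed.

(** In the equation of the component from [flow_component] the two darts of
    every other edge cancel, their colors being opposite. There remains one
    dart of the edge [k] if it is a bridge, and both, with equal colors, if
    it is not. *)
Lemma static_weight_flow k w v : ins_flow Dv w ->
  @static_weight GG R ins_vertex_param (ins_edge P k) v -> v = w k.
Proof.
move=> fw [x [col [xe pr]]]; set S := component _ x.
have cl := ins_edge_flip (k := k).
have EN y : (inl y : D) \notin ins_edge P k by rewrite !inE.
have xS : x \in S by rewrite inE linked_refl.
rewrite (color_diff _ ins_dart_param_sum); last first.
  by move=> z zS; split; [exact: (@component_rot GG) | have [] := pr _ zS].
rewrite (flow_component EN pr fw).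
have -> : \sum_(p : 'I_h * bool | (inr p : D) \in S) sg (col (inr p)) * w p.1 =
   (if a k \in S then sg (col (a k)) * w k else 0) + (if b k \in S then sg (col (b k)) * w k else 0).
  rewrite big_mkcond /= (eq_bigr (fun p : 'I_h * bool => if (inr (p.1, p.2) : D) \in S then sg (col (inr (p.1, p.2))) * w p.1 else 0)); last by move=> [].
  rewrite -(pair_bigA _ (fun k' c => if (inr (k', c) : D) \in S then sg (col (inr (k', c))) * w k' else 0)) /=.
  rewrite (bigD1 k) //= big_bool /= addrC big1 ?add0r 1?addrC // => k' kk'.
  rewrite big_bool /=.
  have bE c : (inr (k', c) : D) \notin ins_edge P k.
    by rewrite !inE !(inj_eq inr_inj) !xpair_eqE (negbTE kk').
  case: (boolP ((inr (k', true) : D) \in S)) => tS.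
    have := @component_flip GG _ x _ (bE true) tS; rewrite /= fl_inr /= => fS; rewrite fS.
    have [_ /(_ (bE true))] := pr _ tS; rewrite /= fl_inr /= => ->.
    by rewrite color_signN mulNr addrN.
  case: (boolP ((inr (k', false) : D) \in S)) => fS; last by rewrite addr0.
  by have := @component_flip GG _ x _ (bE false) fS; rewrite /= fl_inr /= (negbTE tS).
have flS : (fl x \in S) = @linked GG (ins_edge P k) x (fl x) by rewrite inE.
rewrite (bridge_ins xe) -flS /=.
have half_sum c : (sg c * (sg c * w k + sg c * w k)) / 2 = w k.
  by rewrite -mulrDr mulrA color_sign_sq mul1r -mulr2n -[w k *+ 2]mulr_natr mulfK ?pnatr_eq0.
case/ins_edgeP: xe xS => -> xS; rewrite fl_inr xS /=; case: ifPn => fS.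
- by move=> ->; rewrite (negbTE fS) addr0 mulrA color_sign_sq mul1r.
- by move: fS; rewrite negbK => ->; case=> -> ->.
- by move=> ->; rewrite (negbTE fS) add0r mulrA color_sign_sq mul1r.
by move: fS; rewrite negbK => ->; case=> -> ->.
Qed.

End VertexSums.
(** The conditions of [static_weight] which do not involve the value. *)
Definition static_data k : Prop := exists x col,
  [/\ x \in ins_edge P k, @proper_coloring GG (ins_edge P k) (@component GG (ins_edge P k) x) col &
      ~~ bridge (G := GG) (ins_edge P k) -> col (fl x) = col x].

Lemma static_data_weight (R : realType) (p : {set GG} -> R) k : static_data k ->
  exists v, static_weight p (ins_edge P k) v.
Proof.
move=> [x [col [xe pr nb]]]; set S := @component GG _ x in pr.
pose d := color_sum p S col (col x) - color_sum p S col (~~ col x).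
exists (if bridge (G := GG) (ins_edge P k) then d else d / 2); exists x, col.
by split=> //; case E: bridge nb => // nb; split=> //; exact: nb.
Qed.

Lemma weight_static_data (R : realType) (p : {set GG} -> R) k v :
  static_weight p (ins_edge P k) v -> static_data k.
Proof. by move=> [x [col [xe pr H]]]; exists x, col; split=> // nb; move: H; rewrite (negbTE nb) => -[]. Qed.

(** The system is square and injective: when all the excesses vanish, so do
    the weights, since they are determined by the vertex parameters. *)
Lemma flow_exists (R : realType) (Dv : 'I_h -> R) : (forall k, static_data k) ->
  exists w, ins_flow Dv w.
Proof.
move=> sd.
pose M : 'M[R]_h := \matrix_(k, i) \sum_(c : bool | pl (inr (k, c)) == i) color_sign R (co (inr (k, c))).
have ME (v : 'rV[R]_h) i : (v *m M) ord0 i =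
    \sum_(p : 'I_h * bool | pl (inr p) == i) color_sign R (co (inr p)) * v ord0 p.1.
  rewrite mxE (eq_bigr (fun p : 'I_h * bool => color_sign R (co (inr (p.1, p.2))) * v ord0 p.1)); last by move=> [].
  rewrite (eq_bigl (fun p : 'I_h * bool => xpredT p.1 && (pl (inr (p.1, p.2)) == i))); last by move=> [].
  rewrite -(pair_big_dep xpredT (fun k c => pl (inr (k, c)) == i) (fun k c => color_sign R (co (inr (k, c))) * v ord0 k)) /=.
  by apply: eq_bigr => k _; rewrite mxE mulr_sumr; apply: eq_bigr => c _; rewrite mulrC.
have uM : M \in unitmx.
  rewrite -row_free_unit; apply: inj_row_free => v v0.
  apply/rowP => k; rewrite mxE.
  have fv : ins_flow (fun _ => 0) (fun k => v ord0 k).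
    by move=> i; rewrite -ME v0 mxE.
  have [v' sv] := static_data_weight (ins_vertex_param (fun _ => 0 : R)) (sd k).
  have D0 i : \sum_(y | pc y == i) color_sign R (wh y) * dart_param (fun _ => 0 : R) y = 0.
    by apply: big1 => y _; rewrite /dart_param mul0r mulr0.
  have e1 := static_weight_flow D0 fv sv.
  rewrite -e1; case: sv => [x [col [_ _]]].
  by rewrite /color_sum !big1 // subrr; case: ifP => _ => [|[_]] ->; rewrite ?mul0r.
exists (fun k => ((\row_i Dv i) *m invmx M) ord0 k) => i.
by rewrite -ME mulmxKV // mxE.
Qed.

(** * Colorings and the cycle of a canonical insertion *)

Section Canonical.
Hypothesis crf : canonical pc wh rf.
Local Notation tau := (target pc wh rf).
Local Notation A := (tail_color pc wh rf).
Local Notation B := (head_color pc wh rf).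

Lemma pl_tail k : pl (a k) = k.
Proof. by have /forallP /(_ k) /eqP := crf. Qed.

Lemma place_tail k : place pc wh rf (a k) = (k, A k).
Proof. by rewrite /tail_color; have := pl_tail k; case: place => i c /= ->. Qed.

Lemma place_head k : place pc wh rf (b k) = (tau k, B k).
Proof. by rewrite /target /head_color; case: place. Qed.

Lemma flow_canonical (R : realType) (Dn : 'I_h -> nat) w :
  ins_flow (fun i => (Dn i)%:R : R) w <-> is_flow Dn tau A B w.
Proof.
suff E i : \sum_(p : 'I_h * bool | pl (inr p) == i) color_sign R (co (inr p)) * w p.1 =
    color_sign R (A i) * w i + \sum_(k | tau k == i) color_sign R (B k) * w k.
  by split=> H i; [rewrite -E; apply: H | rewrite E; apply: H].
rewrite big_mkcond (eq_bigr (fun p : 'I_h * bool => if pl (inr (p.1, p.2)) == i then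
   color_sign R (co (inr (p.1, p.2))) * w p.1 else 0)); last by move=> [].
rewrite -(pair_bigA _ (fun k c => if pl (inr (k, c)) == i then color_sign R (co (inr (k, c))) * w k else 0)) /=.
under eq_bigr do rewrite big_bool /= place_tail place_head /=.
rewrite big_split /= addrC -!big_mkcond /=; congr (_ + _).
by rewrite (big_pred1 i).
Qed.

Lemma connected_tau : is_connected GG <-> tau_connected tau.
Proof.
split=> [conn T tT /set0Pn [j jT]|conn x x'].
  apply/setP=> i; rewrite inE.
  have := @linked_ind GG set0 (fun z => pl z \in T) (a j) (a i) _ _ (conn _ _).
  rewrite !pl_tail; apply => // z.
    by rewrite placeR.
  case: z => [y|[k c]] _; rewrite /= ?fl_inl ?fl_inr.
    by rewrite !place_inlE /= pc_flip.
  by case: c; rewrite /= place_tail place_head /= tT.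
pose Q i := [forall z, (pl z == i) ==> @linked GG set0 x z].
have L0 z : (forall y, (inl y : D) \notin @set0 D) by move=> y; rewrite inE.
have QE z : Q (pl z) = @linked GG set0 x z.
  apply/forallP/idP => [/(_ z)|l z']; first by rewrite eqxx.
  apply/implyP => /eqP e; apply: linked_trans l _.
  by apply: (piece_linked) => // y; rewrite inE.
have TT : [set i | Q i] = setT.
  apply: conn; last by apply/set0Pn; exists (pl x); rewrite inE QE linked_refl.
  move=> k; rewrite !inE.
  have -> : tau k = pl (b k) by rewrite place_head.
  have {2}-> : k = pl (a k) by rewrite place_tail.
  rewrite !QE; apply/idP/idP => /linked_trans; apply.
    by have := @linked_flip GG set0 (b k); rewrite /= fl_inr inE; apply.
  by have := @linked_flip GG set0 (a k); rewrite /= fl_inr inE; apply.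
by rewrite -QE; have := in_setT (pl x'); rewrite -TT inE.
Qed.

Hypothesis conn : tau_connected tau.

Section Toward.
Variable k0 : 'I_h.

Definition reaches i := fconnect tau i k0.

Lemma reaches_iter i : reaches i -> exists n, iter n tau i == k0.
Proof. by move=> /iter_findex e; exists (findex tau i k0); rewrite e. Qed.

Definition steps i : nat :=
  match reaches i =P true with
  | ReflectT H => ex_minn (reaches_iter H)
  | ReflectF _ => 0
  end.

Lemma reaches_tau i : i != k0 -> reaches (tau i) = reaches i.
Proof.
move=> ik; apply/idP/idP => [|H]; first by apply: connect_trans; apply: fconnect1.
have [n] := reaches_iter H; case: n => [|n]; first by rewrite (negbTE ik).
by rewrite iterSr => /eqP e; rewrite /reaches -e; apply: fconnect_iter.
Qed.

Lemma stepsS i : i != k0 -> reaches i -> steps i = (steps (tau i)).+1.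
Proof.
move=> ik ri; have rt : reaches (tau i) by rewrite reaches_tau.
rewrite /steps; case: eqP => // H1; case: eqP => //.
move=> H2; case: ex_minnP => n; case: n => [|n] /= nE nm; first by rewrite (negbTE ik) in nE.
rewrite -iterS iterSr in nE.
case: ex_minnP => m mE mm; apply/eqP; rewrite eqSS eqn_leq mm // andbT.
by have := nm m.+1; rewrite iterSr; apply.
Qed.

(** Whether colors have to be exchanged in [i] in order that both ends of
    each of the next [n] edges have opposite colors, the last piece keeping
    its own. *)
Fixpoint transport n i : bool :=
  if n is n'.+1 then transport n' (tau i) (+) (A i == B i) else false.

(** A proper coloring of the pieces from which [k0] is reached, after the
    edge [k0] is deleted. *)
Definition upstream_coloring x : bool := co x (+) transport (steps (pl x)) (pl x).
Local Notation col := upstream_coloring.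

Lemma upstream_rot x : col (rf x) = col x.
Proof. by rewrite /upstream_coloring placeR. Qed.

Lemma upstream_flip x : x \notin ins_edge P k0 -> reaches (pl x) ->
  col (fl x) = ~~ col x /\ reaches (pl (fl x)).
Proof.
have E k : k != k0 -> reaches k -> col (b k) = ~~ col (a k).
  move=> kk rk; rewrite /upstream_coloring place_head place_tail /= (stepsS kk rk) /=.
  by case: (A k); case: (B k); case: transport.
case: x => [y _|[k c]].
  by rewrite /upstream_coloring fl_inl !place_inlE /= pc_flip wh_flip addNb.
rewrite !inE !(inj_eq inr_inj) !xpair_eqE => kc.
have kk : k != k0 by move: kc; case: eqP => //=; case: c.
rewrite fl_inr; case: c kc => _; rewrite /= ?place_head ?place_tail /= ?reaches_tau // => rk.
  by rewrite -/(a k) -/(b k) (E _ kk rk) negbK.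
by rewrite -/(b k) -/(a k) (E _ kk rk).
Qed.

Lemma upstream_component x : x \in @component GG (ins_edge P k0) (a k0) -> reaches (pl x).
Proof.
rewrite inE => l; apply: (@linked_ind GG _ (fun z => reaches (pl z))) l _.
- by move=> z; rewrite placeR.
- by move=> z zE rz; have [] := upstream_flip zE rz.
by rewrite place_tail; exact: connect0.
Qed.

Hypothesis odd_face : exists x, odd #|porbit (face_perm rf) x|.

(** If [k0] is on the cycle then every piece is upstream, and the ends of
    [k0] have equal colors: otherwise the whole graph would be bipartite,
    with all faces of even degree. *)
Lemma canonical_static_data : static_data k0.
Proof.
exists (a k0), col; split; first exact: set21.
  by move=> x xS; split; [exact: upstream_rot | move=> xE; have [] := upstream_flip xE (upstream_component xS)].
rewrite (bridge_ins (set21 _ _)) negbK fl_inr => l.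
have rb : reaches (tau k0) by have := upstream_component (x := b k0); rewrite inE place_head; apply.
have rT i : reaches i.
  have TT : [set i | reaches i] = setT.
    apply: conn; last by apply/set0Pn; exists k0; rewrite inE; exact: connect0.
    move=> k; rewrite !inE; case: (eqVneq k k0) => [->|kk]; last exact: reaches_tau.
    by rewrite rb; apply/esym; exact: connect0.
  by have := in_setT i; rewrite -TT inE.
apply/eqP/negPn/negP => nc.
have nc' : col (b k0) = ~~ col (a k0) by move: nc; case: (col (b _)); case: (col (a _)).
have colF x : col (fl x) = ~~ col x.
  have [/ins_edgeP [] ->|xE] := boolP (x \in ins_edge P k0).
  - by rewrite fl_inr.
  - by rewrite fl_inr -/(a k0) nc' negbK.
  by have [] := upstream_flip xE (rT _).
have [x] := odd_face; apply/negP; apply: (odd_orbit (col := col)) => z.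
by rewrite permM upstream_rot colF.
Qed.

End Toward.

Section StaticCycle.
Local Notation E := (ins_darts P h).

Lemma inl_ins (y : P) : (inl y : D) \notin E.
Proof. by apply/imsetP => -[]. Qed.

Lemma linked_pieces x x' : @linked GG E x x' = (pl x == pl x').
Proof.
apply/idP/eqP => [l|]; last exact: (piece_linked inl_ins).
suff : pl x' = pl x by move->.
apply: (@linked_ind GG E (fun z => pl z = pl x)) l erefl => [z|z zE].
  by rewrite placeR.
case: z zE => [y|k]; last by move/imsetP; case; exists k.
by move=> _; rewrite /= fl_inl !place_inlE /= pc_flip.
Qed.

Lemma edge_of_ins k c : @edge_of GG (inr (k, c)) = ins_edge P k.
Proof. by rewrite (@edge_ofE GG) /= fl_inr /ins_edge; case: c => //=; exact: setUC. Qed.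

Lemma ins_edge_inj : injective (fun k => ins_edge P k : {set D}).
Proof.
move=> k k' e; have : a k \in ins_edge P k' by rewrite -e set21.
by case/ins_edgeP => -[].
Qed.

Lemma pl_a k : pl (a k) = k. Proof. exact: pl_tail. Qed.

Definition cycle_edges : {set {set D}} := [set ins_edge P k | k : 'I_h & periodic tau k].

(** The rest of the cycle joins the two ends. *)
Lemma cycle_edges_nonbridge : {in cycle_edges, forall e, ~~ bridge (G := GG) e}.
Proof.
move=> e /imsetP [k]; rewrite inE => pk ->.
rewrite (bridge_ins (set22 _ _)) negbK fl_inr /=.
have piece x x' : pl x = pl x' -> @linked GG (ins_edge P k) x x'.
  by apply: (piece_linked) => y; rewrite !inE.
have H n j x : pl x = j -> iter n tau j = k -> @linked GG (ins_edge P k) x (a k).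
  elim: n j x => [|n IH] j x xj; first by move=> jk; apply: piece; rewrite pl_a xj.
  rewrite iterSr => nk; case: (eqVneq j k) => [jk|jk]; first by apply: piece; rewrite pl_a xj.
  have aN : a j \notin ins_edge P k.
    by apply/negP => /ins_edgeP [] [] ejk; rewrite ejk eqxx in jk.
  have l1 : @linked GG (ins_edge P k) x (a j) by apply: piece; rewrite pl_a.
  have := @linked_flip GG _ _ aN; rewrite /= fl_inr /= => l2.
  exact: linked_trans l1 (linked_trans l2 (IH (tau j) (b j) erefl nk)).
exact: H (erefl _) (iter_findex pk).
Qed.

(** The edges of a simple closed walk are as many as the pieces it visits,
    and each is the outgoing edge of one of them. So [tau] permutes these
    pieces. *)
Lemma static_cycle (i0 : 'I_h) (C' : {set {set GG}}) :
  contracted_cycle (G := GG) E C' <-> C' = cycle_edges.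
Proof.
split=> [[p [p0 pE cp pw ->]]|->]; last first.
  have [k pk _] := exists_periodic tau i0.
  exists [seq a j | j <- fingraph.orbit tau k]; split.
  - by rewrite -size_eq0 size_map fingraph.size_orbit -lt0n fingraph.order_gt0.
  - by move=> x /mapP [j _ ->]; apply: imset_f.
  - rewrite cycle_map; apply: sub_cycle (fcycle_periodic pk) => j j' /eqP <-.
    by rewrite /= linked_pieces pl_a fl_inr.
  - rewrite pairwise_map; have := fingraph.orbit_uniq tau k; rewrite uniq_pairwise.
    apply: sub_pairwise => j j' /= jj; rewrite linked_pieces !pl_a jj !edge_of_ins.
    by apply: contraNneq jj => /ins_edge_inj ->.
  apply/setP=> e; rewrite inE; apply/imsetP/mapP => [[j]|[x /mapP [j jo ->] ->]].
    rewrite inE => pj ->; exists (a j); last by rewrite edge_of_ins.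
    by apply: map_f; rewrite orbit_periodic.
  by exists j; rewrite ?edge_of_ins // inE -(orbit_periodic conn j pk).
pose idx x : 'I_h := if x is inr (k, _) then k else i0.
have pins x : x \in p -> x = a (idx x) \/ x = b (idx x).
  by move=> /pE /imsetP [[k c] _ ->]; case: c; [right|left].
have edgeE x : x \in p -> @edge_of GG x = ins_edge P (idx x).
  by move=> /pins [] ->; rewrite edge_of_ins.
have uS : uniq (map pl p).
  rewrite uniq_pairwise pairwise_map; apply: sub_pairwise pw => x y /=.
  by rewrite linked_pieces => /andP[].
have uI : uniq (map idx p).
  rewrite uniq_pairwise pairwise_map.
  apply: (@sub_in_pairwise _ (mem p) _ _ _ p _ pw); last by apply/allP.
  move=> x z xp zp /= /andP[_]; rewrite !edgeE //.
  by case: (eqVneq (idx x) (idx z)) => // ->; rewrite eqxx.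
(* An edge of the walk ends where the next one starts. *)
have tgt : perm_eq (map (fun x => pl (fl x)) p) (map pl p).
  clear uI uS edgeE pins pE; case: p p0 cp pw => // x s _ /= cp _.
  suff H (y : D) t : path (fun x y : D => @linked GG E (flip GG x) y) y t ->
      map (fun x => pl (fl x)) (belast y t) = map pl t.
    have := H _ _ cp; rewrite belast_rcons /= => ->.
    by rewrite map_rcons perm_rcons.
  elim: t y => //= z t IH y /andP[/= l pt]; rewrite IH //; congr cons.
  by apply/eqP; rewrite -linked_pieces.
have uT : uniq (map (fun x => pl (fl x)) p) by rewrite (perm_uniq tgt).
have S_inj := uniq_map_inj uS; have T_inj := uniq_map_inj uT.
have subIS : {subset map idx p <= map pl p}.
  move=> k /mapP [x xp ->]; case: (pins x xp) => xe.
    by rewrite -[idx x]pl_a -xe; apply: (map_f pl).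
  rewrite -(perm_mem tgt); apply/mapP; exists x => //.
  by rewrite xe fl_inr [RHS]pl_a {2}xe.
have [_ IS] := uniq_min_size uI subIS (eq_leq (etrans (size_map _ _) (esym (size_map _ _)))).
pose K : {set 'I_h} := [set k in map idx p].
have KP k : k \in K -> a k \in p \/ b k \in p.
  by rewrite inE => /mapP [x xp ->]; case: (pins x xp) => <-; [left|right].
have Kt : {in K, forall k, tau k \in K}.
  move=> k /KP [] kp; rewrite inE IS.
    rewrite -(perm_mem tgt); apply/mapP; exists (a k) => //; by rewrite fl_inr.
  by apply/mapP; exists (b k).
(* The walk cannot change between following the orientation of the edges and
   going against it. *)
have Ki : {in K &, injective tau}.
  move=> j k jK kK e; have vK := Kt _ jK.
  have tA i : pl (fl (a i)) = tau i by rewrite fl_inr.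
  have tB i : pl (fl (b i)) = i by rewrite fl_inr; exact: pl_a.
  have mixed i i' : a i \in p -> b i' \in p -> tau i = tau i' -> tau i \in K -> False.
    move=> ip ip' ee /KP [vp|vp].
      have : a (tau i) = b i' by apply: S_inj => //; rewrite pl_a ee.
      by case.
    have : b (tau i) = a i by apply: T_inj => //; rewrite tB tA.
    by case.
  case: (KP _ jK) => jp; case: (KP _ kK) => kp.
  - have : a j = a k by apply: T_inj => //; rewrite !tA.
    by case.
  - by case: (mixed _ _ jp kp e vK).
  - by rewrite e in vK; case: (mixed _ _ kp jp (esym e) vK).
  have : b j = b k by apply: S_inj => //; exact: e.
  by case.
have K0 : K != set0.
  have [x xp] : exists x, x \in p by case: (p) p0 => // x s _; exists x; rewrite mem_head.
  by apply/set0Pn; exists (idx x); rewrite inE map_f.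
have KE := injective_invariant conn K0 Kt Ki.
apply/setP=> e; rewrite inE; apply/mapP/imsetP => [[x xp ->]|[k]].
  by exists (idx x); rewrite ?edgeE // inE -KE inE map_f.
by rewrite inE -KE inE => /mapP [x xp ->] ->; exists x; rewrite ?edgeE.
Qed.

End StaticCycle.

End Canonical.

(** * Degenerating edges *)

Section Zero.
Variables (R : realType) (q : {set P} -> R).
Local Notation sg := (color_sign R).
Local Notation beta := (dart_param q).
Hypothesis q_sum : forall i, \sum_(y | pc y == i) sg (wh y) * beta y = 0.

(** The other pieces are balanced and contribute nothing. When the edge is a
    bridge of the piece but not of the whole graph, the two parts of the
    piece are colored as in the piece, except that the colors of one part
    are exchanged. The difference of their contributions is then zero, and
    so is the sum, hence each of them. *)
Lemma piece_edge_null (e0 : {set P}) : e0 \in edges P ->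
  static_weight (ins_vertex_param q) (inl @: e0 : {set GG}) 0 -> static_weight q e0 0.
Proof.
set e : {set GG} := inl @: e0.
move=> e0E [x [col [xe pr H]]].
have [x0 x0e xE] := imsetP xe; subst x.
have e0x : e0 = [set x0; flip P x0].
  rewrite -edge_ofE; have /imsetP [z _ e0z] := e0E; rewrite /edge_of.
  by move: x0e; rewrite e0z -eq_porbit_mem => /eqP.
have cl0 : flip_closed e0.
  by move=> v; rewrite e0x => /set2P [] ->; rewrite ?flipK ?set21 ?set22.
have inle (v : P) : ((inl v : D) \in e) = (v \in e0).
  by rewrite mem_imset // => u u' [].
have cl : flip_closed e.
  by move=> z /imsetP [v ve ->]; rewrite /= fl_inl inle cl0.
set S := @component GG e (inl x0) in pr H.
pose i := pc x0.
have pcl u v (E : {set P}) : @linked P E u v -> pc v = pc u.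
  by move=> l; apply: (@linked_ind P E (fun z => pc z = pc u)) l erefl => [z|z _]; rewrite ?pc_rot ?pc_flip.
pose SP := [set v | (inl v : D) \in S].
have linkP u v : linked e0 u v -> @linked GG e (inl u) (inl v).
  by apply: linked_inl => // w; rewrite inle.
have SPl u v : u \in SP -> linked e0 u v -> v \in SP.
  by rewrite !inE => lu /linkP; apply: linked_trans.
have x0S : x0 \in SP by rewrite !inE linked_refl.
have clS z : z \in S -> rf z \in S by apply: (@component_rot GG).
pose col' (v : P) := col (inl v).
have pr' : proper_coloring e0 SP col'.
  move=> v vS; have vS' : (inl v : D) \in S by rewrite inE in vS.
  split; last by move=> ve; have [_] := pr _ vS'; rewrite inle ve /= fl_inl; apply.
  apply: (coloring_porbit clS pr vS' _).2.
  by rewrite inl_porbit mem_porbit1 porbit_id.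
have prwh (E : {set P}) T : @proper_coloring P E T wh by move=> v _; rewrite wh_rot wh_flip.
have uniq u v : u \in SP -> linked e0 u v -> col' v (+) wh v = col' u (+) wh u.
  move=> uS; apply: proper_coloring_uniq pr' (prwh _ _) => w; rewrite inE.
  exact: SPl.
have sum0 : \sum_(v in SP) sg (col' v) * beta v = 0.
  have E : sg (col (inl x0)) * \sum_(z in S) sg (col z) * ins_dart_param q z = 0.
    rewrite -(color_diff _ (ins_dart_param_sum q)); last first.
      by move=> z zS; split; [exact: clS | have [] := pr _ zS].
    move: H; case: ifP => _ => [<- //|[_]] /esym/eqP.
    by rewrite mulf_eq0 invr_eq0 pnatr_eq0 orbF => /eqP.
  have {}E : \sum_(z in S) sg (col z) * ins_dart_param q z = 0.
    by rewrite -[LHS]mul1r -(color_sign_sq R (col (inl x0))) -mulrA E mulr0.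
  rewrite -[RHS]E big_sumType /= [X in _ = _ + X]big1 ?addr0; last by move=> p _; rewrite mulr0.
  by apply: eq_bigl => v; rewrite inE.
have {}sum0 : \sum_(v in SP | pc v == i) sg (col' v) * beta v = 0.
  move: sum0; rewrite (bigID (fun v => pc v == i)) /= [X in _ + X](_ : _ = 0) ?addr0 //.
  rewrite (partition_big pc (fun j => j != i)) /=; last by move=> v /andP[].
  apply: big1 => j ji.
  have [/existsP [u /andP[uS /eqP uj]]|none] := boolP [exists u in SP, pc u == j]; last first.
    apply: big_pred0 => v; apply/negP => /andP[/andP[vS _] vj].
    by case/existsP: none; exists v; rewrite vS vj.
  have H1 v : pc v = j -> linked e0 u v.
    move=> vj; have l : linked set0 u v by apply: piece_conn; rewrite vj.
    suff: linked e0 u v /\ pc v = j by case.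
    apply: (@linked_ind P set0 (fun z => linked e0 u z /\ pc z = j)) l _ => [z|z _|]; last by split; [exact: linked_refl|].
      by move=> [lz zj]; split; rewrite ?pc_rot //; apply: linked_trans lz (linked_rot _ _).
    move=> [lz zj]; split; rewrite ?pc_flip //; apply: linked_trans lz (linked_flip _).
    apply: contraNN ji; rewrite e0x -zj => /set2P [] ->; by rewrite ?pc_flip /i.
  transitivity (sg (~~ (col' u (+) wh u)) * \sum_(v | pc v == j) sg (wh v) * beta v); last by rewrite q_sum mulr0.
  rewrite mulr_sumr; apply: eq_big => [v|v /andP[/andP[vS _] /eqP vj]].
    case: (pc v =P j) => [vj|]; rewrite ?andbF // vj ji !andbT.
    exact: SPl uS (H1 _ vj).
  by rewrite mulrA -color_sign_addb -(uniq _ _ uS (H1 _ vj)) -addbA addbb addbF.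
(* Deleting the edge leaves at most two parts of its piece. *)
have cover v : pc v = i -> linked e0 x0 v \/ linked e0 (flip P x0) v.
  move=> vi; have l : linked set0 x0 v by apply: piece_conn; rewrite vi.
  apply: (@linked_ind P set0 (fun z => linked e0 x0 z \/ linked e0 (flip P x0) z)) l _ => [z|z _|].
  - by case=> lz; [left|right]; apply: linked_trans lz (linked_rot _ _).
  - have [|ze] := boolP (z \in e0).
      by rewrite e0x => /set2P [] -> _; rewrite ?flipK; [right|left]; exact: linked_refl.
    by case=> lz; [left|right]; apply: linked_trans lz (linked_flip ze).
  by left; exact: linked_refl.
have brP : bridge e0 = ~~ linked e0 x0 (flip P x0).
  apply/existsP/idP => [[z /andP[ze]]|nl]; last by exists x0; rewrite x0e.
  by apply: contraNN; move: ze; rewrite e0x => /set2P [] ->; rewrite ?flipK -?e0x // => /(linked_sym cl0).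
have brG : bridge e = ~~ @linked GG e (inl x0) (inl (flip P x0)).
  apply/existsP/idP => [[z /andP[ze]]|nl]; last by exists (inl x0); rewrite inle x0e /= fl_inl.
  have [z0 z0e ->] := imsetP ze.
  apply: contraNN; move: z0e; rewrite {1}e0x => /set2P [] ->; rewrite /= !fl_inl ?flipK // => /(linked_sym cl).
  done.
(* If the edge were not a bridge of its piece, its ends would have different
   colors in any coloring of the rest; but the weight of an edge that is not
   a bridge requires equal colors. *)
have b0 : bridge e0.
  rewrite brP; apply/negP => l; move: H; rewrite brG (linkP _ _ l) /= => -[].
  have := uniq _ _ x0S l; rewrite /col' wh_flip fl_inl => e1 e2 _; move: e1; rewrite e2.
  by case: (col _); case: (wh _).
exists x0, col'; split=> //.
  move=> v; rewrite inE => l; apply: pr'; exact: SPl x0S l.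
rewrite b0 (color_diff _ (@dart_param_sum R q)); last first.
  move=> v; rewrite !inE => l; split; first exact: linked_trans l (linked_rot _ _).
  by have [] := pr' v (SPl _ _ x0S l).
suff -> : \sum_(v in component e0 x0) sg (col' v) * beta v = 0 by rewrite mulr0.
have nl0 : ~~ linked e0 x0 (flip P x0) by rewrite -brP.
have dis v : linked e0 x0 v -> linked e0 (flip P x0) v -> False.
  move=> l1 l2; case/negP: nl0; apply: linked_trans l1 _; exact: linked_sym.
set s0 := \sum_(v in component e0 x0) _.
have [nG|lG] := boolP (bridge e).
  rewrite -sum0 /s0; apply: eq_bigl => v; rewrite inE; apply/idP/andP => [l|[vS /eqP vi]].
    by rewrite (SPl _ _ x0S l) (pcl _ _ _ l) eqxx.
  case: (cover v vi) => // l; move: nG; rewrite brG => /negP; case.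
  rewrite inE inE in vS; apply: linked_trans vS _; apply: (linked_sym cl); exact: linkP.
have fxS : flip P x0 \in SP by rewrite !inE; move: lG; rewrite brG negbK.
have c_fx : col' (flip P x0) = col' x0 by move: H; rewrite (negbTE lG) /= fl_inl => -[].
have SPi v : (v \in SP) && (pc v == i) = (pc v == i).
  case: eqP => [vi|]; rewrite ?andbF // andbT.
  by case: (cover v vi) => l; [exact: SPl x0S l | exact: SPl fxS l].
rewrite (eq_bigl _ _ SPi) (bigID (fun v => linked e0 x0 v)) /= in sum0.
have E1 (F : P -> R) : \sum_(v | (pc v == i) && linked e0 x0 v) F v = \sum_(v in component e0 x0) F v.
  by apply: eq_bigl => v; rewrite inE; case l: (linked e0 x0 v); rewrite ?andbF // (pcl _ _ _ l) eqxx.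
have := q_sum i; rewrite (bigID (fun v => linked e0 x0 v)) /= E1 => qs.
rewrite E1 -/s0 in sum0.
have s0E : s0 = sg (~~ (col' x0 (+) wh x0)) * \sum_(v in component e0 x0) sg (wh v) * beta v.
  rewrite mulr_sumr; apply: eq_bigr => v; rewrite inE => l.
  by rewrite mulrA -color_sign_addb -(uniq _ _ x0S l) -addbA addbb addbF.
have s1E : \sum_(v | (pc v == i) && ~~ linked e0 x0 v) sg (col' v) * beta v =
   - sg (~~ (col' x0 (+) wh x0)) * \sum_(v | (pc v == i) && ~~ linked e0 x0 v) sg (wh v) * beta v.
  rewrite mulr_sumr; apply: eq_bigr => v /andP[/eqP vi nl].
  have l : linked e0 (flip P x0) v by case: (cover v vi) => // l; rewrite l in nl.
  have := uniq _ _ fxS l; rewrite c_fx wh_flip /color_sign.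
  by case: (col' v); case: (col' x0); case: (wh v); case: (wh x0) => //= _; ring.
have double0 (z u v : R) : z * u + - z * v = 0 -> u + v = 0 -> z * u = 0.
  move=> e1 /eqP; rewrite addrC addr_eq0 => /eqP e2; move: e1; rewrite e2 mulrNN => /eqP.
  by rewrite -mulr2n mulrn_eq0 /= => /eqP.
by rewrite s0E s1E in sum0; rewrite s0E; apply: double0 sum0 qs.
Qed.

End Zero.

Section Degenerating.
Variables (R : realType) (q : R -> {set P} -> R) (q0 : {set P} -> R) (Dn : 'I_h -> nat).
Local Notation sg := (color_sign R).
Hypothesis q_flow : forall t, 0 <= t <= 1 -> forall i,
  \sum_(y | pc y == i) sg (wh y) * dart_param (q t) y = t * (Dn i)%:R.
Hypothesis q0_sum : forall i, \sum_(y | pc y == i) sg (wh y) * dart_param q0 y = 0.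
Hypothesis q_lim : forall v, (q t v @[t --> 0^'+] --> q0 v)%classic.

Local Notation param := (fun t : R => ins_vertex_param (q t)).

Lemma cvg_bigsum (I : Type) (s : seq I) (Q : pred I) (F : R -> I -> R) (l : I -> R) :
  (forall i, (F t i @[t --> 0^'+] --> l i)%classic) ->
  (\sum_(i <- s | Q i) F t i @[t --> 0^'+] --> \sum_(i <- s | Q i) l i)%classic.
Proof.
move=> H; elim: s => [|i s IH].
  rewrite big_nil; apply: (@cvg_trans _ ((fun=> 0 : R) @ 0^'+)%classic); last exact: cvg_cst.
  by apply: near_eq_cvg; near=> t; rewrite big_nil.
rewrite big_cons; case: ifP => Qi.
  apply: (@cvg_trans _ ((fun t => F t i + \sum_(j <- s | Q j) F t j) @ 0^'+)%classic); last exact: cvgD.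
  by apply: near_eq_cvg; near=> t; rewrite big_cons Qi.
apply: cvg_trans IH; by apply: near_eq_cvg; near=> t; rewrite big_cons Qi.
Unshelve. all: by end_near.
Qed.

Definition weight_value (p : {set GG} -> R) (e S : {set GG}) col (c : bool) : R :=
  let d := color_sum p S col c - color_sum p S col (~~ c) in
  if bridge e then d else d / 2.

Lemma weight_value_lim e S col c :
  (weight_value (param t) e S col c @[t --> 0^'+] -->
    weight_value (ins_vertex_param q0) e S col c)%classic.
Proof.
have L c' : (color_sum (param t) S col c' @[t --> 0^'+] -->
    color_sum (ins_vertex_param q0) S col c')%classic.
  by apply: cvg_bigsum => v; exact: q_lim.
rewrite /weight_value; case: bridge; first exact: cvgB.
by apply: cvgM; [exact: cvgB | exact: cvg_cst].
Qed.

(** For each [t] the weight is one of finitely many expressions in the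
    vertex parameters, given by an end and a coloring. If none of them
    vanished at the limit, the weight would stay away from 0. *)
Lemma degenerating_limit (e : {set GG}) : degenerating param e ->
  static_weight (ins_vertex_param q0) e 0.
Proof.
move=> [_ [w ws wl]].
pose val (p : GG * {ffun GG -> bool}) (m : {set GG} -> R) :=
  weight_value m e (component e p.1) p.2 (p.2 p.1).
pose ok (p : GG * {ffun GG -> bool}) := [/\ p.1 \in e,
  proper_coloring e (component e p.1) p.2 & ~~ bridge e -> p.2 (flip GG p.1) = p.2 p.1].
have weightE m v : static_weight m e v <-> exists2 p, ok p & v = val p m.
  split=> [[x [col [xe pr H]]]|[[x f] [/= xe pr nb] vE]].
    have fE z : [ffun z => col z] z = col z by rewrite ffunE.
    exists (x, [ffun z => col z]).
      split=> //= [z zS|nb]; rewrite !fE; first exact: pr.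
      by move: H; rewrite (negbTE nb) => -[].
    have cE c : color_sum m (component e x) [ffun z => col z] c = color_sum m (component e x) col c.
      apply: eq_bigl => u; rewrite (_ : [set z in component e x | [ffun z => col z] z == c] =
        [set z in component e x | col z == c]) //.
      by apply/setP=> z; rewrite !inE ffunE.
    rewrite /val /weight_value /= fE !cE; move: H; case: bridge => //.
    by case.
  exists x, f; split=> //; rewrite vE /val /weight_value /=; case E: bridge nb => // nb.
  by split=> //; exact: nb.
apply/weightE; apply: contrapT => none.
have nz p : ok p -> val p (ins_vertex_param q0) != 0.
  by move=> okp; apply/eqP => v0; apply: none; exists p.
have : \forall t \near (0^'+)%classic, forall p, ok p -> val p (param t) - w t != 0.
  apply: filter_forall => p; have [okp|nok] := pselect (ok p); last by near=> t => /nok.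
  near=> t => _; near: t.
  apply: (@cvgr_neq0 _ _ _ _ _ (fun t => val p (param t) - w t) (val p (ins_vertex_param q0) - 0)); last by rewrite subr0; exact: nz.
  apply: cvgB => //; exact: weight_value_lim.
move=> N; suff F : \forall t \near (0 : R)^'+%classic, False by have [] := filter_ex F.
near=> t; have t01 : 0 < t <= 1.
  apply/andP; split; first by near: t; exact: nbhs_right_gt.
  by near: t; apply: nbhs_right_le.
have /weightE [p okp E] := ws t t01.
have /(_ p okp) : forall p, ok p -> val p (param t) - w t != 0 by near: t.
by rewrite E subrr eqxx.
Unshelve. all: by end_near.
Qed.

Definition null_edge (e : {set GG}) : Prop := exists2 e0 : {set P}, e0 \in edges P &
  e = (inl @: e0)%SET /\ static_weight q0 e0 0.

Lemma flow_scale t w : ins_flow (fun i => (Dn i)%:R : R) w ->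
  ins_flow (fun i => t * (Dn i)%:R) (fun k => t * w k).
Proof.
by move=> fw i; rewrite -fw mulr_sumr; apply: eq_bigr => p _; rewrite mulrCA.
Qed.

(** The excess of each piece is proportional to [t], and therefore also the
    weights are. *)
Lemma ins_weight_flow t k w v : 0 <= t <= 1 -> ins_flow (fun i => (Dn i)%:R : R) w ->
  static_weight (param t) (ins_edge P k) v -> v = t * w k.
Proof.
move=> t01 fw sw.
exact: (static_weight_flow (q_flow t01) (flow_scale t fw) sw).
Qed.

Lemma static_positive_flow : (forall k, degenerating param (ins_edge P k)) ->
  (forall k (t v : R), 0 < t <= 1 -> static_weight (param t) (ins_edge P k) v -> 0 < v) ->
  exists2 w, ins_flow (fun i => (Dn i)%:R : R) w & forall k, 0 < w k.
Proof.
move=> dg pos; have t1 : 0 < (1 : R) <= 1 by rewrite ltr01 lexx.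
have sw k : exists v, static_weight (param 1) (ins_edge P k) v.
  by have [_ [w ws _]] := dg k; exists (w 1); exact: (ws 1 t1).
have [w fw] := flow_exists (fun i => (Dn i)%:R : R)
   (fun k => let: ex_intro v H := sw k in weight_static_data H).
exists w => // k; have [v sv] := sw k; have := pos _ _ _ t1 sv.
have t1' : 0 <= (1 : R) <= 1 by rewrite ler01 lexx.
by rewrite (ins_weight_flow t1' fw sv) mul1r.
Qed.

Lemma edge_ins_or_piece (e : {set GG}) : e \in edges GG ->
  (exists k, e = ins_edge P k) \/ exists2 e0 : {set P}, e0 \in edges P & e = (inl @: e0)%SET.
Proof.
move=> /imsetP [x _ ->]; rewrite -/(edge_of x) (@edge_ofE GG).
case: x => [y|[k c]]; [right|left].
  exists (edge_of y); first exact: imset_f.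
  by rewrite edge_ofE imsetU !imset_set1 /= fl_inl.
exists k; rewrite /= fl_inr /ins_edge; case: c => //=; exact: setUC.
Qed.

Lemma flow_degenerating w k : (forall k, static_data k) ->
  ins_flow (fun i => (Dn i)%:R : R) w -> degenerating param (ins_edge P k).
Proof.
move=> sd fw; split; first by have [x [col [_ pr _]]] := sd k; exists x, col.
exists (fun t => t * w k).
  move=> t /andP[t0 t1]; have [v sv] := static_data_weight (param t) (sd k).
  by rewrite -(ins_weight_flow _ fw sv) // ltW.
rewrite -[X in (_ --> X)%classic](mul0r (w k)); apply: cvgM; last exact: cvg_cst.
apply: cvg_at_right_filter; exact: cvg_id.
Qed.

(** An edge of a piece that degenerates has weight 0 at the limit point,
    hence is null in the piece by [piece_edge_null]. *)
Lemma degenerating_edges w : (forall k, static_data k) ->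
  ins_flow (fun i => (Dn i)%:R : R) w ->
  {in edges GG, forall e, (exists k, e = ins_edge P k) <-> degenerating param e /\ ~ null_edge e}.
Proof.
move=> sd fw e eE; split=> [[k ->]|[dg nn]].
  split; first exact: flow_degenerating fw.
  move=> [e0 _ [E _]]; have : tail_dart P k \in (inl @: e0 : {set D}) by rewrite -E set21.
  by case/imsetP.
case: (edge_ins_or_piece eE) => // -[e0 e0E E]; case: nn; exists e0 => //; split=> //.
apply: (piece_edge_null q0_sum e0E).
by rewrite -E; apply: degenerating_limit.
Qed.

End Degenerating.
End Weights.

(** * Relabelling the inserted edges *)

Section Descent.
Variables (I : finType) (e : rel I) (root : I).
Hypothesis to_root : forall i, connect e i root.

(** The distance is the length of a shortest path to the root; [lvl n]
    consists of the points at distance at most [n]. *)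
Lemma descent : exists dist : I -> nat,
  forall i, i != root -> exists2 j, e i j & (dist j < dist i)%N.
Proof.
pose lvl := fix lvl n : {set I} :=
  if n is n'.+1 then lvl n' :|: [set i | [exists j in lvl n', e i j]] else [set root].
have ex i : exists n, i \in lvl n.
  have /connectP [p pp rE] := to_root i; exists (size p).
  elim: p i pp rE => [|j p IH] i /= => [_ ->|/andP[eij pp] rE]; first by rewrite inE.
  by rewrite !inE; apply/orP; right; apply/existsP; exists j; rewrite IH.
exists (fun i => ex_minn (ex i)) => i ir.
case: (ex_minnP (ex i)) => -[|n] iL mn; first by move: iL; rewrite inE (negbTE ir).
move: iL; rewrite /= inE => /orP[iL|]; first by have := mn _ iL; rewrite ltnn.
rewrite inE => /existsP [j /andP[jL eij]]; exists j => //.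
by case: (ex_minnP (ex j)) => m _ /(_ _ jL).
Qed.

End Descent.

Section Relabel.
Variables (P : ribbon_graph) (h : nat) (pc : P -> 'I_h) (wh : P -> bool).
Hypotheses (pc_rot : forall y, pc (Defs.rot P y) = pc y) (pc_flip : forall y, pc (flip P y) = pc y).
Hypothesis wh_rot : forall y, wh (Defs.rot P y) = wh y.
Variables (R : realType) (Dn : 'I_h -> nat) (d1 d2 : nat).

Local Notation D := (ins_dart P h).
Local Notation fl := (ins_flip P h).
Local Notation a := (@tail_dart P h).
Local Notation b := (@head_dart P h).
Implicit Types (r rf : {perm D}) (x : D) (k j : 'I_h).

Definition relabels (p : {perm D}) r r' : Prop :=
  [/\ forall y : P, p (inl y) = inl y, forall x, p (fl x) = fl (p x) &
      forall x, p (r x) = r' (p x)].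

Lemma same_insertionP r r' : reflect (exists p, relabels p r r') (same_insertion r r').
Proof.
apply: (iffP existsP) => -[p].
  case/and3P=> /forallP H1 /forallP H2 /forallP H3; exists p.
  by split=> x; apply/eqP.
by case=> H1 H2 H3; exists p; apply/and3P; split; apply/forallP => x; apply/eqP.
Qed.

Lemma relabels_id r : relabels 1%g r r.
Proof. by split=> x; rewrite ?perm1. Qed.

Lemma relabelsV p r r' : relabels p r r' -> relabels (p^-1)%g r' r.
Proof.
case=> H1 H2 H3; split=> x; apply: (@perm_inj _ p); rewrite ?permKV ?H1 //.
  by rewrite H2 permKV.
by rewrite H3 permKV.
Qed.

Lemma relabelsM p p' r r' r'' : relabels p r r' -> relabels p' r' r'' -> relabels (p * p')%g r r''.
Proof.
case=> H1 H2 H3 [K1 K2 K3]; split=> x; rewrite !permM ?H1 ?K1 //.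
  by rewrite H2 K2.
by rewrite H3 K3.
Qed.

Lemma relabels_conj (p : {perm D}) r : (forall y : P, p (inl y) = inl y) ->
  (forall x, p (fl x) = fl (p x)) -> relabels p r (p^-1 * r * p)%g.
Proof. by move=> H1 H2; split=> // x; rewrite !permM permK. Qed.

Lemma same_insertion_equiv : equivalence_rel (@same_insertion P h).
Proof.
move=> r1 r2 r3; split; first by apply/same_insertionP; exists 1%g; exact: relabels_id.
move=> /same_insertionP [p rp]; apply/same_insertionP/same_insertionP => -[p' rp'].
  by exists (p^-1 * p')%g; apply: relabelsM rp'; apply: relabelsV.
by exists (p * p')%g; apply: relabelsM rp'.
Qed.

Section Transfer.
Variables (p : {perm D}) (r r' : {perm D}).
Hypothesis rp : relabels p r r'.

Lemma relabel_iter n x : p (iter n r x) = iter n r' (p x).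
Proof. by elim: n => //= n <-; have [_ _ ->] := rp. Qed.

Lemma relabel_ins k c : exists k' c', p (inr (k, c)) = inr (k', c').
Proof.
case E: (p (inr (k, c))) => [y|[k' c']]; last by exists k', c'.
by have [H1 _ _] := rp; move: E; rewrite -(H1 y) => /perm_inj.
Qed.

Lemma relabel_porbit x z : z \in porbit r x -> p z \in porbit r' (p x).
Proof. by move=> /porbitP [i ->]; rewrite permX relabel_iter -permX mem_porbit. Qed.

Lemma relabel_insertion : insertion r -> insertion r'.
Proof.
move=> /insertionP [att it]; have [H1 _ _] := rp; apply/insertionP; split=> [k|y].
  case E: ((p^-1)%g (inr k)) => [y|k'].
    by have := congr1 p E; rewrite permKV H1.
  have [x xr] := att k'; exists x.
  by rewrite -H1 -[inr k](permKV p) E; apply: relabel_porbit.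
have [n [e H]] := it y; exists n; rewrite -(H1 y) -relabel_iter e H1; split=> // j jn.
rewrite -relabel_iter; have /imsetP [[k c] _ ->] := H j jn.
by have [k' [c' ->]] := relabel_ins k c; apply: imset_f.
Qed.

Hypothesis ir : insertion r.

Lemma relabel_place x : place pc wh r' (p x) = place pc wh r x.
Proof.
have [y yx ->] := attached pc_rot wh_rot ir x.
apply: (place_porbit pc_rot wh_rot (relabel_insertion ir)).
by have [<- _ _] := rp; apply: relabel_porbit.
Qed.

Lemma relabel_connected : is_connected (ins_graph r) -> is_connected (ins_graph r').
Proof.
move=> conn x x'; rewrite -[x](permKV p) -[x'](permKV p).
have [_ H2 H3] := rp; set z := _ x; set z' := _ x'.
apply: (@linked_ind (ins_graph r) set0 (fun u => @linked (ins_graph r') set0 (p z) (p u)) z z');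
  [| |exact: conn|exact: linked_refl].
  by move=> u l; rewrite /= H3; apply: linked_trans l (@linked_rot (ins_graph r') _ _).
move=> u _ l; rewrite /= H2; apply: linked_trans l (@linked_flip (ins_graph r') _ _ _).
by rewrite inE.
Qed.

Lemma relabel_face x : porbit (face_perm r') (p x) = p @: porbit (face_perm r) x.
Proof.
have [_ H2 H3] := rp.
have E n : (face_perm r' ^+ n)%g (p x) = p ((face_perm r ^+ n)%g x).
  by elim: n => [|n IH]; rewrite ?expg0 ?perm1 // !expgSr !permM IH -H2 -H3.
apply/setP=> z; apply/porbitP/imsetP => [[i ->]|[u /porbitP [i ->] ->]].
  by exists ((face_perm r ^+ i)%g x); rewrite ?mem_porbit ?E.
by exists i; rewrite E.
Qed.

Lemma relabel_faces_ok : faces_ok d1 d2 r -> faces_ok d1 d2 r'.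
Proof.
move=> /existsP [f1 /existsP [f2 /and4P[nf /eqP E /eqP c1 /eqP c2]]].
have pi : injective (fun A : {set D} => p @: A) by apply: imset_inj; exact: perm_inj.
apply/existsP; exists (p @: f1); apply/existsP; exists (p @: f2).
rewrite (inj_eq pi) nf !(card_imset _ (@perm_inj _ p)) c1 c2 !eqxx !andbT /=.
have -> : porbits (face_perm r') = (fun A : {set D} => p @: A) @: porbits (face_perm r).
  apply/setP=> A; apply/imsetP/imsetP => [[x _ ->]|[B /imsetP [x _ ->] ->]].
    exists (porbit (face_perm r) ((p^-1)%g x)); first exact: imset_f.
    by rewrite -relabel_face permKV.
  by exists (p x) => //; rewrite relabel_face.
by rewrite E imsetU !imset_set1.
Qed.

Lemma sum_ins (Q : pred D) (F : D -> R) :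
  \sum_(q : 'I_h * bool | Q (inr q)) F (inr q) = \sum_(x in edge_darts P setT | Q x) F x.
Proof.
rewrite [RHS]big_sumType /= [X in _ = X + _]big_pred0 ?add0r; last by move=> y; rewrite inE.
by apply: eq_bigl => -[k c]; rewrite inr_dts in_setT.
Qed.

Definition positive_flow r : Prop :=
  exists2 w, ins_flow pc wh r (fun i => (Dn i)%:R : R) w & forall k, 0 < w k.

Lemma relabel_flow : positive_flow r -> positive_flow r'.
Proof.
move=> [w fw w0]; have rV := relabelsV rp; have [H1 H2 H3] := rp.
pose ix x : option 'I_h := if x is inr (k, _) then Some k else None.
have ix_flip x : ix (fl x) = ix x by case: x => [y|[k c]]; rewrite ?fl_inl ?fl_inr.
pose w' j := if ix ((p^-1)%g (a j)) is Some k then w k else 1.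
pose om (v : 'I_h -> R) x := if ix x is Some k then v k else 1.
have omp x : om w' (p x) = om w x.
  case: x => [y|[k c]]; first by rewrite H1.
  have [k' [c' E]] := relabel_ins k c; rewrite E {1}/om /= /w'.
  suff -> : ix ((p^-1)%g (a k')) = ix (inr (k, c)) by [].
  case: c' E => E; last by rewrite /tail_dart -E permK.
  have -> : a k' = fl (p (inr (k, c))) by rewrite E fl_inr.
  by rewrite -H2 permK ix_flip.
exists w' => [i|j]; last by rewrite /w'; case: (ix _) => [k|].
have E (v : 'I_h -> R) rr : \sum_(q : 'I_h * bool | (place pc wh rr (inr q)).1 == i)
     color_sign R (place pc wh rr (inr q)).2 * v q.1 =
   \sum_(x in edge_darts P setT | (place pc wh rr x).1 == i) color_sign R (place pc wh rr x).2 * om v x.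
  rewrite -sum_ins; apply: eq_big => // -[k c] _; by rewrite /om.
rewrite E -fw E (reindex_inj (@perm_inj _ p)) /=; apply: eq_big => [x|x _].
  rewrite relabel_place; congr (_ && _).
  case: x => [y|[k c]]; first by rewrite H1.
  by have [k' [c' ->]] := relabel_ins k c; rewrite !inr_dts !in_setT.
by rewrite relabel_place omp.
Qed.

End Transfer.

Definition admissible r : Prop :=
  [/\ insertion r, is_connected (ins_graph r), faces_ok d1 d2 r & positive_flow r].

Lemma relabel_admissible p r r' : relabels p r r' -> admissible r -> admissible r'.
Proof.
move=> rp [ir conn fo fw]; split.
- exact: relabel_insertion rp ir.
- exact: relabel_connected rp conn.
- exact: relabel_faces_ok rp fo.
exact: relabel_flow rp ir fw.
Qed.

(** * The two canonical numberings of an insertion *)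

Section CanonicalLabeling.
Hypothesis piece_ex : forall i, exists y, pc y = i.

Section Rename.
Variables (f : 'I_h -> 'I_h) (s : 'I_h -> bool).
Hypothesis f_inj : injective f.

Definition rename_fun (x : D) : D :=
  match x with inl y => inl y | inr (k, c) => inr (f k, s k (+) c) end.

Lemma rename_inj : injective rename_fun.
Proof.
move=> [y|[k c]] [y'|[k' c']] //= [] // /f_inj -> ; by move/addbI ->.
Qed.

Definition rename : {perm D} := perm rename_inj.

Lemma rename_inl (y : P) : rename (inl y) = inl y. Proof. by rewrite permE. Qed.
Lemma rename_inr k c : rename (inr (k, c)) = inr (f k, s k (+) c). Proof. by rewrite permE. Qed.

Lemma rename_flip x : rename (fl x) = fl (rename x).
Proof.
case: x => [y|[k c]]; first by rewrite fl_inl !rename_inl fl_inl.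
by rewrite fl_inr !rename_inr fl_inr addbN.
Qed.

End Rename.

(** Without the edge [k0], which is not a bridge, the graph is still
    connected. Choose for each piece an edge which leads closer to the piece
    of one end of [k0], and [k0] for that piece. No edge is chosen twice,
    since it would lead closer in both directions. As there are as many
    edges as pieces, this renames the edges. *)
Lemma canonical_exists rf (k0 : 'I_h) : insertion rf -> is_connected (ins_graph rf) ->
  ~~ bridge (G := ins_graph rf) (ins_edge P k0) ->
  exists r', (exists p, relabels p rf r') /\ canonical pc wh r'.
Proof.
move=> ir conn nb; pose GG := ins_graph rf.
pose pl x := (place pc wh rf x).1.
pose root := pl (a k0).
pose e : rel 'I_h := fun i j => [exists q : 'I_h * bool,
  [&& (inr q : D) \notin ins_edge P k0, pl (inr q) == i & pl (fl (inr q)) == j]].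
have linkE x x' : @linked GG (ins_edge P k0) x x'.
  apply: (@linked_ind GG set0 (fun z => @linked GG (ins_edge P k0) x z)) (conn x x') (linked_refl _ _).
    by move=> z l; apply: linked_trans l (linked_rot _ _).
  move=> z _ l; apply: linked_trans l _.
  have [ze|zN] := boolP (z \in ins_edge P k0); last exact: (@linked_flip GG).
  by move: nb; rewrite (bridge_ins _ ze) negbK.
have conE i : connect e i root.
  have [y yi] := piece_ex i.
  have pli : pl (inl y) = i by rewrite /pl (place_inlE pc_rot wh_rot ir).
  apply: (@linked_ind GG (ins_edge P k0) (fun z => connect e i (pl z))) (linkE (inl y) (a k0)) _.
  - by move=> z; rewrite /pl (placeR pc_rot wh_rot ir).
  - case=> [v|q] zN; rewrite /pl /=.
      by rewrite fl_inl !(place_inlE pc_rot wh_rot ir) /= pc_flip.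
    move/connect_trans; apply; apply: connect1; apply/existsP; exists q.
    by rewrite zN !eqxx.
  by rewrite pli connect0.
have [dist dP] := descent conE.
have /fin_all_exists [q qP] i : exists q : 'I_h * bool, pl (inr q) = i /\
    (if i == root then q = (k0, false) else
     (inr q : D) \notin ins_edge P k0 /\ (dist (pl (fl (inr q))) < dist i)%N).
  have [->|ir'] := eqVneq i root; first by exists (k0, false).
  have [j /existsP [q /and3P[qN /eqP qi /eqP qj]] lt] := dP _ ir'.
  by exists q; rewrite qj.
pose f i := (q i).1; pose s i := (q i).2.
have f_inj : injective f.
  move=> i j fij; apply/eqP/negPn/negP => ij.
  have qj : fl (inr (q i)) = inr (q j).
    have [pi _] := qP i; have [pj _] := qP j; move: fij pi pj; rewrite /f.
    case: (q i) => ki ci; case: (q j) => kj cj /= <-; rewrite fl_inr.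
    case: (eqVneq ci cj) => [<- -> e'|]; first by rewrite e' eqxx in ij.
    by case: ci; case: cj.
  have qi : fl (inr (q j)) = inr (q i) by rewrite -qj flE.
  have inN k : (q k).1 = k0 -> (inr (q k) : D) \in ins_edge P k0.
    by case: (q k) => k' c /= ->; rewrite !inE; case: c; rewrite eqxx ?orbT.
  have [pi] := qP i; have [pj] := qP j; rewrite qi qj pi pj.
  case: (eqVneq i root) => [ir'|_]; case: (eqVneq j root) => [jr|_].
  - by rewrite ir' jr eqxx in ij.
  - move=> [/negP jN _] qi'; case: jN; apply: inN.
    by rewrite -[(q j).1]fij /f qi'.
  - move=> qj' [/negP iN _]; case: iN; apply: inN.
    by rewrite -[(q i).1]/(f i) fij /f qj'.
  by move=> [_ l1] [_ l2]; have := ltn_trans l1 l2; rewrite ltnn.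
pose gp := rename s f_inj.
have rel : relabels gp (gp * rf * gp^-1)%g rf.
  split=> x; rewrite ?rename_inl ?rename_flip //.
  by rewrite !permM permKV.
exists (gp * rf * gp^-1)%g; split; first by exists (gp^-1)%g; exact: relabelsV.
apply/forallP => i.
rewrite -(relabel_place rel); last first.
  by apply: (relabel_insertion (relabelsV rel)).
rewrite rename_inr addbF /f /s; have [pi _] := qP i.
by rewrite -surjective_pairing; apply/eqP.
Qed.

Section Reverse.
Variable rf : {perm D}.
Hypotheses (ir : insertion rf) (cr : canonical pc wh rf).
Local Notation tau := (target pc wh rf).
Hypothesis conn : tau_connected tau.
Variable i0 : 'I_h.

Definition shift k := if periodic tau k then tau k else k.

Lemma shift_inj : injective shift.
Proof.
move=> j k; rewrite /shift; case: ifP => pj; case: ifP => pk.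
- exact: periodic_inj.
- by move=> e; have := periodic_tau pj; rewrite e pk.
- by move=> e; have := periodic_tau pk; rewrite -e pj.
by [].
Qed.

Definition reversal : {perm D} := rename (periodic tau) shift_inj.

(** The edges of the cycle are reversed, and take the names of the pieces
    which they now leave. *)
Definition reversed : {perm D} := (reversal^-1 * rf * reversal)%g.

Lemma reversed_relabels : relabels reversal rf reversed.
Proof. by apply: relabels_conj => x; [exact: rename_inl | exact: rename_flip]. Qed.

Lemma reversed_canonical : canonical pc wh reversed.
Proof.
apply/forallP => j; have pl x := relabel_place reversed_relabels ir x.
have [pj|pj] := boolP (periodic tau j); last first.
  have -> : a j = reversal (a j) by rewrite rename_inr /shift (negbTE pj).
  by rewrite pl pl_tail.
have [k pk kj] : exists2 k, periodic tau k & tau k = j.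
  exists (iter (findex tau (tau j) j) tau j); first exact: periodic_iter.
  by rewrite -iterS iterSr; exact: iter_findex pj.
have -> : a j = reversal (b k) by rewrite rename_inr /shift pk kj.
by rewrite pl -[_.1]/(tau k) kj.
Qed.

(** Every vertex keeps a dart of [P], from which the other darts are reached
    by the rotation. *)
Lemma relabels_fixed p r : relabels p r r -> insertion r -> p = 1%g.
Proof.
move=> rp irr; apply/permP=> x; rewrite perm1.
have [y yx _] := attached pc_rot wh_rot irr x.
move: yx; rewrite porbit_sym => /porbitP [n ->].
by rewrite permX (relabel_iter rp); have [-> _ _] := rp.
Qed.

Lemma reversed_neq : reversed != rf.
Proof.
apply/eqP => E; have [k pk _] := exists_periodic tau i0.
have := relabels_fixed (_ : relabels reversal rf rf) ir.
rewrite -{2}E => /(_ reversed_relabels) /permP /(_ (a k)).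
by rewrite perm1 rename_inr pk.
Qed.

(** The name of an edge that is not reversed is the piece it leaves, so it
    does not change. An edge [k] which is reversed leaves [tau k], hence
    takes this name; so [tau k] is reversed too. The reversed edges form an
    invariant set on which [tau] is injective: none of them or the cycle. *)
Lemma canonical_pair p r' : relabels p rf r' -> canonical pc wh r' ->
  r' = rf \/ r' = reversed.
Proof.
move=> rp cr'; have ir' := relabel_insertion rp ir.
have pl x := relabel_place rp ir x; have [H1 H2 H3] := rp.
have step k : p (a k) = a k \/ p (a k) = b (tau k) /\ p (b k) = a (tau k).
  have [j [c E]] := relabel_ins rp k false; case: c E => E; last first.
    left; have := pl (a k); rewrite E -/(a j) !place_tail // => -[-> _] //.
  have Eb : p (b k) = a j by rewrite -[b k]flE fl_inr H2 E fl_inr.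
  have jE : j = tau k by have := pl (b k); rewrite Eb place_tail // place_head => -[].
  by right; rewrite -jE.
have stepb k : p (a k) = a k -> p (b k) = b k.
  by move=> e; rewrite -[b k]flE fl_inr H2 e fl_inr.
have r'E p' : p = p' -> r' = (p'^-1 * rf * p')%g.
  by move=> <-; apply/permP=> x; rewrite !permM H3 permKV.
pose K := [set k | p (a k) != a k].
have KP k : k \in K -> p (a k) = b (tau k) /\ p (b k) = a (tau k).
  by rewrite inE; case: (step k) => // ->; rewrite eqxx.
have [K0|K0] := eqVneq K set0.
  left; rewrite (r'E 1%g) ?invg1 ?mul1g ?mulg1 //.
  apply/permP=> -[y|[k c]]; rewrite perm1; first exact: H1.
  have ak : p (a k) = a k by apply/eqP/negPn/negP => kK; have := in_set0 k; rewrite -K0 inE kK.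
  by case: c => //; exact: stepb.
right; apply: r'E.
have KE : forall k, (k \in K) = periodic tau k.
  apply: (injective_invariant conn K0) => [k /KP [_ pb]|j k /KP [pj _] /KP [pk _] e].
    rewrite inE; apply/eqP => e; have : p (a (tau k)) = p (b k) by rewrite e pb.
    by move/perm_inj.
  have : p (a j) = p (a k) by rewrite pj pk e.
  by move/perm_inj; case.
apply/permP=> -[y|[k c]]; rewrite ?rename_inl ?H1 // rename_inr /shift -KE.
case: ifP => [/KP [pa pb]|/negbT]; first by case: c; [exact: pb | exact: pa].
rewrite inE negbK => /eqP ak; case: c => //=; exact: stepb.
Qed.

End Reverse.

End CanonicalLabeling.
End Relabel.

(** * The pieces *)

Lemma card_darts (G : ribbon_graph) : #|G| = (2 * #|edges G|)%N.
Proof.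
rewrite -[LHS]sum1_card (partition_big (fun x => edge_of x) (fun e => e \in edges G)) /=; last first.
  by move=> x _; apply: imset_f.
rewrite (eq_bigr (fun _ => 2)); first by rewrite sum_nat_const mulnC.
move=> e /imsetP [x _ ->]; rewrite (eq_bigl (fun y => y \in edge_of x)).
  by rewrite sum1_card edge_ofE cards2 eq_sym flip_neq.
by move=> y; rewrite /edge_of -eq_porbit_mem.
Qed.

Section Pieces.
Variables (h c : nat) (g : 'I_h -> nat) (G : 'I_h -> ribbon_graph).
Variable lab : {set disjoint_union G} -> 'I_(c + c).
Hypotheses (g_gt0 : forall i, (0 < g i)%N).
Hypothesis G_connected : forall i, is_connected (G i).
Hypothesis G_one_face : forall i, #|faces (G i)| = 1%N.
Hypothesis G_edges : forall i, #|edges (G i)| = (2 * g i - 1)%N.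
Hypothesis lab_pairing : vertex_pairing lab.

Local Notation P := (disjoint_union G).
Let pc : P -> 'I_h := @piece_of h G.
Definition white (x : P) : bool := ~~ black (lab (vertex_of x)).
Let w (i : 'I_h) := (4 * g i)%N.

Lemma piece_rot x : pc (Defs.rot P x) = pc x.
Proof. by rewrite /pc /piece_of /= permE. Qed.

Lemma piece_flip x : pc (flip P x) = pc x.
Proof. by rewrite /pc /piece_of /= permE. Qed.

Lemma white_rot x : white (Defs.rot P x) = white x.
Proof. by rewrite /white; have [-> _] := pairing_color lab_pairing (in_setT x). Qed.

Lemma white_flip x : white (flip P x) = ~~ white x.
Proof.
have [_ H] := pairing_color lab_pairing (in_setT x).
by rewrite /white H // inE.
Qed.

Lemma rot_tagged i (x : G i) : Defs.rot P (Tagged (fun i => G i : Type) x) =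
  Tagged (fun i => G i : Type) (Defs.rot (G i) x).
Proof. by rewrite /= permE. Qed.

Lemma flip_tagged i (x : G i) : flip P (Tagged (fun i => G i : Type) x) =
  Tagged (fun i => G i : Type) (flip (G i) x).
Proof. by rewrite /= permE. Qed.

Lemma linked_tagged i (x y : G i) :
  @linked P set0 (Tagged (fun i => G i : Type) x) (Tagged (fun i => G i : Type) y).
Proof.
apply: (@linked_ind (G i) set0 (fun z => @linked P set0 (Tagged (fun i => G i : Type) x) (Tagged (fun i => G i : Type) z)))
  (G_connected x y) (linked_refl _ _) => [z|z _] l; apply: linked_trans l _.
  by have := @linked_rot P set0 (Tagged (fun i => G i : Type) z); rewrite /= permE.
have := @linked_flip P set0 (Tagged (fun i => G i : Type) z); rewrite /= permE inE; exact.
Qed.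

Lemma piece_linked0 (x y : P) : pc x = pc y -> linked set0 x y.
Proof.
case: x => i x; case: y => j y; rewrite /pc /piece_of /= => e.
by case: j / e y => y; exact: (linked_tagged x y).
Qed.

Lemma one_face (x y : P) : pc x = pc y -> y \in porbit (flip P * Defs.rot P) x.
Proof.
case: x => i x; case: y => j y; rewrite /pc /piece_of /= => e; case: j / e y => y.
have E n : ((flip P * Defs.rot P) ^+ n)%g (Tagged (fun i => G i : Type) x) =
    Tagged (fun i => G i : Type) (((flip (G i) * Defs.rot (G i)) ^+ n)%g x).
  elim: n => [|n IH]; first by rewrite !expg0 !perm1.
  by rewrite !expgSr !permM IH flip_tagged rot_tagged.
have : y \in porbit (flip (G i) * Defs.rot (G i)) x.
  have /eqP/cards1P [F FE] := G_one_face i.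
  have Fx z : porbit (flip (G i) * Defs.rot (G i)) z = F.
    by apply/set1P; rewrite -FE; apply: imset_f.
  by rewrite Fx -(Fx y) porbit_id.
by move=> /porbitP [n ->]; apply/porbitP; exists n; rewrite E.
Qed.

Lemma card_piece_darts i : #|[set x | pc x == i]| = (4 * g i - 2)%N.
Proof.
have -> : [set x : P | pc x == i] = [set Tagged (fun i => G i : Type) x | x : G i].
  apply/setP=> -[j x]; rewrite inE; apply/eqP/imsetP => [|[y _ E]].
    by rewrite /pc /piece_of /= => e; case: i / e; exists x.
  by have := congr1 (@tag _ _) E.
rewrite card_imset; first by rewrite card_darts G_edges; have := g_gt0 i; lia.
by move=> x y E; have /eqP := E; rewrite eq_Tagged /= => /eqP.
Qed.

(** The two darts of an edge of a piece have different colors. *)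
Lemma card_white i e : #|[set x | site pc white x == (i, e)]|%:R = ((w i)%:R - 2) / 2 :> rat.
Proof.
pose S e := [set x | site pc white x == (i, e)].
have SE d : #|S d| = #|S (~~ d)|.
  rewrite -(card_imset (S d) (@perm_inj _ (flip P))); apply: eq_card => x.
  apply/imsetP/idP => [[y yS ->]|xS].
    by move: yS; rewrite /S !inE /site !xpair_eqE piece_flip white_flip; case: (_ == i) => //=; case: (white y); case: d.
  exists (flip P x); last by rewrite flipK.
  by move: xS; rewrite /S !inE /site !xpair_eqE piece_flip white_flip; case: (_ == i) => //=; case: (white x); case: d.
have tot : (#|S true| + #|S false|)%N = (4 * g i - 2)%N.
  rewrite -card_piece_darts -[LHS]/(#|S true| + #|S false|)%N.
  have -> : [set x | pc x == i] = S true :|: S false.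
    by apply/setP=> x; rewrite !inE /site !xpair_eqE; case: (pc x == i); case: (white x).
  rewrite cardsU (_ : S true :&: S false = set0) ?cards0 ?subn0 //.
  by apply/setP=> x; rewrite !inE /site !xpair_eqE; case: (pc x == i); case: (white x).
have Se : (2 * #|S e| + 2 = w i)%N.
  have := SE true; move: tot (g_gt0 i); rewrite /= /w.
  by case: (e); move: #|S true| #|S false| => m n; lia.
by rewrite -/(S e) -Se natrD natrM; field.
Qed.

Lemma piece_ex i : exists x, pc x = i.
Proof.
have : (0 < #|[set x | pc x == i]|)%N by rewrite card_piece_darts; have := g_gt0 i; lia.
by rewrite card_gt0 => /set0Pn [x]; rewrite inE => /eqP; exists x.
Qed.

Lemma label_piece : exists psi : 'I_c -> 'I_h, forall s (x : P),
  lab (vertex_of x) = lshift c s \/ lab (vertex_of x) = rshift c s -> pc x = psi s.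
Proof.
have /fin_all_exists [psi psiP] : forall s : 'I_c, exists i : 'I_h, forall x : P,
  lab (vertex_of x) = lshift c s \/ lab (vertex_of x) = rshift c s -> pc x = i; last by exists psi.
move=> s; have [v vV lv] := pairing_surj lab_pairing (lshift c s).
have /imsetP [x0 _ vE] := vV; exists (pc x0) => x.
have lx0 : lab (vertex_of x0) = lshift c s by rewrite /vertex_of -vE.
case=> lx; last exact/esym/(pairing_piece lab_pairing lx0 lx).
have : vertex_of x = vertex_of x0.
  by apply: (pairing_inj lab_pairing); rewrite ?lx ?lx0 // imset_f.
move=> /eqP; rewrite eq_porbit_mem => /porbitP [n ->].
by elim: n => [|n IH]; rewrite ?expg0 ?perm1 // expgSr permM piece_rot.
Qed.

Section Labels.
Variable psi : 'I_c -> 'I_h.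
Hypothesis psiP : forall s (x : P),
  lab (vertex_of x) = lshift c s \/ lab (vertex_of x) = rshift c s -> pc x = psi s.

(** The parameters of the white vertices of the piece [i] exceed those of
    its black ones by [t] times this number. *)
Definition deficit (i : 'I_h) : nat := (\sum_(s | psi s == i) 2 ^ s.+1)%N.

Lemma psi_surj i : exists s, psi s = i.
Proof.
have [x xi] := piece_ex i; case: (split_ordP (lab (vertex_of x))) => s lx.
  by exists s; rewrite -xi; apply/esym/psiP; left.
by exists s; rewrite -xi; apply/esym/psiP; right.
Qed.

(** The piece which contains the greatest label, since [2 ^ s.+1] exceeds
    the sum of all smaller such powers. *)
Lemma deficit_dominated (Q : {set 'I_h}) : Q != set0 ->
  exists2 M, M \in Q & (\sum_(i in Q :\ M) deficit i < deficit M)%N.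
Proof.
move=> /set0Pn [i iQ]; have [s0 s0i] := psi_surj i.
have s0Q : psi s0 \in Q by rewrite s0i.
have [s sQ smax] := @arg_maxnP _ s0 (fun s : 'I_c => psi s \in Q) (fun s : 'I_c => s : nat) s0Q.
exists (psi s) => //.
have -> : (\sum_(i in Q :\ psi s) deficit i = \sum_(t | psi t \in Q :\ psi s) 2 ^ t.+1)%N.
  rewrite [RHS](partition_big psi (fun i => i \in Q :\ psi s)) //=.
  apply: eq_bigr => j jQ; apply: eq_bigl => t.
  by case: eqP => [->|]; rewrite ?jQ ?andbF.
have le1 : (\sum_(t | psi t \in Q :\ psi s) 2 ^ t.+1 <= \sum_(t < c | (t < s)%N) 2 ^ t.+1)%N.
  rewrite big_mkcond [X in (_ <= X)%N]big_mkcond /=; apply: leq_sum => t _.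
  case: ifP => //; rewrite !inE => /andP[ts tQ].
  have -> // : (t < s)%N.
  rewrite ltn_neqAle; apply/andP; split; last exact: smax.
  by apply: contraNneq ts => /val_inj ->.
have le2 : (2 ^ s.+1 <= deficit (psi s))%N by rewrite /deficit (bigD1 s) //= leq_addr.
apply: leq_ltn_trans le1 (leq_trans _ le2).
rewrite -(big_mkord (fun t => (t < s)%N) (fun t => 2 ^ t.+1)%N).
have -> : (\sum_(0 <= t < c | (t < s)%N) 2 ^ t.+1 = \sum_(0 <= t < s) 2 ^ t.+1)%N.
  by rewrite (big_nat_widen 0 s c) //; exact: ltnW.
elim: (s : nat) => [|m IH]; first by rewrite big_geq.
by rewrite big_nat_recr //= [in X in (_ < X)%N]expnS; lia.
Qed.

Lemma piece_param (R : realType) (m : 'I_(c + c) -> R) i :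
  \sum_(y | pc y == i) color_sign R (white y) * dart_param (fun v => m (lab v)) y =
  \sum_(s | psi s == i) (m (rshift c s) - m (lshift c s)).
Proof.
pose l (y : P) := lab (vertex_of y).
have one k e : (forall y, l y = k -> white y = e) ->
    \sum_(y | l y == k) color_sign R (white y) * dart_param (fun v => m (lab v)) y = color_sign R e * m k.
  move=> we; have [v vV lv] := pairing_surj lab_pairing k.
  have /imsetP [x _ vE] := vV.
  have lE y : (l y == k) = (y \in v).
    rewrite vE -eq_porbit_mem -[porbit _ y]/(vertex_of y) -[porbit _ x]/(vertex_of x).
    apply/eqP/eqP => [ly|e']; last by rewrite /l e' /vertex_of -vE.
    by apply: (pairing_inj lab_pairing); rewrite ?imset_f // -[lab _]/(l y) ly -lv vE.
  have -> : m k = m (lab v) by rewrite lv.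
  rewrite -(dart_param_sum (fun v => m (lab v)) vV) mulr_sumr.
  by apply: eq_big => [y|y ly]; [rewrite lE | rewrite (we y) //; exact/eqP].
rewrite (partition_big l xpredT) //= big_split_ord /= sumrB addrC.
have P0 k s : (k = lshift c s \/ k = rshift c s) -> forall e, (forall y, l y = k -> white y = e) ->
  \sum_(y | (pc y == i) && (l y == k)) color_sign R (white y) * dart_param (fun v => m (lab v)) y =
  if psi s == i then color_sign R e * m k else 0.
  move=> ks e we; rewrite -(one k e we); case: ifP => si; last first.
    apply: big_pred0 => y; apply/negP => /andP[/eqP yi /eqP ly].
    by rewrite -yi (@psiP s) ?eqxx // in si; rewrite -/(l y) ly.
  apply: eq_bigl => y; case: (eqVneq (l y) k) => [ly|]; rewrite ?andbF // andbT.
  by rewrite (@psiP s) // -/(l y) ly.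
rewrite [in RHS]big_mkcond [X in _ = _ - X]big_mkcond -sumrN /=; congr (_ + _); apply: eq_bigr => s _.
  rewrite (P0 _ s _ true) ?mul1r //; first by right.
  by move=> y; rewrite /l /white => ->; rewrite /black /= ltnNge leq_addr.
rewrite (P0 _ s _ false); first by case: ifP; rewrite ?mulN1r ?oppr0.
  by left.
by move=> y; rewrite /l /white => ->; rewrite /black /= ltn_ord.
Qed.

End Labels.
End Pieces.

(** * Counting the classes *)

Section Assembly.
Variables (R : realType) (h c : nat) (g : 'I_h -> nat) (G : 'I_h -> ribbon_graph).
Variables (m1 m2 : int) (lab : {set disjoint_union G} -> 'I_(c + c)).
Variables (b : 'I_(c + c) -> R) (b' : R -> 'I_(c + c) -> R).
Hypotheses (g_gt0 : forall i, (0 < g i)%N).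
Hypothesis G_connected : forall i, is_connected (G i).
Hypothesis G_edges : forall i, #|edges (G i)| = (2 * g i - 1)%N.
Hypothesis lab_pairing : vertex_pairing lab.
Hypothesis b_generic : generic_on_wall b.
Hypothesis b'_degeneration : degeneration b b'.
Variables (d1 d2 : nat).
Hypotheses (d1E : d1%:Z = m1 + 2) (d2E : d2%:Z = m2 + 2) (d1_odd : odd d1).
Variable psi : 'I_c -> 'I_h.
Hypothesis psiP : forall s (x : disjoint_union G),
  lab (vertex_of x) = lshift c s \/ lab (vertex_of x) = rshift c s -> piece_of x = psi s.
Variable k0 : 'I_h.

Local Notation P := (disjoint_union G).
Local Notation D := (ins_dart P h).
Let pc : P -> 'I_h := @piece_of h G.
Let wh : P -> bool := white lab.
Let Dn : 'I_h -> nat := deficit psi.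
Let q (t : R) (v : {set P}) : R := b' t (lab v).
Let q0 (v : {set P}) : R := b (lab v).
Local Notation oci := (@one_cycle_insertion R h c G m1 m2 lab b b').
Local Notation admissible := (admissible pc wh R Dn d1 d2).
Implicit Types r rf : {perm D}.

Let pc_rot := @piece_rot h G.
Let pc_flip := @piece_flip h G.
Let wh_rot := white_rot lab_pairing.
Let wh_flip := white_flip lab_pairing.
Let piece_conn := piece_linked0 G_connected.
Let dominated := deficit_dominated g_gt0 G_edges psiP.

Let q_flow t : 0 <= t <= 1 -> forall i,
  \sum_(y | pc y == i) color_sign R (wh y) * dart_param (q t) y = t * (Dn i)%:R.
Proof.
move=> t01 i; rewrite (piece_param lab_pairing psiP (b' t)) /Dn /deficit natr_sum mulr_sumr.
by apply: eq_bigr => s _; rewrite (b'_degeneration.2 t t01 s) mulrC natrX.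
Qed.

Let q0_sum i : \sum_(y | pc y == i) color_sign R (wh y) * dart_param q0 y = 0.
Proof.
rewrite (piece_param lab_pairing psiP b) big1 // => s _.
by rewrite (b_generic.1 s) subrr.
Qed.

Let q_lim v : (q t v @[t --> 0^'+] --> q0 v)%classic.
Proof. exact: (b'_degeneration.1 (lab v)). Qed.

Lemma oci_faces_ok rf : (exists f1 f2 : {set ins_graph rf},
    [/\ f1 != f2, faces (ins_graph rf) = [set f1; f2],
        #|f1|%:Z = m1 + 2 & #|f2|%:Z = m2 + 2]) <-> faces_ok d1 d2 rf.
Proof.
split=> [[f1 [f2 [f12 fE f1E f2E]]]|/existsP [f1 /existsP [f2 /and4P [f12 /eqP fE /eqP f1E /eqP f2E]]]].
  apply/existsP; exists f1; apply/existsP; exists f2; apply/and4P; split=> //; first exact/eqP.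
    by apply/eqP; move: f1E; rewrite -d1E => -[].
  by apply/eqP; move: f2E; rewrite -d2E => -[].
by exists f1, f2; split=> //; rewrite ?f1E ?f2E.
Qed.

Lemma ins_edge_edges rf k : ins_edge P k \in edges (ins_graph rf).
Proof. by rewrite -(edge_of_ins rf k true); apply: imset_f. Qed.

Lemma oci_admissible rf : oci rf -> admissible rf.
Proof.
case=> /insertionP irf conn /oci_faces_ok fo st _ pos; split=> //.
apply: (static_positive_flow pc_rot wh_rot wh_flip piece_conn irf (q := q) q_flow) => //.
by move=> k; have [dg _] := (st _ (ins_edge_edges rf k)).1 (ex_intro _ k erefl).
Qed.

Lemma oci_nonbridge rf : oci rf -> exists k : 'I_h, ~~ bridge (G := ins_graph rf) (ins_edge P k).
Proof.
case=> _ _ _ _ [C [CE nb]] _.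
have [[|x p] [// _ pD _ _ CE']] := (CE C).2 erefl.
have /imsetP [[k e] _ xE] := pD x (mem_head _ _); exists k.
by apply: nb; rewrite CE' inE /= -(edge_of_ins rf k e) -xE mem_head.
Qed.

Lemma odd_face rf : faces_ok d1 d2 rf -> exists x : D, odd #|porbit (face_perm rf) x|.
Proof.
move=> /existsP [f1 /existsP [f2 /and4P [_ /eqP fE /eqP f1E _]]].
have /imsetP [x _ fx] : f1 \in porbits (face_perm rf) by rewrite fE set21.
by exists x; rewrite -fx f1E.
Qed.

Lemma admissible_oci rf : canonical pc wh rf -> admissible rf -> oci rf.
Proof.
move=> crf gd; have [irf conn fo [w fw w_gt0]] := gd.
have tc : tau_connected (target pc wh rf) by apply/(connected_tau pc_rot pc_flip wh_rot piece_conn irf crf).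
have sd k := canonical_static_data pc_rot pc_flip wh_rot wh_flip irf crf tc k (odd_face fo).
split=> //.
- exact/insertionP.
- exact/oci_faces_ok.
- exact: (degenerating_edges pc_rot pc_flip wh_rot wh_flip piece_conn irf (q := q) q_flow (q0 := q0) q0_sum q_lim sd fw).
- exists (cycle_edges pc wh rf); split.
    exact: (static_cycle pc_rot pc_flip wh_rot piece_conn irf crf tc k0).
  exact: (cycle_edges_nonbridge pc_rot wh_rot piece_conn irf crf).
move=> k t v t01 sv; have /andP[t0 t1] := t01.
have t01' : 0 <= t <= 1 by rewrite ltW.
rewrite (ins_weight_flow pc_rot wh_rot wh_flip piece_conn irf (q := q) q_flow t01' fw sv).
exact: mulr_gt0.
Qed.

(** By [explore_pos] the tests of the exploration are the positivity of the
    flow, which exists by [flow_exists]; and the exploration reaches all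
    pieces. *)
Lemma admissible_valid rf M : leader Dn [set: 'I_h] = Some M -> canonical pc wh rf ->
  admissible rf <-> valid pc wh Dn d1 d2 rf #|[set~ M]| set0 [set M] M true.
Proof.
move=> lM crf; have [|M' []] := leaderP dominated (Q := setT); first by apply/set0Pn; exists k0.
rewrite lM => -[<-] _ dM.
set tau := target pc wh rf.
have start := @chain_start _ Dn tau (tail_color pc wh rf) (head_color pc wh rf) set0 M _ _ _ R.
have {}start : chain_inv Dn tau (tail_color pc wh rf) (head_color pc wh rf) R set0 [set M] M M true xpredT.
  by apply: start => [k||]; rewrite ?setC0 ?inE.
have En : #|~: (set0 :|: [set M])| = #|[set~ M]| by rewrite set0U.
have all_k k : k \in M |: ~: (set0 :|: [set M]) by rewrite set0U !inE; case: (k == M).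
have conn irf := connected_tau pc_rot pc_flip wh_rot piece_conn irf crf.
split=> [[irf conn_rf fo [w /(flow_canonical crf) fw w_gt0]]|/and4P [irf _ fo ex]].
  apply/and4P; split=> //; apply/(explore_pos dominated fw _ En start) => [|k _]; last exact: w_gt0.
  exact/(conn irf).
have tc : tau_connected tau.
  move=> T tT /set0Pn [j jT]; apply/setP => i; rewrite inE.
  have E := explore_connected dominated tT En (set11 M) _ _ ex.
  have {}E i' : (i' \in T) = (M \in T).
    by apply: E => [? ?|?]; rewrite inE // => /eqP ->.
  by rewrite E -(E j).
have sd k := canonical_static_data pc_rot pc_flip wh_rot wh_flip irf crf tc k (odd_face fo).
have [w fw] := flow_exists pc_rot wh_rot wh_flip piece_conn irf (fun i => (Dn i)%:R : R) sd.
split=> //; first exact/(conn irf).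
exists w => // k; have /(flow_canonical crf) fw' := fw.
exact: (explore_pos dominated fw' tc En start).1.
Qed.

(** A class contains a canonical insertion, by [canonical_exists], and then
    the one with the cycle reversed, but no other. *)
Lemma class_card M (O := [set r | `[< oci r >]])
    (X := [set rf | valid pc wh Dn d1 d2 rf #|[set~ M]| set0 [set M] M true]) B :
  leader Dn [set: 'I_h] = Some M ->
  B \in equivalence_partition (@same_insertion P h) O -> #|B :&: X| = 2%N.
Proof.
move=> lM /imsetP [x]; rewrite inE => /asboolP ox ->.
have gx := oci_admissible ox; have [ix connx _ _] := gx; have [k nb] := oci_nonbridge ox.
have [r [[p px] cr]] := canonical_exists pc_rot pc_flip wh_rot (piece_ex g_gt0 G_edges) ix connx nb.
have gr : admissible r := relabel_admissible pc_rot wh_rot px gx; have [ir connr _ _] := gr.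
have tc : tau_connected (target pc wh r) by apply/(connected_tau pc_rot pc_flip wh_rot piece_conn ir cr).
have rr := reversed_relabels pc wh r.
have cr' := reversed_canonical pc_rot wh_rot ir cr.
have gr' := relabel_admissible pc_rot wh_rot rr gr.
have -> : [set y in O | same_insertion x y] :&: X = [set r; reversed pc wh r].
  apply/setP => y; rewrite !inE; apply/idP/idP.
    case/andP=> /andP[_ /same_insertionP [p' py]] /and4P [_ cy _ _].
    have [->|->] := canonical_pair pc_rot wh_rot ir cr tc (relabelsM (relabelsV px) py) cy.
      by rewrite eqxx.
    by rewrite eqxx orbT.
  have member z p' : relabels p' x z -> canonical pc wh z -> admissible z ->
      `[< oci z >] && same_insertion x z && valid pc wh Dn d1 d2 z #|[set~ M]| set0 [set M] M true.
    move=> pz cz gz; apply/andP; split; last exact/(admissible_valid lM cz).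
    apply/andP; split; first exact/asboolP/admissible_oci.
    by apply/same_insertionP; exists p'.
  by case/orP=> /eqP ->; apply: member => //; [exact: px | exact: relabelsM px rr].
by rewrite cards2 eq_sym reversed_neq.
Qed.

Lemma count_classes M : leader Dn [set: 'I_h] = Some M ->
  (2 * count_one_cycle m1 m2 lab b b' =
   #|[set rf | valid pc wh Dn d1 d2 rf #|[set~ M]| set0 [set M] M true]|)%N.
Proof.
move=> lM; set X := [set rf | _]; rewrite /count_one_cycle; set O := [set r | _].
have XO : X \subset O.
  apply/subsetP => r; rewrite !inE => vr; have /and4P [_ cr _ _] := vr.
  exact/asboolP/admissible_oci/(admissible_valid lM cr).
have part : partition (equivalence_partition (@same_insertion P h) O) O.
  by apply: equivalence_partitionP => x y z _ _ _; exact: same_insertion_equiv.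
have -> : #|X| = (\sum_(x in O | x \in X) 1)%N.
  by rewrite -sum1_card; apply: eq_bigl => x; rewrite -in_setI (setIidPr XO).
rewrite (set_partition_big_cond _ part) /= mulnC -sum_nat_const.
apply: eq_bigr => B BO; rewrite sum1dep_card -(class_card lM BO).
by apply: eq_card => x; rewrite !inE.
Qed.

End Assembly.

Theorem proposition6p7 (R : realType) (h : nat) (g : 'I_h -> nat) (m1 m2 : int)
    (c : nat) (G : 'I_h -> ribbon_graph)
    (lab : {set disjoint_union G} -> 'I_(c + c))
    (b : 'I_(c + c) -> R) (b' : R -> 'I_(c + c) -> R)
    (h_gt0 : (0 < h)%N)
    (g_gt0 : forall i, (0 < g i)%N)
    (m1_ge : -1 <= m1) (m2_ge : -1 <= m2)
    (m1_odd : ~~ (2 %| m1)%Z) (m2_odd : ~~ (2 %| m2)%Z)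
    (m12 : m1 + m2 = 4 * (\sum_i g i)%N%:Z - 4)
    (G_connected : forall i, is_connected (G i))
    (G_bipartite : forall i, bipartite (G i))
    (G_one_face : forall i, #|faces (G i)| = 1%N)
    (G_edges : forall i, #|edges (G i)| = (2 * g i - 1)%N)
    (lab_pairing : vertex_pairing lab)
    (b_generic : generic_on_wall b)
    (b'_degeneration : degeneration b b') :
  (count_one_cycle m1 m2 lab b b')%:R =
    vol g m1 m2 * \prod_(i < h) ((kappa (g i))%:R / 2) :> rat.
Proof.
have [d1 d1E] : exists d1 : nat, d1%:Z = m1 + 2 by exists `|(m1 + 2)%R|%N; lia.
have [d2 d2E] : exists d2 : nat, d2%:Z = m2 + 2 by exists `|(m2 + 2)%R|%N; lia.
have d1_odd : odd d1.
  by move: m1_odd; rewrite dvdzE; lia.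
have d1_gt0 : (0 < d1)%N by lia.
have d2_gt0 : (0 < d2)%N by lia.
have d12 : (d1 + d2 = weight (fun i : 'I_h => (4 * g i)%N) [set: 'I_h])%N.
  have -> : weight (fun i : 'I_h => (4 * g i)%N) [set: 'I_h] = (4 * \sum_i g i)%N.
    by rewrite /weight big_distrr /=; apply: eq_bigl => i; rewrite inE.
  by lia.
have d12_neq : d1 != d2 by move: d12; rewrite /weight; lia.
have [psi psiP] := label_piece lab_pairing.
pose k0 := Ordinal h_gt0.
have dominated := deficit_dominated g_gt0 G_edges psiP.
have [|M [lM _ _]] := leaderP dominated (Q := setT); first by apply/set0Pn; exists k0.
have w_gt2 i : (2 < 4 * g i)%N by have := g_gt0 i; lia.
have X_card := count_valid (@piece_rot h G) (@piece_flip h G) (white_rot lab_pairing)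
  (one_face G_one_face) (card_white g_gt0 G_edges lab_pairing) w_gt2 dominated
  d1_gt0 d2_gt0 d12_neq d12 lM.
have classes := count_classes g_gt0 G_connected G_edges lab_pairing b_generic b'_degeneration
  d1E d2E d1_odd psiP k0 lM.
move: X_card; rewrite -classes (vol_unicycles d1E d2E d1_gt0 d2_gt0 d12 M) natrM.
rewrite mulrCA => /(mulfI _) -> //; rewrite mulrC; congr (_ * _).
apply: eq_bigr => i _; rewrite /half /kappa natrB //.
by have := g_gt0 i; lia.
Qed.
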